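(* Let $X$ be a Lévy process with Lévy triplet $(b,\sigma^2,\nu)$, let $\Delta>0$ and let $n\ge 2$ be the number of observations. The cutoffs $m^\star$ achieving the squared bias-variance compromise (in the sense made precise in the context) are $$m^\star=\begin{cases}\sqrt{\dfrac{\log n}{\Delta\sigma^2}} & \text{if } (b,\sigma^2,\nu)\in\mathcal T_+,\\[2mm] \dfrac{\pi}{2}\Big(\dfrac{\log n}{M\Delta}\Big)^{1/\alpha} & \text{if } (b,\sigma^2,\nu)\in\mathcal T_{0,M,\alpha}\ \ (M>0,\ \alpha\in(0,2)).\end{cases}$$ Moreover, there exists a constant $C>0$, not depending on $n$, such that for all $n\ge 2$ $$\mathbb E\big[\|\hat f_{\Delta,m^\star}-f_\Delta\|^2\big]\le C\begin{cases}\dfrac{(\log n)^{1/2}}{\sigma^2\, n\,\Delta^{1/2}} & \text{if } (b,\sigma^2,\nu)\in\mathcal T_+,\\[2mm] \dfrac{(\log n)^{1/\alpha}}{n\,(M\Delta)^{1/\alpha}} & \text{if } (b,\sigma^2,\nu)\in\mathcal T_{0,M,\alpha}.\end{cases}$$ If $\Delta=\Delta_n\to 0$ as $n\to\infty$, the same results still hold (with $\Delta$ replaced by $\Delta_n$ and $C$ not depending on $n$).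
   Context: A Lévy process $X$ (with $X_0=0$ a.s.) with Lévy triplet $(b,\sigma^2,\nu)$, $b\in\mathbb R$, $\sigma\ge 0$, $\nu$ a Lévy measure (Borel measure on $\mathbb R$ with $\nu(\{0\})=0$, $\int_{\mathbb R}(x^2\wedge 1)\,\nu(dx)<\infty$), has characteristic function $$\phi_t(u)=\mathbb E[e^{iuX_t}]=\exp\Big(itub-\tfrac{t\sigma^2u^2}{2}+t\int_{\mathbb R}(e^{iux}-1-iux\mathbf 1_{|x|<1})\,\nu(dx)\Big).$$ For $M>0$ and $0<\alpha<2$, a Lévy density $p$ (density of $\nu$ with respect to Lebesgue measure) satisfies $(\mathcal A_{M,\alpha})$ if $\int_{[-\eta,\eta]}x^2p(x)\,dx\ge M\eta^{2-\alpha}$ for all $0<\eta\le 1$. Classes of triplets: $\mathcal T_+=\{(b,\sigma^2,\nu): b\in\mathbb R,\ \sigma^2>0,\ \nu\text{ a Lévy measure}\}$; $\mathcal T_{M,\alpha}=\{(b,\sigma^2,\nu): b\in\mathbb R,\ \sigma^2\ge0,\ \nu \text{ admits a Lévy density } p \text{ satisfying }(\mathcal A_{M,\alpha})\}$; $\mathcal T_{0,M,\alpha}=\mathcal T_{M,\alpha}\setminus\mathcal T_+$ (so $\sigma=0$). For triplets in these classes $X_\Delta$ has a Lebesgue density, denoted $f_\Delta$. The observations are the i.i.d. increments $X_{j\Delta}-X_{(j-1)\Delta}$, $j=1,\dots,n$. Set $$\hat\phi_{X_\Delta}(u)=\frac1n\sum_{j=1}^n e^{iu(X_{j\Delta}-X_{(j-1)\Delta})},\qquad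 \hat f_{\Delta,m}(x)=\frac1{2\pi}\int_{-m}^m\hat\phi_{X_\Delta}(u)e^{-iux}\,du,\quad m\geq 0.$$ $\|\cdot\|$ is the $L^2(\mathbb R)$ norm. Squared bias-variance compromise: $m^\star$ is the minimizer over $m\ge0$ of $b_j^2(m)+V(m)$, where $V(m)=\frac{m}{\pi n}$, with $j=1$ if the triplet is in $\mathcal T_+$ and $j=2$ if it is in $\mathcal T_{0,M,\alpha}$. Here $$b_1^2(m)=\frac1\pi\int_m^\infty e^{-\Delta\sigma^2u^2}\,du,\qquad b_2^2(m)=\frac{\Gamma\big(\frac1\alpha,(\frac{2m}{\pi})^\alpha M\Delta\big)}{2\alpha(M\Delta)^{1/\alpha}},$$ with $\Gamma(a,x)=\int_x^\infty z^{a-1}e^{-z}\,dz$. *)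

(* Defs.v *)
From HB Require Import structures.
From mathcomp Require Import all_boot all_order all_algebra.
From mathcomp Require Export complex.
From mathcomp Require Import all_classical all_reals all_analysis.

Set Implicit Arguments.
Unset Strict Implicit.
Unset Printing Implicit Defensive.

Import Order.TTheory GRing.Theory Num.Theory.
Import numFieldNormedType.Exports.

Local Open Scope classical_set_scope.
Local Open Scope ring_scope.

Section complex_analysis.
Context {R : realType}.

Definition cexp (z : R[i]) : R[i] :=
  (expR (complex.Re z) * cos (complex.Im z)
   +i* (expR (complex.Re z) * sin (complex.Im z)))%C.

(* [ciexp y] is e^{iy}. *)
Definition ciexp (y : R) : R[i] := cexp (0 +i* y)%C.

Definition cintegral d (T : measurableType d) (mu : {measure set T -> \bar R})
    (D : set T) (f : T -> R[i]) : R[i] :=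
  (\int[mu]_(x in D) complex.Re (f x) +i* \int[mu]_(x in D) complex.Im (f x))%C.

Definition L2norm_sq (g : R -> R[i]) : \bar R :=
  (('N[@lebesgue_measure R]_2%:E
      [EFin \o (@Normc.normc R \o g)]) ^+ 2)%E.

Definition upper_Gamma (a x : R) : R :=
  (\int[@lebesgue_measure R]_(z in `[x, +oo[) (z `^ (a - 1) * expR (- z)))%R.

End complex_analysis.

Section densities.
Context {R : realType}.

Definition has_density (mu : set (measurableTypeR R) -> \bar R)
    (f : R -> R) : Prop :=
  [/\ measurable_fun [set: measurableTypeR R] (f : measurableTypeR R -> R),
      forall x, 0 <= f x &
      forall A : set (measurableTypeR R), measurable A ->
        mu A = (\int[@lebesgue_measure R]_(x in A) (f x)%:E)%E].

Definition unique_minimizer_ge0 (g : R -> R) (m0 : R) : Prop :=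
  0 <= m0 /\ forall m, 0 <= m -> m != m0 -> g m0 < g m.

End densities.

Section levy_triplets.
Context (R : realType).

Definition levy_measure
    (nu : {measure set (measurableTypeR R) -> \bar R}) : Prop :=
  nu [set 0] = 0%E /\
  (\int[nu]_x (Num.min (x ^+ 2) 1)%:E < +oo)%E.

(* The triplet (b, sigma^2, nu), stored with sigma >= 0 instead of sigma^2. *)
Record levy_triplet := LevyTriplet {
  drift : R ;
  sigma : R ;
  levy_nu : {measure set (measurableTypeR R) -> \bar R} ;
  sigma_ge0 : 0 <= sigma ;
  levy_nuP : levy_measure levy_nu }.

Definition levy_exponent (tr : levy_triplet) (t u : R) : R[i] :=
  (0 +i* (t * u * drift tr))%C - (t * sigma tr ^+ 2 * u ^+ 2 / 2)%:C%C
  + t%:C%C *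
    cintegral (levy_nu tr) [set: measurableTypeR R]
      (fun x : R => ciexp (u * x) - 1
                    - (0 +i* (u * x * (`|x| < 1)%R%:R))%C).

Definition cond_A (M alpha : R) (p : R -> R) : Prop :=
  forall eta : R, 0 < eta <= 1 ->
    ((M * eta `^ (2 - alpha))%:E <=
     \int[@lebesgue_measure R]_(x in `[(- eta)%R, eta]) (x ^+ 2 * p x)%:E)%E.

Definition T_plus : set levy_triplet := [set tr | 0 < sigma tr ^+ 2].

Definition T_class (M alpha : R) : set levy_triplet :=
  [set tr | exists p : R -> R,
     has_density (levy_nu tr) p /\ cond_A M alpha p].

Definition T_zero (M alpha : R) : set levy_triplet :=
  T_class M alpha `\` T_plus.

End levy_triplets.

Section levy_processes.
Context {R : realType} {d : measure_display} {Omega : measurableType d}.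
Variable P : probability Omega R.

(* For a finite family, the product rule over all subfamilies follows from the
   product rule over the whole family by taking some of the [A i] full. *)
Definition independent_family (I : finType) (Y : I -> Omega -> R) : Prop :=
  forall A : I -> set (measurableTypeR R), (forall i, measurable (A i)) ->
    P (\bigcap_(i in [set: I]) (Y i @^-1` A i)) =
    (\prod_(i : I) P (Y i @^-1` A i))%E.

(* Only the values X t with 0 <= t are constrained (and used). *)
Definition levy_process (X : R -> {RV P >-> R}) : Prop :=
  [/\ {ae P, forall w, X 0 w = 0},
      forall (k : nat) (t : nat -> R),
        0 <= t 0%N -> (forall i, t i <= t i.+1) ->
        independent_family (fun (i : 'I_k) w => X (t i.+1) w - X (t i) w),
      forall s t : R, 0 <= s -> 0 <= t ->
        forall A : set (measurableTypeR R), measurable A ->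
          P ((fun w => X (s + t) w - X s w) @^-1` A) = P (X t @^-1` A),
      forall s e : R, 0 <= s -> 0 < e ->
        P [set w | e < `|X t w - X s w|]
          @[t --> within [set t : R | 0 <= t] (nbhs s)] --> 0%E &
      {ae P, forall w,
         (forall t : R, 0 <= t -> X s w @[s --> t^'+] --> X t w) /\
         (forall t : R, 0 < t -> cvg (X s w @[s --> t^'-]))}].

Definition has_triplet (X : R -> {RV P >-> R}) (tr : levy_triplet R) : Prop :=
  forall t u : R, 0 <= t ->
    cintegral P [set: Omega] (fun w => ciexp (u * X t w)) =
    cexp (levy_exponent tr t u).

(* The increments X_{j Delta} - X_{(j-1) Delta} for j = 1, ..., n are indexed
   by [j < n], that is, shifted by one. *)
Definition phi_hat (X : R -> {RV P >-> R}) (Delta : R) (n : nat) (w : Omega)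
    (u : R) : R[i] :=
  (n%:R : R[i])^-1 *
  \sum_(j < n) ciexp (u * (X (j.+1%:R * Delta) w - X (j%:R * Delta) w)).

Definition f_hat (X : R -> {RV P >-> R}) (Delta : R) (n : nat) (m : R)
    (w : Omega) (x : R) : R[i] :=
  (2 * pi)^-1%:C%C *
  cintegral (@lebesgue_measure R) `[- m, m]
    (fun u : R => phi_hat X Delta n w u * ciexp (- (u * x))).

(* E || f_hat_{Delta, m} - f ||^2, which may a priori be infinite. *)
Definition L2risk (X : R -> {RV P >-> R}) (Delta : R) (n : nat) (m : R)
    (f : R -> R) : \bar R :=
  (\int[P]_w L2norm_sq (fun x => f_hat X Delta n m w x - (f x)%:C%C)%R)%E.

End levy_processes.

Section bias_variance.
Context {R : realType}.

Definition variance_bound (n : nat) (m : R) : R := m / (pi * n%:R).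

Definition bias1_sq (Delta sg m : R) : R :=
  pi^-1 * (\int[@lebesgue_measure R]_(u in `[m, +oo[)
             expR (- (Delta * sg ^+ 2 * u ^+ 2)))%R.

Definition bias2_sq (Delta M alpha m : R) : R :=
  upper_Gamma alpha^-1 ((2 * m / pi) `^ alpha * M * Delta)
  / (2 * alpha * (M * Delta) `^ alpha^-1).

Definition cutoff1 (Delta sg : R) (n : nat) : R :=
  Num.sqrt (ln n%:R / (Delta * sg ^+ 2)).

Definition cutoff2 (Delta M alpha : R) (n : nat) : R :=
  pi / 2 * (ln n%:R / (M * Delta)) `^ alpha^-1.

Definition rate1 (Delta sg : R) (n : nat) : R :=
  Num.sqrt (ln n%:R) / (sg ^+ 2 * n%:R * Num.sqrt Delta).

Definition rate2 (Delta M alpha : R) (n : nat) : R :=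
  (ln n%:R) `^ alpha^-1 / (n%:R * (M * Delta) `^ alpha^-1).

End bias_variance.

(* Main.v *)
Require Import Defs.
From HB Require Import structures.
From mathcomp Require Import all_boot all_order all_algebra.
From mathcomp Require Import all_classical all_reals all_analysis.
From mathcomp Require Import measurable_realfun ring lra.
Set Implicit Arguments.
Unset Strict Implicit.
Unset Printing Implicit Defensive.
Import Order.TTheory GRing.Theory Num.Theory.
Import numFieldNormedType.Exports.
Local Open Scope classical_set_scope.
Local Open Scope ring_scope.

(** Both assertions are statements about one function. Let [stretched_exp kap a]
be the function sending [u] to exp(- kap u^a), and [tail_mass kap a m] its
integral over [m, +oo[ divided by pi. The two squared bias terms are tail
masses: the first with a = 2 and kap = Delta sigma^2 by definition, the second
with a = alpha and kap = M Delta (2/pi)^alpha through the substitution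
z = kap u^a in the incomplete Gamma function ([upper_GammaE]). The derivative of
tail mass plus variance is (1/n - exp(- kap m^a)) / pi, which changes sign once,
at m* = (log n / kap)^(1/a); this is the cutoff in both cases
([tail_mass_minimizer]).

For the risk, the estimator is the empirical mean of a window kernel K shifted
by the increments, K being the inverse Fourier transform of the indicator of
[-m, m]. Expanding the square at a fixed point, where the cross terms vanish by
pairwise independence, and then integrating over the line bounds the risk by the
energy of the bias plus the energy of K over n. Both energies are bounded by the
Plancherel inequality: the first is at most (2 pi)^-1 times the
integral of |phi|^2 over |u| > m, the second at most m / (pi n)
([projection_risk_le]).

Plancherel and Fourier inversion are established here for real trigonometric
integrals G(x) = int a(u) cos(ux) + b(u) sin(ux) du with a, b integrable, a and b
being E cos(uY) and E sin(uY) for the characteristic function of Y. Inserting the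
weight exp(- eps |x|) makes every exchange of integrals legitimate and turns
products of waves into Poisson kernels. The total mass 2 pi of these kernels gives
int G^2 <= 2 pi int (a^2 + b^2) by a Schur test ([plancherel_le]), and their concentration at the origin identifies the density
of Y with G / (2 pi) ([fourier_inversion]).

It remains to bound |phi|^2 = exp(- t sigma^2 u^2 - 2 t int (1 - cos(ux)) nu(dx)).
A Gaussian part gives exp(- t sigma^2 u^2) for all u. For the other class,
1 - cos y >= 2 y^2 / pi^2 on [-pi, pi] and the lower bound on the truncated second
moment at eta = pi / |u| give exp(- kap |u|^alpha), but only for |u| >= pi, where
eta <= 1. So the risk is at most the tail mass plus the variance, plus 1 when
m* < pi. At m* the tail mass is at most a constant times the variance
([tail_mass_critical_le]), which is the claimed rate; and m* < pi forces
log n < 2^alpha M Delta, hence, Delta being bounded, only finitely many n are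
concerned and for these the rate is bounded below ([small_cutoff_rate]). *)

(** * Integrals on products and under reflection *)

Section product_integrals.
Context d1 d2 (T1 : measurableType d1) (T2 : measurableType d2) (R : realType).
Variable m1 : {sigma_finite_measure set T1 -> \bar R}.
Variable m2 : {sigma_finite_measure set T2 -> \bar R}.
Variables (f : T1 * T2 -> R) (g : T1 -> R) (h : T2 -> R).
Hypothesis mf : measurable_fun [set: T1 * T2] f.
Hypothesis ig : m1.-integrable [set: T1] (EFin \o g).
Hypothesis ih : m2.-integrable [set: T2] (EFin \o h).
Hypothesis fgh : forall x y, `|f (x, y)| <= g x * h y.

(** A bound by a product of integrable functions of one variable each is the
form in which all the double integrals below are dominated; it makes every
section integrable, not only almost every one, so that the real-valued inner
integrals never take a default value. *)
Lemma integrable_sectionl x : m2.-integrable [set: T2] (fun y => (f (x, y))%:E).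
Proof.
apply: (le_integrable measurableT _ _ (integrableZl measurableT (g x) ih)).
  by apply/measurable_EFinP; exact: measurableT_comp mf (pair1_measurable x).
move=> y _ /=; rewrite lee_fin (le_trans (fgh x y))//.
exact: ler_norm.
Qed.

Lemma integrable_sectionr y : m1.-integrable [set: T1] (fun x => (f (x, y))%:E).
Proof.
apply: (le_integrable measurableT _ _ (integrableZl measurableT (h y) ig)).
  by apply/measurable_EFinP; exact: measurableT_comp mf (pair2_measurable y).
move=> x _ /=; rewrite lee_fin (le_trans (fgh x y))// mulrC.
exact: ler_norm.
Qed.

Lemma integrable_tensor : (m1 \x m2)%E.-integrable [set: T1 * T2] (EFin \o f).
Proof.
have mEf : measurable_fun [set: T1 * T2] (EFin \o f) by exact/measurable_EFinP.
apply/integrable12ltyP => //.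
have /integrableP[mg gfin] := ig; have /integrableP[mh hfin] := ih.
set H := (\int[m2]_y `|(EFin \o h) y|)%E.
have H0 : (0 <= H)%E by apply: integral_ge0.
apply: (@le_lt_trans _ _ (\int[m1]_x (`|(EFin \o g) x| * H))%E); last first.
  rewrite ge0_integralZr//; last exact: measurableT_comp.
  have G0 : (0 <= \int[m1]_x `|(EFin \o g) x|)%E by exact: integral_ge0.
  by rewrite lte_mul_pinfty// ge0_fin_numE.
apply: ge0_le_integral => //.
- by move=> x _; exact: integral_ge0.
- apply: (measurable_fun_fubini_tonelli_F (fun z => `|(EFin \o f) z|)%E) => //.
  exact: measurableT_comp.
- by apply: emeasurable_funM => //; exact: measurableT_comp.
move=> x _; rewrite -ge0_integralZl//; last exact: measurableT_comp.
apply: ge0_le_integral => //.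
- apply: measurableT_comp => //.
  exact: measurableT_comp mEf (pair1_measurable x).
- by apply: emeasurable_funM => //; exact: measurableT_comp.
- move=> y _ /=; rewrite -EFinM lee_fin (le_trans (fgh x y))//.
  by rewrite -normrM ler_norm.
Qed.

Lemma Rintegral_swap :
  \int[m1]_x (\int[m2]_y f (x, y)) = \int[m2]_y (\int[m1]_x f (x, y)).
Proof.
have E1 x : ((\int[m2]_y f (x, y))%:E = \int[m2]_y (f (x, y))%:E)%E.
  by rewrite fineK//; apply: integrable_fin_num => //; exact: integrable_sectionl.
have E2 y : ((\int[m1]_x f (x, y))%:E = \int[m1]_x (f (x, y))%:E)%E.
  by rewrite fineK//; apply: integrable_fin_num => //; exact: integrable_sectionr.
rewrite {1}/Rintegral [in RHS]/Rintegral; congr fine.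
rewrite (eq_integral (fun x => \int[m2]_y (f (x, y))%:E)%E); last first.
  by move=> x _; rewrite E1.
rewrite [in RHS](eq_integral (fun y => \int[m1]_x (f (x, y))%:E)%E); last first.
  by move=> y _; rewrite E2.
exact: (Fubini integrable_tensor).
Qed.

Lemma integrable_Rintegral_sectionl :
  m1.-integrable [set: T1] (fun x => (\int[m2]_y f (x, y))%:E).
Proof.
apply: eq_integrable (integrable_fubini_F integrable_tensor) => // x _.
rewrite fineK//; apply: integrable_fin_num => //; exact: integrable_sectionl.
Qed.

Lemma integrable_Rintegral_sectionr :
  m2.-integrable [set: T2] (fun y => (\int[m1]_x f (x, y))%:E).
Proof.
have iG : m2.-integrable [set: T2] (fun y => (\int[m1]_x (f (x, y))%:E)%E).
  apply/integrableP; split; first exact: measurable_fubini_G integrable_tensor.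
  apply: (@le_lt_trans _ _ (\int[m2]_y \int[m1]_x `|(f (x, y))%:E|)%E); last first.
    move: integrable_tensor => /integrable21ltyP; apply.
    exact/measurable_EFinP.
  apply: ge0_le_integral => //.
  - by apply: measurableT_comp => //; exact: measurable_fubini_G integrable_tensor.
  - apply: (measurable_fun_fubini_tonelli_G (fun z => `|(EFin \o f) z|)%E) => //.
    by apply: measurableT_comp => //; exact/measurable_EFinP.
  - move=> y _; apply: le_abse_integral => //.
    by apply/measurable_EFinP; exact: measurableT_comp mf (pair2_measurable y).
apply: eq_integrable iG => // y _.
rewrite fineK//; apply: integrable_fin_num => //; exact: integrable_sectionr.
Qed.

End product_integrals.

Section reflection.
Context {R : realType}.
Notation mu := (@lebesgue_measure R).

Lemma ge0_integral_oppr (f : R -> \bar R) :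
  measurable_fun [set: R] f -> (forall x, 0 <= f x)%E ->
  (\int[mu]_x f (- x)%R = \int[mu]_x f x)%E.
Proof.
move=> mf f0.
rewrite -[RHS](@eq_measure_integral _ _ _ _ _ (pushforward mu (-%R : _ -> measurableTypeR R)))//=.
  by rewrite ge0_integral_pushforward.
by move=> A mA _; exact: lebesgue_measureN.
Qed.

Lemma Rintegral_oppr (f : R -> R) : measurable_fun [set: R] f ->
  \int[mu]_x f (- x) = \int[mu]_x f x.
Proof.
move=> mf; rewrite /Rintegral; congr fine.
rewrite [LHS]integralE [RHS]integralE; congr (_ - _)%E.
  rewrite -[RHS]ge0_integral_oppr//; first by apply: eq_integral => x _; rewrite ?funeposE ?funenegE.
  by apply: measurable_funepos; exact/measurable_EFinP.
rewrite -[RHS]ge0_integral_oppr//; first by apply: eq_integral => x _; rewrite ?funeposE ?funenegE.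
by apply: measurable_funeneg; exact/measurable_EFinP.
Qed.

Lemma Rintegral_odd (f : R -> R) : mu.-integrable [set: R] (EFin \o f) ->
  (forall x, f (- x) = - f x) -> \int[mu]_x f x = 0.
Proof.
move=> intf fN.
have mf : measurable_fun [set: R] f.
  by apply/measurable_EFinP; exact: measurable_int intf.
have := Rintegral_oppr mf.
under eq_Rintegral do rewrite fN -mulN1r.
rewrite RintegralZl//; lra.
Qed.

Lemma ge0_integral_even (f : R -> R) : measurable_fun [set: R] f ->
  (forall x, 0 <= f x) -> (forall x, f (- x) = f x) ->
  (\int[mu]_x (f x)%:E = 2%:E * \int[mu]_(x in `[0%R, +oo[) (f x)%:E)%E.
Proof.
move=> mf f0 fN.
have mEf : measurable_fun [set: R] (EFin \o f) by exact/measurable_EFinP.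
rewrite -(setUv `[0%R, +oo[) ge0_integral_setU//=; last 4 first.
- exact: measurableC.
- exact: measurable_funTS.
- by move=> x _; rewrite lee_fin.
- exact/disj_setPCl.
rewrite setCitvr addeC.
rewrite integral_itv_bndo_bndc; last exact: measurable_funTS.
rewrite mule_natl mule2n; congr +%E.
rewrite (@ge0_integration_by_substitution0 _ (EFin \o f))//.
by apply: eq_integral => x _ /=; rewrite fN.
Qed.

End reflection.

(** * The Poisson kernel *)

Section antiderivatives.
Context {R : realType}.
Notation mu := (@lebesgue_measure R).

Lemma integral_is_derive (f F : R -> R) (a b : R) : a <= b ->
  continuous f -> (forall x, is_derive x (1 : R) F (f x)) ->
  (\int[mu]_(x in `[a, b]) (f x)%:E = (F b - F a)%:E)%E.
Proof.
rewrite le_eqVlt => /predU1P[-> | ab] cf dF.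
  by rewrite set_itv1 integral_set1 subrr.
have cF : continuous F.
  by move=> x; apply/differentiable_continuous/derivable1_diffP; case: (dF x).
rewrite (@continuous_FTC2 _ f F)//.
- exact: continuous_subspaceT.
- split => [x _||]; first by case: (dF x).
  + exact/cvg_at_right_filter/cF.
  + exact/cvg_at_left_filter/cF.
- by move=> x _; rewrite derive1E; case: (dF x).
Qed.

Lemma ge0_integral_is_derivey (f F : R -> R) (a l : R) :
  (forall x, a <= x -> 0 <= f x) -> continuous f ->
  (forall x, is_derive x (1 : R) F (f x)) -> F x @[x --> +oo] --> l ->
  (\int[mu]_(x in `[a, +oo[) (f x)%:E = (l - F a)%:E)%E.
Proof.
move=> f0 cf dF Fl.
have cF : continuous F.
  by move=> x; apply/differentiable_continuous/derivable1_diffP; case: (dF x).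
rewrite (@ge0_continuous_FTC2y _ f F _ l)//.
- exact: continuous_subspaceT.
- exact/cvg_at_right_filter/cF.
- by move=> x _; rewrite derive1E; case: (dF x).
Qed.

End antiderivatives.

Section poisson_kernel.
Context {R : realType}.
Notation mu := (@lebesgue_measure R).

(** Cosine and sine are not integrable; this weight makes them so, and tends to
1 as [eps] tends to 0. *)
Definition exp_weight (eps x : R) : R := expR (- (eps * `|x|)).

(** The Poisson kernel of the half plane without its normalisation: the Fourier
transform of [exp_weight eps], of total mass 2 pi. *)
Definition poisson (eps u : R) : R := 2 * eps / (eps ^+ 2 + u ^+ 2).

Lemma poisson_ge0 eps u : 0 <= eps -> 0 <= poisson eps u.
Proof.
by move=> e0; rewrite /poisson divr_ge0 ?mulr_ge0// addr_ge0 ?sqr_ge0.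
Qed.

Lemma poisson_le eps u : 0 < eps -> `|poisson eps u| <= 2 / eps.
Proof.
move=> e0; rewrite ger0_norm; last by rewrite poisson_ge0// ltW.
rewrite /poisson.
have D0 : 0 < eps ^+ 2 + u ^+ 2 by rewrite ltr_wpDr ?sqr_ge0// exprn_gt0.
rewrite ler_pdivrMr// mulrAC ler_pdivlMr// -mulrA ler_pM2l//.
by rewrite -expr2 lerDl sqr_ge0.
Qed.

Lemma continuous_poisson eps : 0 < eps -> continuous (poisson eps).
Proof.
move=> e0 u; apply: cvgM; first exact: cvg_cst.
apply: cvgV; first by rewrite gt_eqF// ltr_wpDr ?sqr_ge0// exprn_gt0.
by apply: cvgD; [exact: cvg_cst|exact: exprn_continuous].
Qed.

Lemma continuous_exp_weight eps : continuous (exp_weight eps).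
Proof.
move=> x; apply: (@continuous_comp _ _ _ (fun y => - (eps * `|y|)) expR).
  by apply: cvgN; apply: cvgM; [exact: cvg_cst|exact: norm_continuous].
exact: continuous_expR.
Qed.

Lemma exp_weightN eps x : exp_weight eps (- x) = exp_weight eps x.
Proof. by rewrite /exp_weight normrN. Qed.

Lemma continuous_cosM (u : R) : continuous (fun x => cos (u * x)).
Proof.
move=> x; apply: (@continuous_comp _ _ _ (fun y => u * y) cos).
  exact: mulrl_continuous.
exact: continuous_cos.
Qed.

Lemma continuous_sinM (u : R) : continuous (fun x => sin (u * x)).
Proof.
move=> x; apply: (@continuous_comp _ _ _ (fun y => u * y) sin).
  exact: mulrl_continuous.
exact: continuous_sin.
Qed.

(** Adding 1 to the cosine makes the integrand nonnegative and even, so that its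
integral over a half line is obtained from an explicit antiderivative without
knowing integrability beforehand; the latter is deduced from the present
formula. *)
Lemma integral_exp_cosD1 (eps u : R) : 0 < eps ->
  (\int[mu]_x (exp_weight eps x * (1 + cos (u * x)))%:E =
   (2 / eps + poisson eps u)%:E)%E.
Proof.
move=> e0.
have cf : continuous (fun x => exp_weight eps x * (1 + cos (u * x))).
  move=> x; apply: cvgM; first exact: continuous_exp_weight.
  by apply: cvgD; [exact: cvg_cst|exact: continuous_cosM].
rewrite ge0_integral_even//; last 3 first.
- exact: continuous_measurable_fun.
- by move=> x; rewrite mulr_ge0// expR_ge0.
- by move=> x; rewrite exp_weightN mulrN cosN.
(* the antiderivative of exp(- eps x) (1 + cos(u x)) *)
pose F : R -> R := (expR \o (( - eps) \*: (@id R : R -> R))) *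
  (cst (- eps^-1) + (eps ^+ 2 + u ^+ 2)^-1 \*:
     (u \*: (sin \o (u \*: (@id R : R -> R))) - eps \*: (cos \o (u \*: (@id R : R -> R))))).
pose g x := expR (- eps * x) * (1 + cos (u * x)).
have D0 : 0 < eps ^+ 2 + u ^+ 2 by rewrite ltr_wpDr ?sqr_ge0// exprn_gt0.
have dF x : is_derive x (1 : R) F (g x).
  rewrite /F; apply: is_derive_eq.
  rewrite /g /= !fctE /GRing.scale /= /GRing.scale /=.
  field.
  by rewrite !gt_eqF.
have -> : (\int[mu]_(x in `[0%R, +oo[) (exp_weight eps x * (1 + cos (u * x)))%:E =
           \int[mu]_(x in `[0%R, +oo[) (g x)%:E)%E.
  apply: eq_integral => x; rewrite inE/= in_itv/= andbT => x0.
  by rewrite /g /exp_weight ger0_norm// mulNr.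
rewrite (@ge0_integral_is_derivey _ g F 0 0)//.
- rewrite /F !fctE /= /GRing.scale /= !mulr0 expR0 sin0 cos0 /poisson -EFinM.
  congr EFin; field.
  by rewrite !gt_eqF.
- by move=> x _; rewrite mulr_ge0// expR_ge0.
- move=> x; apply: cvgM; last first.
    by apply: cvgD; [exact: cvg_cst|exact: continuous_cosM].
  apply: (@continuous_comp _ _ _ (fun y => - eps * y) expR).
    exact: mulrl_continuous.
  exact: continuous_expR.
- pose C := eps^-1 + (eps ^+ 2 + u ^+ 2)^-1 * (`|u| + eps).
  have expy : expR (- (eps * x)) @[x --> +oo] --> (0 : R).
    apply: (@cvg_comp _ _ _ (fun x => eps * x) (fun y : R => expR (- y)) _ +oo).
      by apply: gt0_cvgMry => //; exact: cvg_id.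
    exact: cvgr_expR.
  have expyC : C * expR (- (eps * x)) @[x --> +oo] --> (0 : R).
    by rewrite -(mulr0 C); apply: cvgMr.
  apply: (squeeze_cvgr (f := fun x => - (C * expR (- (eps * x))))
    (h := fun x => C * expR (- (eps * x)))) => //; last first.
    by rewrite -[X in _ --> X]oppr0; exact: cvgN.
  near=> x.
  rewrite -ler_norml /F !fctE /= /GRing.scale /= mulNr normrM.
  rewrite ger0_norm ?expR_ge0// mulrC.
  apply: ler_wpM2r; first exact: expR_ge0.
  apply: (le_trans (ler_normD _ _)); rewrite normrN ger0_norm; last first.
    by rewrite invr_ge0 ltW.
  rewrite lerD2l normrM ger0_norm; last by rewrite invr_ge0 ltW.
  apply: ler_wpM2l; first by rewrite invr_ge0 ltW.
  apply: (le_trans (ler_normB _ _)); rewrite !normrM (gtr0_norm e0).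
  by apply: lerD; [rewrite ler_piMr// sin_max|apply: ler_piMr; [exact: ltW|exact: cos_max]].
Unshelve. all: end_near.
Qed.

Lemma integrable_exp_weight eps : 0 < eps ->
  mu.-integrable [set: R] (EFin \o exp_weight eps).
Proof.
move=> e0; apply/integrableP; split.
  by apply/measurable_EFinP; apply: continuous_measurable_fun; exact: continuous_exp_weight.
have := integral_exp_cosD1 0 e0.
under eq_integral do rewrite mul0r cos0.
move=> E; apply: (@le_lt_trans _ _ (2 / eps + poisson eps 0)%:E); last exact: ltry.
rewrite -E; apply: ge0_le_integral => //.
- apply: measurableT_comp => //; apply/measurable_EFinP.
  by apply: continuous_measurable_fun; exact: continuous_exp_weight.
- apply/measurable_EFinP; apply: measurable_funM => //.
  by apply: continuous_measurable_fun; exact: continuous_exp_weight.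
- move=> x _; rewrite /= lee_fin ger0_norm ?expR_ge0//.
  by rewrite ler_peMr ?expR_ge0// lerDl.
Qed.

(** [exp_weight] decays and the trigonometric factor is bounded, so every such
product is integrable. *)
Lemma integrable_exp_weightM (eps : R) (h : R -> R) : 0 < eps ->
  continuous h -> (forall x, `|h x| <= 1) ->
  mu.-integrable [set: R] (fun x => (exp_weight eps x * h x)%:E).
Proof.
move=> e0 ch h1; apply: le_integrable (integrable_exp_weight e0) => //.
  apply/measurable_EFinP; apply: continuous_measurable_fun => x.
  by apply: cvgM; [exact: continuous_exp_weight|exact: ch].
move=> x _ /=; rewrite lee_fin normrM (ger0_norm (expR_ge0 _)).
by rewrite ler_piMr// expR_ge0.
Qed.

(** Obtained by subtracting from the formula for 1 + cos(ux) its half at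
[u = 0]. *)
Lemma Rintegral_exp_weight_cos (eps u : R) : 0 < eps ->
  \int[mu]_x (exp_weight eps x * cos (u * x)) = poisson eps u.
Proof.
move=> e0.
have icos v : mu.-integrable [set: R] (fun x => (exp_weight eps x * cos (v * x))%:E).
  by apply: integrable_exp_weightM => //;
    [exact: continuous_cosM|move=> x; exact: cos_max].
have D1 v : \int[mu]_x (exp_weight eps x) + \int[mu]_x (exp_weight eps x * cos (v * x)) =
    2 / eps + poisson eps v.
  rewrite -RintegralD//; [|exact: integrable_exp_weight|exact: icos].
  rewrite /Rintegral -[RHS]/(fine (2 / eps + poisson eps v)%:E).
  rewrite -integral_exp_cosD1//; congr fine; apply: eq_integral => x _.
  by rewrite mulrDr mulr1.
have E0 : poisson eps 0 = 2 / eps.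
  by rewrite /poisson expr0n addr0; field; rewrite gt_eqF.
have D10 : \int[mu]_x (exp_weight eps x) + \int[mu]_x (exp_weight eps x) =
    2 / eps + 2 / eps.
  rewrite -[X in _ = _ + X]E0 -(D1 0); congr (_ + _).
  by apply: eq_Rintegral => x _; rewrite mul0r cos0 mulr1.
have solve_sum (I J p q : R) : I + I = q + q -> I + J = q + p -> J = p by lra.
exact: solve_sum D10 (D1 u).
Qed.

Lemma Rintegral_exp_weight_sin (eps u : R) : 0 < eps ->
  \int[mu]_x (exp_weight eps x * sin (u * x)) = 0.
Proof.
move=> e0; apply: Rintegral_odd.
  by apply: integrable_exp_weightM => //;
    [exact: continuous_sinM|move=> x; exact: sin_max].
by move=> x; rewrite exp_weightN mulrN sinN mulrN.
Qed.

Lemma integral_poisson_itv (eps y s t : R) : 0 < eps -> s <= t ->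
  (\int[mu]_(x in `[s, t]) (poisson eps (x - y))%:E =
   (2 * (atan ((t - y) / eps) - atan ((s - y) / eps)))%:E)%E.
Proof.
move=> e0 st.
pose F : R -> R := 2 \*: (atan \o (eps^-1 \*: ((@id R : R -> R) - cst y))).
have cf : continuous (fun x => poisson eps (x - y)).
  move=> x; apply: (@continuous_comp _ _ _ (fun x => x - y) (poisson eps)).
    by apply: cvgB; [exact: cvg_id|exact: cvg_cst].
  exact: continuous_poisson.
have dF x : is_derive x (1 : R) F (poisson eps (x - y)).
  rewrite /F; apply: is_derive_eq.
  rewrite !fctE /GRing.scale /= /GRing.scale /= /poisson; field.
  by rewrite !gt_eqF//= ltr_wpDr ?sqr_ge0// exprn_gt0.
rewrite (integral_is_derive st cf dF).
by rewrite /F /= !fctE /GRing.scale /= ![eps^-1 * _]mulrC -mulrBr.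
Qed.

(** The mass over [-k, k] is a difference of two arctangents, each of absolute
value less than pi / 2. *)
Lemma integral_poisson_le (eps y : R) : 0 < eps ->
  (\int[mu]_x (poisson eps (x - y))%:E <= (2 * pi)%:E)%E.
Proof.
move=> e0.
have mp : measurable_fun [set: R] (fun x => (poisson eps (x - y))%:E).
  apply/measurable_EFinP; apply: continuous_measurable_fun => x.
  apply: (@continuous_comp _ _ _ (fun x => x - y) (poisson eps)).
    by apply: cvgB; [exact: cvg_id|exact: cvg_cst].
  exact: continuous_poisson.
pose F (k : nat) : set R := [set` `[- (k%:R : R), k%:R]].
have UT : \bigcup_k F k = [set: R].
  rewrite -subTset => x _; exists (Num.truncn `|x|).+1 => //=.
  by rewrite /F/= in_itv/= -ler_norml ltW// truncnS_gt.
have cv : (\int[mu]_(x in F k) (poisson eps (x - y))%:E @[k --> \oo] -->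
    \int[mu]_(x in \bigcup_k F k) (poisson eps (x - y))%:E)%E.
  apply: ge0_nondecreasing_set_cvg_integral => //.
  - apply/nondecreasing_seqP => k; rewrite subsetEset /F.
    by apply: subset_itv; rewrite bnd_simp ?lerN2 ler_nat.
  - by move=> k; exact: measurable_itv.
  - by move=> k; exact: measurable_funTS.
  - by move=> k x _; rewrite lee_fin poisson_ge0// ltW.
rewrite -UT; move/cvg_lim : (cv) => <-//; apply: lime_le.
  by apply/cvg_ex; eexists; exact: cv.
apply: nearW => k.
have nk : - (k%:R : R) <= k%:R by rewrite (@le_trans _ _ 0)// oppr_le0.
rewrite (integral_poisson_itv _ e0 nk) lee_fin.
rewrite ler_pM2l//.
have := atan_ltpi2 ((k%:R - y) / eps); have := atan_gtNpi2 ((- k%:R - y) / eps).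
lra.
Qed.

End poisson_kernel.

(** * A Plancherel inequality for trigonometric integrals *)

Section trigonometric_integrals.
Context {R : realType}.
Notation mu := (@lebesgue_measure R).
Notation mR := (measurableTypeR R).

(** The real form of a Fourier integrand: when [a] and [b] are the real and
imaginary parts of a characteristic function phi, with [a] even and [b] odd,
[synthesis a b x] is the integral of phi(u) exp(- iux). *)
Definition wave (a b : R -> R) (u x : R) : R := a u * cos (u * x) + b u * sin (u * x).

Definition synthesis (a b : R -> R) (x : R) : R := \int[mu]_u wave a b u x.

Variables a b : R -> R.
Hypothesis ia : mu.-integrable [set: R] (EFin \o a).
Hypothesis ib : mu.-integrable [set: R] (EFin \o b).

Let ma : measurable_fun [set: R] a.
Proof. by apply/measurable_EFinP; exact: measurable_int ia. Qed.

Let mb : measurable_fun [set: R] b.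
Proof. by apply/measurable_EFinP; exact: measurable_int ib. Qed.

Let amp u := `|a u| + `|b u|.

Let amp_ge0 u : 0 <= amp u. Proof. by rewrite addr_ge0. Qed.

Let iamp : mu.-integrable [set: R] (EFin \o amp).
Proof.
rewrite (_ : EFin \o amp = (fun u => (`|a u|)%:E + (`|b u|)%:E)%E)//.
by apply: integrableD => //; exact: integrable_norm.
Qed.

Lemma wave_le u x : `|wave a b u x| <= amp u.
Proof.
apply: (le_trans (ler_normD _ _)); rewrite !normrM; apply: lerD.
  by rewrite ler_piMr// cos_max.
by rewrite ler_piMr// sin_max.
Qed.

Lemma measurable_wave : measurable_fun [set: (mR * mR)%type] (fun z : mR * mR => wave a b z.2 z.1).
Proof.
have mM : measurable_fun [set: (mR * mR)%type] (fun z : mR * mR => z.2 * z.1 : R) by exact: measurable_funM.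
apply: measurable_funD; apply: measurable_funM.
- exact: measurableT_comp ma measurable_snd.
- by apply: measurableT_comp mM; apply: continuous_measurable_fun; exact: continuous_cos.
- exact: measurableT_comp mb measurable_snd.
- by apply: measurableT_comp mM; apply: continuous_measurable_fun; exact: continuous_sin.
Qed.

Lemma integrable_wave x : mu.-integrable [set: R] (fun u => (wave a b u x)%:E).
Proof.
apply: le_integrable iamp => //.
  apply/measurable_EFinP.
  exact: (measurableT_comp measurable_wave (pair1_measurable x)).
move=> u _ /=; rewrite lee_fin (ger0_norm (amp_ge0 u)); exact: wave_le.
Qed.

Let C := \int[mu]_u amp u.

Lemma synthesis_le x : `|synthesis a b x| <= C.
Proof.
apply: (le_trans (le_normr_Rintegral _ (integrable_wave x))) => //.
apply: le_Rintegral => //.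
- by apply: integrable_norm; exact: integrable_wave.
- by move=> u _; exact: wave_le.
Qed.

Section weighted.
Variable eps : R.
Hypothesis eps0 : 0 < eps.
Let w := exp_weight eps.

Let mw : measurable_fun [set: R] w.
Proof. by apply: continuous_measurable_fun; exact: continuous_exp_weight. Qed.

Let iw : mu.-integrable [set: R] (EFin \o w).
Proof. exact: integrable_exp_weight. Qed.

Let w_ge0 x : 0 <= w x. Proof. exact: expR_ge0. Qed.

Let m_wwave : measurable_fun [set: (mR * mR)%type] (fun z : mR * mR => w z.1 * wave a b z.2 z.1).
Proof.
apply: measurable_funM; last exact: measurable_wave.
exact: measurableT_comp mw measurable_fst.
Qed.

Let wwave_le x u : `|w x * wave a b u x| <= w x * amp u.
Proof. by rewrite normrM ger0_norm// ler_wpM2l// wave_le. Qed.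

Lemma integrable_weighted_synthesis :
  mu.-integrable [set: R] (fun x => (w x * synthesis a b x)%:E).
Proof.
have H := integrable_Rintegral_sectionl m_wwave iw iamp wwave_le.
apply: eq_integrable H => //.
by move=> x _ /=; rewrite RintegralZl//; exact: integrable_wave.
Qed.

(** A parameter integral of an integrable function of two variables is
measurable; the wave is not integrable jointly in both, so the weight is
inserted and then divided out. *)
Lemma measurable_synthesis : measurable_fun [set: R] (synthesis a b).
Proof.
rewrite (_ : synthesis a b = (fun x => expR (eps * `|x|) * (w x * synthesis a b x))).
  apply: measurable_funM.
    apply: (measurableT_comp (f := expR)) => //.
    by apply: measurable_funM => //; exact: measurableT_comp.
  by apply/measurable_EFinP; exact: measurable_int integrable_weighted_synthesis.
by apply/funext => x; rewrite mulrA -expRD subrr expR0 mul1r.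
Qed.

(** The product of the waves at [u] and [v] is a combination of cosines and
sines of (u - v) x and (u + v) x; integrated against the weight, the former
become Poisson kernels and the latter vanish. *)
Let Q u v := 2^-1 * (poisson eps (u - v) * (a u * a v + b u * b v)
                   + poisson eps (u + v) * (a u * a v - b u * b v)).

Let wave_mul_integral u v : \int[mu]_x (w x * wave a b u x * wave a b v x) = Q u v.
Proof.
have icos t : mu.-integrable [set: R] (fun x => (w x * cos (t * x))%:E).
  by apply: integrable_exp_weightM => //;
    [exact: continuous_cosM|move=> x; exact: cos_max].
have isin t : mu.-integrable [set: R] (fun x => (w x * sin (t * x))%:E).
  by apply: integrable_exp_weightM => //;
    [exact: continuous_sinM|move=> x; exact: sin_max].
have iZ (k : R) (h : R -> R) : mu.-integrable [set: R] (fun x => (h x)%:E) ->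
    mu.-integrable [set: R] (fun x => (k * h x)%:E).
  by move=> ih; exact: (integrableZl measurableT k ih).
have iD (h1 h2 : R -> R) : mu.-integrable [set: R] (fun x => (h1 x)%:E) ->
    mu.-integrable [set: R] (fun x => (h2 x)%:E) ->
    mu.-integrable [set: R] (fun x => (h1 x + h2 x)%:E).
  by move=> i1 i2; exact: (integrableD measurableT i1 i2).
pose c1 := 2^-1 * (a u * a v + b u * b v).
pose c2 := 2^-1 * (a u * a v - b u * b v).
pose c3 := 2^-1 * (a u * b v + b u * a v).
pose c4 := 2^-1 * (b u * a v - a u * b v).
transitivity (\int[mu]_x ((c1 * (w x * cos ((u - v) * x)) +
    c2 * (w x * cos ((u + v) * x))) + (c3 * (w x * sin ((u + v) * x)) +
    c4 * (w x * sin ((u - v) * x))))).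
  apply: eq_Rintegral => x _.
  rewrite /wave !(mulrDl u) mulNr !cosD !sinD cosN sinN /c1 /c2 /c3 /c4.
  by field.
rewrite RintegralD//; last 2 first.
- by apply: iD; exact: iZ.
- by apply: iD; exact: iZ.
rewrite RintegralD//; [|exact: iZ|exact: iZ].
rewrite RintegralD//; [|exact: iZ|exact: iZ].
rewrite !RintegralZl//; try exact: icos; try exact: isin.
rewrite !Rintegral_exp_weight_cos// !Rintegral_exp_weight_sin// /c1 /c2 /Q.
by field.
Qed.

Let ener u := a u ^+ 2 + b u ^+ 2.

Let ener_ge0 u : 0 <= ener u. Proof. by rewrite addr_ge0 ?sqr_ge0. Qed.

(** The kernel of the Schur test: symmetric and, as each Poisson kernel weighs
at most 2 pi, of integral at most pi in each variable. *)
Let P u v := 4^-1 * (poisson eps (u - v) + poisson eps (u + v)).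

Let Q_le u v : `|Q u v| <= P u v * ener u + P u v * ener v.
Proof.
have p1 := poisson_ge0 (u - v) (ltW eps0).
have p2 := poisson_ge0 (u + v) (ltW eps0).
(* [e1] and [e2] both come from 2 |xy| <= x^2 + y^2, summed *)
have e1 : `|a u * a v + b u * b v| <= (ener u + ener v) / 2.
  rewrite /ener ler_norml; apply/andP; split; rewrite -subr_ge0.
    rewrite (_ : _ - _ = ((a u + a v) ^+ 2 + (b u + b v) ^+ 2) / 2); last by field.
    by rewrite divr_ge0// addr_ge0 ?sqr_ge0.
  rewrite (_ : _ - _ = ((a u - a v) ^+ 2 + (b u - b v) ^+ 2) / 2); last by field.
  by rewrite divr_ge0// addr_ge0 ?sqr_ge0.
have e2 : `|a u * a v - b u * b v| <= (ener u + ener v) / 2.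
  rewrite /ener ler_norml; apply/andP; split; rewrite -subr_ge0.
    rewrite (_ : _ - _ = ((a u + a v) ^+ 2 + (b u - b v) ^+ 2) / 2); last by field.
    by rewrite divr_ge0// addr_ge0 ?sqr_ge0.
  rewrite (_ : _ - _ = ((a u - a v) ^+ 2 + (b u + b v) ^+ 2) / 2); last by field.
  by rewrite divr_ge0// addr_ge0 ?sqr_ge0.
rewrite /Q normrM ger0_norm//.
apply: (@le_trans _ _ (2^-1 * (poisson eps (u - v) * ((ener u + ener v) / 2) +
   poisson eps (u + v) * ((ener u + ener v) / 2)))); last by rewrite /P; lra.
apply: ler_wpM2l => //; apply: (le_trans (ler_normD _ _)).
rewrite !(normrM (poisson eps _)) (ger0_norm p1) (ger0_norm p2).
by apply: lerD; apply: ler_wpM2l.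
Qed.

Let mp : measurable_fun [set: R] (poisson eps).
Proof. by apply: continuous_measurable_fun; exact: continuous_poisson. Qed.

Let mP : measurable_fun [set: (mR * mR)%type] (fun z : mR * mR => P z.1 z.2).
Proof.
apply: measurable_funM => //; apply: measurable_funD.
  by apply: (measurableT_comp mp); exact: measurable_funB.
by apply: (measurableT_comp mp); exact: measurable_funD.
Qed.

Let P_ge0 u v : 0 <= P u v.
Proof. by rewrite mulr_ge0// addr_ge0// poisson_ge0// ltW. Qed.

Let Psym u v : P u v = P v u.
Proof.
rewrite /P (addrC v u); congr (_ * (_ + _)).
by rewrite /poisson -[u - v]opprB sqrrN.
Qed.

Let P_integral u : (\int[mu]_v (P u v)%:E <= pi%:E)%E.
Proof.
have mpB : measurable_fun [set: R] (fun v => poisson eps (v - u)).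
  by apply: (measurableT_comp mp); exact: measurable_funB.
have mpD : measurable_fun [set: R] (fun v => poisson eps (v - (- u))).
  by apply: (measurableT_comp mp); exact: measurable_funB.
rewrite (eq_integral (fun v : mR => 4^-1%:E * ((poisson eps (v - u))%:E +
    (poisson eps (v - (- u)))%:E)))%E; last first.
  by move=> v _; rewrite Psym /P EFinM EFinD opprK.
rewrite ge0_integralZl_EFin//; last 2 first.
- by move=> v _; rewrite -EFinD lee_fin addr_ge0// poisson_ge0// ltW.
- by apply: emeasurable_funD; exact/measurable_EFinP.
rewrite ge0_integralD//; last 4 first.
- by move=> v _; rewrite lee_fin poisson_ge0// ltW.
- exact/measurable_EFinP.
- by move=> v _; rewrite lee_fin poisson_ge0// ltW.
- exact/measurable_EFinP.
apply: (@le_trans _ _ (4^-1%:E * ((2 * pi)%:E + (2 * pi)%:E))%E).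
  by rewrite lee_pmul2l// leeD// integral_poisson_le.
by rewrite -EFinD -EFinM lee_fin; lra.
Qed.

Let mener : measurable_fun [set: R] ener.
Proof. by apply: measurable_funD; exact: measurable_funX. Qed.

(** Integrating the first term in [v] and the second, by symmetry, in [u] leaves
pi times the energy twice. *)
Let schur : (\int[mu]_u \int[mu]_v (P u v * ener u + P u v * ener v)%:E <=
   (2 * pi)%:E * \int[mu]_u (ener u)%:E)%E.
Proof.
have m1 : measurable_fun [set: (mR * mR)%type] (fun z : mR * mR => (P z.1 z.2 * ener z.1)%:E).
  apply/measurable_EFinP/measurable_funM => //.
  exact: measurableT_comp mener measurable_fst.
have m2 : measurable_fun [set: (mR * mR)%type] (fun z : mR * mR => (P z.1 z.2 * ener z.2)%:E).
  apply/measurable_EFinP/measurable_funM => //.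
  exact: measurableT_comp mener measurable_snd.
have n1 (z : mR * mR) : (0 <= (P z.1 z.2 * ener z.1)%:E)%E.
  by rewrite lee_fin mulr_ge0.
have n2 (z : mR * mR) : (0 <= (P z.1 z.2 * ener z.2)%:E)%E.
  by rewrite lee_fin mulr_ge0.
have I1 : (\int[mu]_u \int[mu]_v (P u v * ener u)%:E <= pi%:E * \int[mu]_u (ener u)%:E)%E.
  rewrite -ge0_integralZl//=; last 3 first.
  - exact/measurable_EFinP.
  - by move=> u _; rewrite lee_fin.
  - by rewrite lee_fin pi_ge0.
  apply: ge0_le_integral => //.
  - by move=> u _; apply: integral_ge0 => v _; rewrite lee_fin mulr_ge0.
  - exact: (measurable_fun_fubini_tonelli_F _ m1 n1).
  - by apply: emeasurable_funM => //; exact/measurable_EFinP.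
  move=> u _; rewrite (eq_integral (fun v : mR => (P u v)%:E * (ener u)%:E)%E)//.
  rewrite ge0_integralZr//; last 3 first.
  - by apply/measurable_EFinP; exact: (measurableT_comp mP (pair1_measurable u)).
  - by move=> v _; rewrite lee_fin.
  - by rewrite lee_fin.
  by apply: lee_wpmul2r; [rewrite lee_fin|exact: P_integral].
have I2 : (\int[mu]_u \int[mu]_v (P u v * ener v)%:E <= pi%:E * \int[mu]_u (ener u)%:E)%E.
  have -> : (\int[mu]_u \int[mu]_v (P u v * ener v)%:E =
             \int[mu]_v \int[mu]_u (P u v * ener v)%:E)%E.
    exact: (fubini_tonelli _ m2 n2).
  have -> : (\int[mu]_v \int[mu]_u (P u v * ener v)%:E =
      \int[mu]_u \int[mu]_v (P u v * ener u)%:E)%E.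
    by apply: eq_integral => v _; apply: eq_integral => u _; rewrite Psym.
  exact: I1.
under eq_integral => u _.
  rewrite (eq_integral (fun v : mR => (P u v * ener u)%:E + (P u v * ener v)%:E)%E)//.
  rewrite ge0_integralD//; last 4 first.
  - by move=> v _; rewrite lee_fin mulr_ge0.
  - exact: (measurableT_comp m1 (pair1_measurable u)).
  - by move=> v _; rewrite lee_fin mulr_ge0.
  - exact: (measurableT_comp m2 (pair1_measurable u)).
  over.
rewrite ge0_integralD//; last 4 first.
- by move=> u _; apply: integral_ge0 => v _; rewrite lee_fin mulr_ge0.
- exact: (measurable_fun_fubini_tonelli_F _ m1 n1).
- by move=> u _; apply: integral_ge0 => v _; rewrite lee_fin mulr_ge0.
- exact: (measurable_fun_fubini_tonelli_F _ m2 n2).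
apply: (le_trans (leeD I1 I2)).
have -> : (2 * pi)%:E = (pi%:E + pi%:E)%E :> \bar R.
  by rewrite -EFinD (_ : 2 = 1 + 1 :> R)// mulrDl mul1r.
by rewrite ge0_muleDl// lee_fin pi_ge0.
Qed.

(** Unfolding the square as a double integral of waves and exchanging the
integrals turns the left side into the double integral of [Q], to which the
Schur test applies. *)
Lemma weighted_plancherel :
  (\int[mu]_x (w x * synthesis a b x ^+ 2)%:E <= (2 * pi)%:E * \int[mu]_u (ener u)%:E)%E.
Proof.
have mG := measurable_synthesis.
have C0 : 0 <= C by apply: Rintegral_ge0.
have iCw : mu.-integrable [set: R] (EFin \o (fun x => C * w x)).
  exact: (integrableZl measurableT C iw).
(* the first exchange unfolds one factor of the square, the second the other *)
have E1 : \int[mu]_x (w x * synthesis a b x ^+ 2) =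
    \int[mu]_u \int[mu]_x (w x * synthesis a b x * wave a b u x).
  transitivity (\int[mu]_x \int[mu]_u (w x * synthesis a b x * wave a b u x)).
    apply: eq_Rintegral => x _.
    by rewrite RintegralZl//; [rewrite expr2 mulrA|exact: integrable_wave].
  apply: (Rintegral_swap (f := fun z : mR * mR => w z.1 * synthesis a b z.1 * wave a b z.2 z.1) _ iCw iamp).
    apply: measurable_funM; last exact: measurable_wave.
    apply: measurable_funM; first exact: measurableT_comp mw measurable_fst.
    exact: measurableT_comp mG measurable_fst.
  move=> x u /=; rewrite normrM; apply: ler_pM => //; last exact: wave_le.
  rewrite normrM ger0_norm// mulrC; apply: ler_wpM2r => //; exact: synthesis_le.
have iww u : mu.-integrable [set: R] (EFin \o (fun x => amp u * w x)).
  exact: (integrableZl measurableT (amp u) iw).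
have mww u : measurable_fun [set: (mR * mR)%type]
    (fun z : mR * mR => w z.1 * wave a b u z.1 * wave a b z.2 z.1).
  apply: measurable_funM; last exact: measurable_wave.
  apply: measurable_funM; first exact: measurableT_comp mw measurable_fst.
  apply: (measurableT_comp _ measurable_fst).
  exact: (measurableT_comp measurable_wave (pair2_measurable u)).
have ww_le u x v : `|w x * wave a b u x * wave a b v x| <= amp u * w x * amp v.
  rewrite normrM; apply: ler_pM => //; last exact: wave_le.
  by rewrite normrM ger0_norm// mulrC; apply: ler_wpM2r => //; exact: wave_le.
have E2 u : \int[mu]_x (w x * synthesis a b x * wave a b u x) = \int[mu]_v Q u v.
  transitivity (\int[mu]_x \int[mu]_v (w x * wave a b u x * wave a b v x)).
    apply: eq_Rintegral => x _.
    by rewrite RintegralZl//; [rewrite mulrAC|exact: integrable_wave].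
  rewrite (Rintegral_swap (mww u) (iww u) iamp (ww_le u)).
  by apply: eq_Rintegral => v _; exact: wave_mul_integral.
have iQ u : mu.-integrable [set: R] (EFin \o Q u).
  have iH := integrable_Rintegral_sectionr (mww u) (iww u) iamp (ww_le u).
  apply: eq_integrable iH => // v _ /=.
  by congr EFin; exact: wave_mul_integral.
have m1 : measurable_fun [set: (mR * mR)%type] (fun z : mR * mR =>
    w z.1 * synthesis a b z.1 * wave a b z.2 z.1).
  apply: measurable_funM; last exact: measurable_wave.
  apply: measurable_funM; first exact: measurableT_comp mw measurable_fst.
  exact: measurableT_comp mG measurable_fst.
have m1_le x u : `|w x * synthesis a b x * wave a b u x| <= C * w x * amp u.
  rewrite normrM; apply: ler_pM => //; last exact: wave_le.
  by rewrite normrM ger0_norm// mulrC; apply: ler_wpM2r => //; exact: synthesis_le.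
have ih : mu.-integrable [set: R] (fun u => (\int[mu]_v Q u v)%:E).
  have iH := integrable_Rintegral_sectionr m1 iCw iamp m1_le.
  by apply: eq_integrable iH => // u _ /=; rewrite E2.
have iS : mu.-integrable [set: R] (fun x => (w x * synthesis a b x ^+ 2)%:E).
  apply: (@le_integrable _ _ _ mu _ measurableT _ (fun x => (C ^+ 2)%:E * (w x)%:E)%E).
  - by apply/measurable_EFinP/measurable_funM => //; exact: measurable_funX.
  - move=> x _ /=; rewrite lee_fin (normrM (w x)) (normrM (C ^+ 2)) (ger0_norm (w_ge0 x)).
    rewrite mulrC; apply: ler_wpM2r => //.
    by rewrite !normrX (ger0_norm C0) ler_pXn2r ?nnegrE//; exact: synthesis_le.
  - exact: integrableZl.
rewrite -[leLHS]fineK; last exact: integrable_fin_num.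
rewrite -/(Rintegral mu setT (fun x => w x * synthesis a b x ^+ 2)) E1.
have -> : \int[mu]_u (\int[mu]_x (w x * synthesis a b x * wave a b u x)) =
    \int[mu]_u (\int[mu]_v Q u v).
  by apply: eq_Rintegral => u _; exact: E2.
apply: le_trans schur.
apply: (@le_trans _ _ (`|\int[mu]_u (\int[mu]_v Q u v)|%:E)%E).
  by rewrite lee_fin ler_norm.
rewrite EFin_normr_Rintegral//.
apply: (le_trans (le_abse_integral _ _ _)) => //; first exact: measurable_int ih.
have mPe : measurable_fun [set: (mR * mR)%type]
    (fun z : mR * mR => (P z.1 z.2 * ener z.1 + P z.1 z.2 * ener z.2)%:E).
  apply/measurable_EFinP; apply: measurable_funD; apply: measurable_funM => //.
    exact: measurableT_comp mener measurable_fst.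
  exact: measurableT_comp mener measurable_snd.
have Pe0 (z : mR * mR) : (0 <= (P z.1 z.2 * ener z.1 + P z.1 z.2 * ener z.2)%:E)%E.
  by rewrite lee_fin addr_ge0// mulr_ge0.
apply: ge0_le_integral => //.
- by apply: measurableT_comp => //; exact: measurable_int ih.
- exact: (measurable_fun_fubini_tonelli_F _ mPe Pe0).
move=> u _; rewrite /= EFin_normr_Rintegral//.
have mQu := measurable_int mu (iQ u).
apply: (le_trans (le_abse_integral _ _ _)) => //.
apply: ge0_le_integral => //.
- exact: measurableT_comp.
- exact: (measurableT_comp mPe (pair1_measurable u)).
- by move=> v _; rewrite /= lee_fin; exact: Q_le.
Qed.

End weighted.

(** The weight increases to 1 as [eps] decreases to 0, so the weighted
inequality passes to the limit by monotone convergence. *)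
Theorem plancherel_le :
  (\int[mu]_x (synthesis a b x ^+ 2)%:E <=
   (2 * pi)%:E * \int[mu]_u (a u ^+ 2 + b u ^+ 2)%:E)%E.
Proof.
pose e (k : nat) : R := k.+1%:R^-1.
have e0 k : 0 < e k by rewrite invr_gt0.
pose g k x := (exp_weight (e k) x * synthesis a b x ^+ 2)%:E.
have mG := measurable_synthesis (ltr01 : 0 < 1 :> R).
have mg k : measurable_fun [set: R] (g k).
  apply/measurable_EFinP/measurable_funM; last exact: measurable_funX.
  by apply: continuous_measurable_fun; exact: continuous_exp_weight.
have g0 k x : (0 <= g k x)%E by rewrite lee_fin mulr_ge0// ?expR_ge0 ?sqr_ge0.
have glim x : g ^~ x @ \oo --> (synthesis a b x ^+ 2)%:E.
  apply/cvg_EFin; first exact: nearW.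
  rewrite -[X in _ --> X]mul1r; apply: cvgMl.
  rewrite -expR0; apply: continuous_cvg; first exact: continuous_expR.
  rewrite -oppr0; apply: cvgN; rewrite -(mul0r `|x|); apply: cvgMl.
  exact: cvg_harmonic.
rewrite (eq_integral (fun x : mR => limn (g ^~ x))); last first.
  by move=> x _; exact/esym/cvg_lim.
have nd x : {homo (g ^~ x) : k l / (k <= l)%N >-> (k <= l)%E}.
  move=> k l kl; rewrite lee_fin ler_wpM2r ?sqr_ge0// ler_expR lerN2.
  by rewrite ler_wpM2r// lef_pV2 ?posrE// ler_nat.
have cv := cvg_monotone_convergence (mu := mu) measurableT mg (fun k x _ => g0 k x) (fun x _ => nd x).
move/cvg_lim : (cv) => <- //; apply: lime_le.
  by apply/cvg_ex; eexists; exact: cv.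
by apply: nearW => k; exact: weighted_plancherel.
Qed.

End trigonometric_integrals.

(** * Fourier inversion for integrable characteristic functions *)

Section equality_from_intervals.
Context {R : realType}.
Notation mu := (@lebesgue_measure R).
Notation mR := (measurableTypeR R).

(** Exhausting half lines by compact intervals shows that the difference has a
vanishing primitive; Lebesgue differentiation concludes. The integrability of
[g] follows from the equality of the total masses. *)
Lemma ae_eq_from_intervals (f g : R -> R) :
  measurable_fun [set: R] g -> (forall x, 0 <= f x) -> (forall x, 0 <= g x) ->
  mu.-integrable [set: R] (EFin \o f) ->
  (forall s t : R, s <= t ->
     (\int[mu]_(x in `[s, t]) (f x)%:E = \int[mu]_(x in `[s, t]) (g x)%:E)%E) ->
  {ae mu, forall x, f x = g x}.
Proof.
move=> mg f0 g0 intf fg.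
have mf : measurable_fun [set: R] f by apply/measurable_EFinP; exact: measurable_int intf.
have union (D : set R) (s t : nat -> R) : (forall k, s k <= t k) ->
    nondecreasing_seq (fun k => `[s k, t k]%classic) ->
    \bigcup_k `[s k, t k]%classic = D ->
    (\int[mu]_(x in D) (f x)%:E = \int[mu]_(x in D) (g x)%:E)%E.
  move=> st nd <-.
  have cv (h : R -> R) : measurable_fun [set: R] h -> (forall x, 0 <= h x) ->
      (\int[mu]_(x in `[s k, t k]) (h x)%:E @[k --> \oo] -->
       \int[mu]_(x in \bigcup_k `[s k, t k]%classic) (h x)%:E)%E.
    move=> mh h0; apply: ge0_nondecreasing_set_cvg_integral => //.
    - by move=> k; apply/measurable_EFinP; exact: measurable_funTS.
    - by move=> k x _; rewrite lee_fin.
  have cf := cv _ mf f0; have cg := cv _ mg g0.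
  apply: (cvg_unique _ cf) => //.
  rewrite (_ : (fun k => _) = (fun k => \int[mu]_(x in `[s k, t k]) (g x)%:E)%E)//.
  by apply/funext => k; exact: fg.
have eqT : (\int[mu]_x (f x)%:E = \int[mu]_x (g x)%:E)%E.
  apply: (union _ (fun k => - (k%:R : R)) (fun k => k%:R)).
  - by move=> k; rewrite (@le_trans _ _ 0)// oppr_le0.
  - apply/nondecreasing_seqP => k; rewrite subsetEset.
    by apply: subset_itv; rewrite bnd_simp ?lerN2 ler_nat.
  - rewrite -subTset => x _; exists (Num.truncn `|x|).+1 => //=.
    by rewrite in_itv/= -ler_norml ltW// truncnS_gt.
have eqy y : (\int[mu]_(x in `]-oo, y]) (f x)%:E = \int[mu]_(x in `]-oo, y]) (g x)%:E)%E.
  apply: (union _ (fun k => y - (k%:R : R)) (fun k => y)).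
  - by move=> k; rewrite gerBl.
  - apply/nondecreasing_seqP => k; rewrite subsetEset.
    by apply: subset_itv; rewrite bnd_simp// lerD2l lerN2 ler_nat.
  - apply/seteqP; split => [x [k _] /=|x /=].
      by rewrite !in_itv/= => /andP[].
    rewrite in_itv/= => xy; exists (Num.truncn (y - x)).+1 => //=.
    by rewrite in_itv/= xy andbT lerBlDr addrC -lerBlDr ltW// truncnS_gt.
have intg : mu.-integrable [set: R] (EFin \o g).
  apply/integrableP; split; first exact/measurable_EFinP.
  have /integrableP[_] := intf.
  rewrite (eq_integral (fun x : mR => (f x)%:E)); last by move=> x _; rewrite /= ger0_norm.
  rewrite eqT => H; rewrite (eq_integral (fun x : mR => (g x)%:E))// => x _.
  by rewrite /= ger0_norm.
pose h x := f x - g x.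
have inth : mu.-integrable [set: R] (EFin \o h).
  exact: (integrableB measurableT intf intg).
have F0 y : \int[mu]_(x in `]-oo, y]) h x = 0.
  rewrite /h RintegralB//; last 2 first.
  - exact: integrableS intf.
  - exact: integrableS intg.
  by rewrite /Rintegral eqy subrr.
have hl : locally_integrable [set: R] h by apply: open_integrable_locally => //; exact: openT.
have hy y : mu.-integrable `]-oo, y] (EFin \o h) by apply: integrableS inth.
have := FTC1Ny (f := h) hy hl.
apply: filterS; first exact: (ae_filter_ringOfSetsType mu).
move=> x /= [_].
rewrite (_ : (fun y => _) = cst 0); last by apply/funext => y; exact: F0.
by rewrite derive1_cst => /esym/eqP; rewrite /h subr_eq0 => /eqP.
Qed.

End equality_from_intervals.

Section bounded_integrands.
Context d (T : measurableType d) (R : realType).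

Lemma Rintegral_dominated_cvg (m : {measure set T -> \bar R}) (D : set T)
    (f_ : nat -> T -> R) (f g : T -> R) : measurable D ->
  (forall n, measurable_fun D (f_ n)) -> measurable_fun D f ->
  {ae m, forall x, D x -> f_ ^~ x @ \oo --> f x} ->
  m.-integrable D (EFin \o g) -> (forall n x, D x -> `|f_ n x| <= g x) ->
  \int[m]_(x in D) f_ n x @[n --> \oo] --> \int[m]_(x in D) f x.
Proof.
move=> mD mf_ mf f_f ig f_g.
have [] := @dominated_convergence _ _ _ m D mD (fun n x => (f_ n x)%:E)
  (EFin \o f) (EFin \o g).
- by move=> n; exact/measurable_EFinP.
- exact/measurable_EFinP.
- apply: filterS f_f.
  by move=> x /= H Dx; apply/cvg_EFin; [exact: nearW|exact: H].
- exact: ig.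
- by apply: aeW => x n Dx /=; rewrite lee_fin; exact: f_g.
move=> intf _ cv; rewrite /Rintegral.
have fin : (\int[m]_(x in D) (f x)%:E)%E \is a fin_num by exact: integrable_fin_num.
by apply: fine_cvg; rewrite fineK.
Qed.

Lemma integrable_bounded (P : {finite_measure set T -> \bar R}) (h : T -> R) (M : R) :
  measurable_fun [set: T] h -> (forall w, `|h w| <= M) ->
  P.-integrable [set: T] (EFin \o h).
Proof.
move=> mh hM; apply: (@le_integrable _ _ _ P _ measurableT _ (cst M%:E)).
- exact/measurable_EFinP.
- by move=> w _ /=; rewrite lee_fin (le_trans (hM w))// ler_norm.
- exact: finite_measure_integrable_cst.
Qed.

End bounded_integrands.

Section inversion.
Context {R : realType} {d : measure_display} {Omega : measurableType d}.
Variable P : probability Omega R.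
Notation mu := (@lebesgue_measure R).
Notation mR := (measurableTypeR R).
Variable Y : Omega -> R.
Hypothesis mY : measurable_fun [set: Omega] Y.

(** [cos_mean] and [sin_mean] are the real and imaginary parts of the
characteristic function of [Y]. *)
Definition cos_mean (u : R) : R := \int[P]_w cos (u * Y w).
Definition sin_mean (u : R) : R := \int[P]_w sin (u * Y w).

Let mcos (k : R) : measurable_fun [set: Omega] (fun w => cos (k * Y w)).
Proof.
apply: (measurableT_comp (f := cos)).
  by apply: continuous_measurable_fun; exact: continuous_cos.
exact: measurable_funM.
Qed.

Let msin (k : R) : measurable_fun [set: Omega] (fun w => sin (k * Y w)).
Proof.
apply: (measurableT_comp (f := sin)).
  by apply: continuous_measurable_fun; exact: continuous_sin.
exact: measurable_funM.
Qed.

Let icos (k : R) : P.-integrable [set: Omega] (EFin \o (fun w => cos (k * Y w))).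
Proof. by apply: (@integrable_bounded _ _ _ _ _ 1) => // w; exact: cos_max. Qed.

Let isin (k : R) : P.-integrable [set: Omega] (EFin \o (fun w => sin (k * Y w))).
Proof. by apply: (@integrable_bounded _ _ _ _ _ 1) => // w; exact: sin_max. Qed.

Lemma wave_mean u x :
  wave cos_mean sin_mean u x = \int[P]_w cos (u * (Y w - x)).
Proof.
rewrite /wave /cos_mean /sin_mean -RintegralZr// -RintegralZr// -RintegralD//.
- by apply: eq_Rintegral => w _; rewrite mulrBr cosB.
- exact: (integrableZr measurableT (cos (u * x)) (icos u)).
- exact: (integrableZr measurableT (sin (u * x)) (isin u)).
Qed.

Hypothesis ia : mu.-integrable [set: R] (EFin \o cos_mean).
Hypothesis ib : mu.-integrable [set: R] (EFin \o sin_mean).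

(** Abel means of the inversion integral. *)
Let smooth eps x := \int[mu]_u (exp_weight eps u * wave cos_mean sin_mean u x).

Let mYx (x : R) : measurable_fun [set: Omega] (fun w => Y w - x).
Proof. exact: measurable_funB. Qed.

(** By Fubini the Abel mean is the expectation of a Poisson kernel centred at
[Y]. *)
Let smooth_mean eps x : 0 < eps -> smooth eps x = \int[P]_w poisson eps (Y w - x).
Proof.
move=> e0; rewrite /smooth.
transitivity (\int[mu]_u \int[P]_w (exp_weight eps u * cos (u * (Y w - x)))).
  apply: eq_Rintegral => u _; rewrite wave_mean RintegralZl//.
  apply: (@integrable_bounded _ _ _ _ _ 1) => [|w]; last exact: cos_max.
  apply: (measurableT_comp (f := cos)).
    by apply: continuous_measurable_fun; exact: continuous_cos.
  exact: measurable_funM.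
rewrite (Rintegral_swap (f := fun z : mR * Omega => exp_weight eps z.1 * cos (z.1 * (Y z.2 - x)))
  _ (integrable_exp_weight e0) (h := cst 1)).
- by apply: eq_Rintegral => w _; rewrite -Rintegral_exp_weight_cos//;
    apply: eq_Rintegral => u _ /=; rewrite (mulrC u).
- apply: measurable_funM.
    apply: (measurableT_comp _ measurable_fst).
    by apply: continuous_measurable_fun; exact: continuous_exp_weight.
  apply: (measurableT_comp (f := cos)).
    by apply: continuous_measurable_fun; exact: continuous_cos.
  apply: measurable_funM => //.
  exact: (measurableT_comp (mYx x) measurable_snd).
- exact: finite_measure_integrable_cst.
- move=> u w /=; rewrite normrM ger0_norm ?expR_ge0//.
  by rewrite ler_wpM2l ?expR_ge0// cos_max.
Qed.

Let e (k : nat) : R := k.+1%:R^-1.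

Let e0 k : 0 < e k. Proof. by rewrite invr_gt0. Qed.

Let exp_weight_le1 k u : exp_weight (e k) u <= 1.
Proof. by rewrite -expR0 ler_expR oppr_le0 mulr_ge0// ltW. Qed.

Let amp u := `|cos_mean u| + `|sin_mean u|.

Let iamp : mu.-integrable [set: R] (EFin \o amp).
Proof.
rewrite (_ : EFin \o amp = (fun u => (`|cos_mean u|)%:E + (`|sin_mean u|)%:E)%E)//.
by apply: integrableD => //; exact: integrable_norm.
Qed.

Let weighted_wave_le k u x :
  `|exp_weight (e k) u * wave cos_mean sin_mean u x| <= amp u.
Proof.
rewrite normrM ger0_norm ?expR_ge0//.
apply: le_trans (wave_le cos_mean sin_mean u x).
by rewrite ler_piMl.
Qed.

Let mwave x : measurable_fun [set: R] (fun u => wave cos_mean sin_mean u x).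
Proof. exact: (measurableT_comp (measurable_wave ia ib) (pair1_measurable x)). Qed.

Let mwwave x k : measurable_fun [set: R]
  (fun u => exp_weight (e k) u * wave cos_mean sin_mean u x).
Proof.
apply: measurable_funM => //.
by apply: continuous_measurable_fun; exact: continuous_exp_weight.
Qed.

Let iwwave k x : mu.-integrable [set: R]
  (EFin \o (fun u => exp_weight (e k) u * wave cos_mean sin_mean u x)).
Proof.
apply: le_integrable iamp => //; first by apply/measurable_EFinP; exact: mwwave.
by move=> u _ /=; rewrite lee_fin (le_trans (weighted_wave_le _ _ _))// ler_norm.
Qed.

(** Dominated convergence, thanks to the integrability of the characteristic
function. *)
Let smooth_cvg x : smooth (e k) x @[k --> \oo] --> synthesis cos_mean sin_mean x.
Proof.
have cvu u : exp_weight (e k) u * wave cos_mean sin_mean u x @[k --> \oo] -->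
    wave cos_mean sin_mean u x.
  rewrite -[X in _ --> X]mul1r; apply: cvgMl.
  rewrite -expR0; apply: continuous_cvg; first exact: continuous_expR.
  rewrite -oppr0; apply: cvgN; rewrite -(mul0r `|u|); apply: cvgMl.
  exact: cvg_harmonic.
apply: (@Rintegral_dominated_cvg _ _ _ mu setT
  (fun k u => exp_weight (e k) u * wave cos_mean sin_mean u x) _ amp) => //.
- by move=> k; exact: mwwave.
- exact: mwave.
- by apply: (aeW mu) => u _; exact: cvu.
Qed.

(** A limit of expectations of Poisson kernels, which are nonnegative. *)
Lemma synthesis_mean_ge0 x : 0 <= synthesis cos_mean sin_mean x.
Proof.
apply: (cvgr_to_ge (@smooth_cvg x)).
apply: nearW => k; rewrite smooth_mean//; apply: Rintegral_ge0 => w _.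
by rewrite poisson_ge0// ltW.
Qed.

Variable f : R -> R.
Hypothesis mf : measurable_fun [set: R] f.
Hypothesis f0 : forall x, 0 <= f x.
Hypothesis fE : forall A : set mR, measurable A ->
  (P (Y @^-1` A) = \int[mu]_(x in A) (f x)%:E)%E.

Let smooth_itv k s t : s <= t ->
  \int[mu]_(x in `[s, t]) smooth (e k) x =
  \int[P]_w (2 * (atan ((t - Y w) / e k) - atan ((s - Y w) / e k))).
Proof.
move=> st; pose I : set R := `[s, t]%classic.
have mI : measurable (I : set mR) by exact: measurable_itv.
have iI : mu.-integrable [set: R] (EFin \o (fun x : mR => 2 / e k * \1_I x)).
  have iI1 : mu.-integrable [set: R] (EFin \o (\1_I : R -> R)).
    exact: integrable_indic_itv.
  exact: (integrableZl measurableT (2 / e k) iI1).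
have mp : measurable_fun [set: R] (poisson (e k)).
  by apply: continuous_measurable_fun; exact: continuous_poisson.
rewrite Rintegral_mkcond.
transitivity (\int[mu]_x \int[P]_w (\1_I x * poisson (e k) (Y w - x))).
  apply: eq_Rintegral => x _; rewrite patch_indic/= mulrC RintegralZl//.
    by rewrite smooth_mean.
  apply: (@integrable_bounded _ _ _ _ _ (2 / e k)).
    exact: (measurableT_comp mp (mYx x)).
  move=> w; exact: poisson_le.
rewrite (Rintegral_swap (f := fun z : mR * Omega => \1_I z.1 * poisson (e k) (Y z.2 - z.1))
  _ iI (h := cst 1)).
- apply: eq_Rintegral => w _ /=.
  rewrite -[RHS]/(fine (2 * (atan ((t - Y w) / e k) - atan ((s - Y w) / e k)))%:E).
  rewrite -integral_poisson_itv// -[RHS]/(Rintegral mu _ _) Rintegral_mkcond.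
  apply: eq_Rintegral => x _; rewrite patch_indic/= mulrC.
  by rewrite /poisson -[Y w - x]opprB sqrrN.
- apply: measurable_funM.
    by apply: (measurableT_comp _ measurable_fst); exact: measurable_indic.
  apply: (measurableT_comp mp); apply: measurable_funB => //.
  exact: (measurableT_comp mY measurable_snd).
- exact: finite_measure_integrable_cst.
- move=> x w /=; rewrite mulr1 normrM ger0_norm//.
  by rewrite mulrC ler_wpM2r//; exact: poisson_le.
Qed.

Let cvg_atan_scaled c : c != 0 ->
  atan (c / e k) @[k --> \oo] --> (if 0 < c then pi / 2 else - (pi / 2) : R).
Proof.
have pos b : 0 < b -> atan (b / e k) @[k --> \oo] --> (pi / 2 : R).
  move=> b0; apply: (@cvg_comp _ _ _ (fun k => b / e k) atan _ +oo); last exact: cvgy_atan.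
  rewrite (_ : (fun k => _) = (fun k => b * k.+1%:R)); last first.
    by apply/funext => k; rewrite /e invrK.
  apply/cvgryPge => A; near=> k; rewrite -ler_pdivrMl//.
  by apply: (@le_trans _ _ k%:R); [near: k; exact: nbhs_infty_ger|rewrite ler_nat].
move=> c0; case: ltrP => [|cle]; first exact: pos.
have cN : 0 < - c by rewrite oppr_gt0 lt_neqAle c0.
rewrite (_ : (fun k => _) = (fun k => - atan ((- c) / e k))).
  by apply: cvgN; exact: pos.
by apply/funext => k; rewrite mulNr atanN opprK.
Unshelve. all: end_near.
Qed.

Let msmooth k : measurable_fun [set: R] (smooth (e k)).
Proof.
have mp : measurable_fun [set: R] (poisson (e k)).
  by apply: continuous_measurable_fun; exact: continuous_poisson.
rewrite (_ : smooth (e k) = fun x => fine (\int[P]_w (poisson (e k) (Y w - x))%:E)%E); last first.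
  by apply/funext => x; rewrite smooth_mean.
apply: (measurableT_comp (f := fine)) => //.
apply: (@measurable_fun_fubini_tonelli_F _ _ mR Omega R P
  (fun z : mR * Omega => (poisson (e k) (Y z.2 - z.1))%:E)).
  apply/measurable_EFinP; apply: (measurableT_comp mp); apply: measurable_funB => //.
  exact: (measurableT_comp mY measurable_snd).
by move=> z; rewrite lee_fin poisson_ge0// ltW.
Qed.

(** Both sides are limits of the integrals of the Abel means over the interval:
the left one by dominated convergence, the right one because the integrated
Poisson kernel converges to 2 pi inside the interval and to 0 outside. The
endpoints have probability 0, as [Y] has a density. *)
Let synthesis_itv s t : s <= t ->
  \int[mu]_(x in `[s, t]) synthesis cos_mean sin_mean x =
  2 * pi * fine (P (Y @^-1` `]s, t[)).
Proof.
move=> st; pose J : set R := `]s, t[%classic.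
have mJ : measurable (J : set mR) by exact: measurable_itv.
have mYJ : measurable (Y @^-1` J) by rewrite -[X in measurable X]setTI; exact: mY.
have muI : (mu `[s, t] < +oo)%E by rewrite lebesgue_measure_itv/=; case: ifP => _; rewrite ?ltry.
pose C := \int[mu]_u amp u.
have cv1 : \int[mu]_(x in `[s, t]) smooth (e k) x @[k --> \oo] -->
    \int[mu]_(x in `[s, t]) synthesis cos_mean sin_mean x.
  apply: (@Rintegral_dominated_cvg _ _ _ mu `[s, t]%classic (fun k => smooth (e k)) _ (cst C)) => //.
  - by move=> k; apply: measurable_funTS; exact: msmooth.
  - by apply: measurable_funTS; exact: (measurable_synthesis ia ib ltr01).
  - by apply: (aeW mu) => x _; exact: smooth_cvg.
  - apply: measurable_bounded_integrable => //; exists `|C|; split => //.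
    by move=> z Cz x _; exact: ltW.
  - move=> k x _; rewrite /smooth.
    apply: (le_trans (le_normr_Rintegral _ (iwwave k x))) => //.
    by apply: le_Rintegral => //; exact: integrable_norm (iwwave k x).
have mYset (c : R) : measurable (Y @^-1` [set c]).
  by rewrite -[X in measurable X]setTI; apply: mY => //; exact: measurable_set1.
have PY (c : R) : P (Y @^-1` [set c]) = 0%E.
  by rewrite fE ?integral_set1//; exact: measurable_set1.
have cv2 : \int[mu]_(x in `[s, t]) smooth (e k) x @[k --> \oo] -->
    \int[P]_w (2 * pi * \1_J (Y w)).
  rewrite (_ : (fun k => _) = (fun k => \int[P]_w
      (2 * (atan ((t - Y w) / e k) - atan ((s - Y w) / e k))))); last first.
    by apply/funext => k; exact: smooth_itv.
  have matan (c : R) k : measurable_fun [set: Omega] (fun w => atan ((c - Y w) / e k)).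
    apply: (measurableT_comp (f := atan)).
      by apply: continuous_measurable_fun; exact: continuous_atan.
    by apply: measurable_funM => //; exact: measurable_funB.
  apply: (@Rintegral_dominated_cvg _ _ _ P setT (fun k w =>
    2 * (atan ((t - Y w) / e k) - atan ((s - Y w) / e k))) _ (cst (2 * pi))) => //.
  - by move=> k; apply: measurable_funM => //; exact: measurable_funB.
  - apply: measurable_funM => //; apply: (measurableT_comp _ mY).
    exact: measurable_indic.
  (* convergence fails only at the two endpoints, where the arctangent is taken
  at 0 *)
  - exists (Y @^-1` [set s] `|` Y @^-1` [set t]); split.
    + by apply: measurableU; exact: mYset.
    + by rewrite measureU0; [exact: PY|exact: mYset|exact: mYset|exact: PY].
    + move=> w /= H; apply: contrapT => /not_orP[/= /eqP Ys /eqP Yt]; apply: H => _.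
      have ts : t - Y w != 0 by rewrite subr_eq0 eq_sym.
      have ss : s - Y w != 0 by rewrite subr_eq0 eq_sym.
      rewrite (_ : 2 * pi * _ = 2 * ((if 0 < t - Y w then pi / 2 else - (pi / 2)) -
        (if 0 < s - Y w then pi / 2 else - (pi / 2)))).
        by apply: cvgMr; apply: cvgB; exact: cvg_atan_scaled.
      rewrite indicE mem_setE in_itv/= !subr_gt0.
      have [Yt'|tY] := ltrP (Y w) t; have [Ys'|sY] := ltrP (Y w) s.
      + by rewrite ltNge (ltW Ys')/= mulr0 subrr mulr0.
      + by rewrite lt_neqAle sY eq_sym Ys/= mulr1; lra.
      + by move: (le_lt_trans (le_trans st tY) Ys'); rewrite ltxx.
      + by rewrite andbF mulr0 subrr mulr0.
  - exact: finite_measure_integrable_cst.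
  - move=> k w _ /=; rewrite normrM ger0_norm//; apply: ler_wpM2l => //.
    have := atan_ltpi2 ((t - Y w) / e k); have := atan_gtNpi2 ((t - Y w) / e k).
    have := atan_ltpi2 ((s - Y w) / e k); have := atan_gtNpi2 ((s - Y w) / e k).
    by rewrite ler_norml => ? ? ? ?; apply/andP; split; lra.
rewrite (cvg_unique _ cv1 cv2)//.
rewrite RintegralZl//; last first.
  apply: (@integrable_bounded _ _ _ _ _ 1) => [|w].
    by apply: (measurableT_comp _ mY); exact: measurable_indic.
  by rewrite indicE; case: (_ \in _); rewrite ?normr1 ?normr0.
congr (_ * _); rewrite /Rintegral (_ : (fun w => _) = (fun w => (\1_(Y @^-1` J) w)%:E))//.
by rewrite integral_indic// setIT.
Qed.

(** The density and the inversion integral divided by 2 pi have the same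
integral over every compact interval. *)
Theorem fourier_inversion :
  {ae mu, forall x, f x = (2 * pi)^-1 * synthesis cos_mean sin_mean x}.
Proof.
have twopi : 0 < 2 * pi :> R by rewrite mulr_gt0// pi_gt0.
have ms := measurable_synthesis ia ib (ltr01 : 0 < 1 :> R).
apply: ae_eq_from_intervals => //.
- exact: measurable_funM.
- by move=> x; rewrite mulr_ge0 ?synthesis_mean_ge0// invr_ge0 ltW.
- apply/integrableP; split; first exact/measurable_EFinP.
  rewrite (eq_integral (fun x : mR => (f x)%:E)); last by move=> x _; rewrite /= ger0_norm.
  by rewrite -fE// preimage_setT probability_setT ltry.
move=> s t st.
have muI : (mu `[s, t] < +oo)%E by rewrite lebesgue_measure_itv/=; case: ifP => _; rewrite ?ltry.
have ig : mu.-integrable `[s, t] (EFin \o synthesis cos_mean sin_mean).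
  apply: (@le_integrable _ _ _ mu _ (measurable_itv _) _ (cst (\int[mu]_u amp u)%:E)).
  - by apply/measurable_EFinP; exact: measurable_funTS.
  - by move=> x _ /=; rewrite lee_fin (le_trans (synthesis_le ia ib x))// ler_norm.
  - apply: measurable_bounded_integrable => //; exists `|\int[mu]_u amp u|; split => //.
    by move=> z Cz x _; exact: ltW.
have iz : mu.-integrable `[s, t] (EFin \o (fun x => (2 * pi)^-1 * synthesis cos_mean sin_mean x)).
  have mI : measurable (`[s, t]%classic : set mR) by exact: measurable_itv.
  exact: (integrableZl mI (2 * pi)^-1 ig).
have fin : (\int[mu]_(x in `[s, t]) ((2 * pi)^-1 * synthesis cos_mean sin_mean x)%:E)%E
    \is a fin_num.
  exact: integrable_fin_num iz.
rewrite -[RHS]fineK//.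
rewrite -[X in _ = (fine X)%:E]/(\int[mu]_(x in `[s, t]) (((2 * pi)^-1 * synthesis cos_mean sin_mean x)%:E))%E.
rewrite -/(Rintegral mu _ (fun x => (2 * pi)^-1 * synthesis cos_mean sin_mean x)).
rewrite RintegralZl// synthesis_itv// mulKf ?gt_eqF// fineK; last first.
  by rewrite fin_num_measure// -[X in measurable X]setTI; exact: mY.
rewrite fE//.
rewrite integral_itv_bndo_bndc; last exact/measurable_EFinP/measurable_funTS.
by rewrite integral_itv_obnd_cbnd//; exact/measurable_EFinP/measurable_funTS.
Qed.

End inversion.

(** * Means of functions of independent variables *)

Section transfer_of_laws.
Context {R : realType} {d d' : measure_display}.
Context {Omega : measurableType d} {T : measurableType d'}.
Variable P : probability Omega R.
Implicit Types (Y Z : Omega -> T) (h k : T -> R).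

Lemma eq_law_Rintegral Y Z h (M : R) :
  measurable_fun [set: Omega] Y -> measurable_fun [set: Omega] Z ->
  measurable_fun [set: T] h -> (forall y, `|h y| <= M) ->
  (forall A, measurable A -> P (Y @^-1` A) = P (Z @^-1` A)) ->
  \int[P]_w h (Y w) = \int[P]_w h (Z w).
Proof.
move=> mY mZ mh hM YZ.
pose Ym : {mfun Omega >-> T} := HB.pack Y (isMeasurableFun.Build _ _ _ _ _ mY).
pose Zm : {mfun Omega >-> T} := HB.pack Z (isMeasurableFun.Build _ _ _ _ _ mZ).
have mhE : measurable_fun [set: T] (EFin \o h) by exact/measurable_EFinP.
have ih (X : {mfun Omega >-> T}) : P.-integrable [set: Omega] ((EFin \o h) \o X).
  by apply: (@integrable_bounded _ _ _ _ _ M) => //; exact: measurableT_comp.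
rewrite /Rintegral; congr fine.
transitivity (\int[distribution P Ym]_y (h y)%:E)%E.
  exact/esym/(integral_distribution mhE (ih Ym)).
transitivity (\int[distribution P Zm]_y (h y)%:E)%E.
  by apply: eq_measure_integral => A mA _; exact: YZ.
exact: (integral_distribution mhE (ih Zm)).
Qed.

(** The law of the pair is the product of the laws, since they agree on
rectangles; the integral of a product of functions of one variable each then
factorises. *)
Lemma indep_Rintegral Y Z h k (M : R) :
  measurable_fun [set: Omega] Y -> measurable_fun [set: Omega] Z ->
  measurable_fun [set: T] h -> measurable_fun [set: T] k ->
  (forall y, `|h y| <= M) -> (forall y, `|k y| <= M) ->
  (forall A B, measurable A -> measurable B ->
     P (Y @^-1` A `&` Z @^-1` B) = P (Y @^-1` A) * P (Z @^-1` B))%E ->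
  \int[P]_w (h (Y w) * k (Z w)) = (\int[P]_w h (Y w)) * (\int[P]_w k (Z w)).
Proof.
move=> mY mZ mh mk hM kM YZ.
pose Ym : {mfun Omega >-> T} := HB.pack Y (isMeasurableFun.Build _ _ _ _ _ mY).
pose Zm : {mfun Omega >-> T} := HB.pack Z (isMeasurableFun.Build _ _ _ _ _ mZ).
pose YZf w := (Y w, Z w).
have mYZ : measurable_fun [set: Omega] YZf by exact: measurable_fun_pair.
pose YZm : {mfun Omega >-> (T * T)%type} :=
  HB.pack YZf (isMeasurableFun.Build _ _ _ _ _ mYZ).
have law X : measurable X ->
    (distribution P Ym \x distribution P Zm)%E X = distribution P YZm X.
  by move=> mX; apply: product_measure_unique.
have M0 : 0 <= M by exact: le_trans (hM point).
have mhk : measurable_fun [set: T * T] (fun z => h z.1 * k z.2).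
  apply: measurable_funM; first exact: measurableT_comp mh measurable_fst.
  exact: measurableT_comp mk measurable_snd.
have hkM z : `|h z.1 * k z.2| <= M * M by rewrite normrM ler_pM.
have iE (X : {mfun Omega >-> T}) (l : T -> R) : measurable_fun [set: T] l ->
   (forall y, `|l y| <= M) ->
   \int[distribution P X]_y l y = \int[P]_w l (X w).
  move=> ml lM; rewrite /Rintegral; congr fine.
  apply: (@integral_distribution _ _ _ _ _ P X (EFin \o l)); first exact/measurable_EFinP.
  by apply: (@integrable_bounded _ _ _ _ _ M) => //; exact: measurableT_comp.
transitivity (\int[distribution P YZm]_z (h z.1 * k z.2)).
  rewrite /Rintegral; congr fine; apply/esym.
  apply: (@integral_distribution _ _ _ _ _ P YZm (fun z => (h z.1 * k z.2)%:E)).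
    exact/measurable_EFinP.
  apply: (@integrable_bounded _ _ _ P (fun w => h (Y w) * k (Z w)) (M * M)).
    by apply: measurable_funM; exact: measurableT_comp.
  by move=> w; exact: (hkM (Y w, Z w)).
have ic : (distribution P Ym).-integrable [set: T] (EFin \o cst M).
  exact: finite_measure_integrable_cst.
have ic' : (distribution P Zm).-integrable [set: T] (EFin \o cst M).
  exact: finite_measure_integrable_cst.
transitivity (\int[distribution P Ym]_y \int[distribution P Zm]_z (h y * k z)).
  have it := integrable_tensor mhk ic ic' (fun x y => hkM (x, y)).
  rewrite {1}/Rintegral (eq_measure_integral (distribution P Ym \x distribution P Zm)%E); last first.
    by move=> A mA _; exact/esym/law.
  rewrite -(integral12_prod_meas1 it) /Rintegral; congr fine.
  apply: eq_integral => y _; rewrite fineK//; apply: integrable_fin_num => //.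
  exact: integrable_sectionl mhk ic' (fun x y => hkM (x, y)) y.
transitivity (\int[distribution P Ym]_y (h y * \int[distribution P Zm]_z k z)).
  apply: eq_Rintegral => y _; rewrite RintegralZl//.
  exact: (@integrable_bounded _ _ _ _ _ M).
rewrite RintegralZr//; last exact: (@integrable_bounded _ _ _ _ _ M).
by rewrite !iE.
Qed.

End transfer_of_laws.

Section mean_square_error.
Context {R : realType} {d : measure_display} {Omega : measurableType d}.
Variable P : probability Omega R.

Lemma Rintegral_sum (I : Type) (s : seq I) (F : I -> Omega -> R) :
  (forall i, P.-integrable [set: Omega] (EFin \o F i)) ->
  \int[P]_w (\sum_(i <- s) F i w) = \sum_(i <- s) \int[P]_w F i w.
Proof.
move=> iF; elim: s => [|i s IHs].
  rewrite big_nil -[RHS](mul0r (fine (P setT))) -Rintegral_cst//.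
  by apply: eq_Rintegral => w _; rewrite big_nil.
rewrite big_cons -IHs -RintegralD//.
  by apply: eq_Rintegral => w _; rewrite big_cons.
rewrite (_ : EFin \o _ = (fun w => \sum_(i <- s) (F i w)%:E)%E); last first.
  by apply/funext => w /=; rewrite sumEFin.
by apply: integrable_sum => // j _; exact: iF.
Qed.

Lemma Rintegral_cst_prob (c : R) : \int[P]_w c = c.
Proof.
rewrite Rintegral_cst// -[RHS]mulr1; congr (_ * _).
by rewrite -[RHS]/(fine 1%E); congr fine; exact: probability_setT.
Qed.

Variables (n : nat) (Y : 'I_n -> Omega -> R) (Y0 : Omega -> R).
Hypothesis n0 : (0 < n)%N.
Hypothesis mY : forall i, measurable_fun [set: Omega] (Y i).
Hypothesis mY0 : measurable_fun [set: Omega] Y0.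
Hypothesis lawY : forall i (A : set (measurableTypeR R)), measurable A ->
  P (Y i @^-1` A) = P (Y0 @^-1` A).
Hypothesis indepY : forall i j (A B : set (measurableTypeR R)), i != j ->
  measurable A -> measurable B ->
  (P (Y i @^-1` A `&` Y j @^-1` B) = P (Y i @^-1` A) * P (Y j @^-1` B))%E.

(** Bias and variance: after centring, the cross terms of the square of the sum
vanish by pairwise independence; the variance is at most the second moment. *)
Lemma mean_square_error_le (g : R -> R) (M c : R) :
  measurable_fun [set: R] g -> (forall y, `|g y| <= M) ->
  \int[P]_w ((n%:R^-1 * \sum_(j < n) g (Y j w) - c) ^+ 2) <=
  (\int[P]_w g (Y0 w) - c) ^+ 2 + n%:R^-1 * \int[P]_w (g (Y0 w) ^+ 2).
Proof.
move=> mg gM; set mean := \int[P]_w g (Y0 w).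
have M0 : 0 <= M by exact: le_trans (gM 0).
pose h y := g y - mean.
have mh : measurable_fun [set: R] h by exact: measurable_funB.
have hM y : `|h y| <= M + `|mean| by rewrite (le_trans (ler_normB _ _))// lerD2r.
set B := M + `|mean| in hM.
have B0 : 0 <= B by rewrite addr_ge0.
have ib (k : Omega -> R) (K : R) : measurable_fun [set: Omega] k ->
    (forall w, `|k w| <= K) -> P.-integrable [set: Omega] (EFin \o k).
  by move=> mk kK; exact: (@integrable_bounded _ _ _ _ _ K).
have iY (k : R -> R) (K : R) (X : Omega -> R) : measurable_fun [set: R] k ->
    measurable_fun [set: Omega] X ->
    (forall y, `|k y| <= K) -> P.-integrable [set: Omega] (EFin \o (k \o X)).
  move=> mk mX kK; apply: (ib _ K); first exact: measurableT_comp mk mX.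
  by move=> w; exact: kK.
have ig := iY g M Y0 mg mY0 gM.
have g2M y : `|g y ^+ 2| <= M ^+ 2 by rewrite normrX ler_pXn2r ?nnegrE.
have ig2 := iY (fun y => g y ^+ 2) (M ^+ 2) Y0 (measurable_funX _ mg) mY0 g2M.
have ih j := iY h B (Y j) mh (mY j) hM.
have Eh0 : \int[P]_w h (Y0 w) = 0.
  by rewrite RintegralB// ?Rintegral_cst_prob ?subrr//; exact: finite_measure_integrable_cst.
have Eh j : \int[P]_w h (Y j w) = 0.
  by rewrite (eq_law_Rintegral (Z := Y0) _ _ mh hM (lawY j))// -/Eh0.
pose v := \int[P]_w (h (Y0 w) ^+ 2).
have h2B y : `|h y ^+ 2| <= B ^+ 2 by rewrite normrX ler_pXn2r ?nnegrE.
have Ehh i j : \int[P]_w (h (Y i w) * h (Y j w)) = if i == j then v else 0.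
  case: eqVneq => [<-|ij].
    transitivity (\int[P]_w (h (Y i w) ^+ 2)); first by apply: eq_Rintegral.
    exact: (@eq_law_Rintegral _ _ _ _ _ P _ _ (fun y => h y ^+ 2) _
      (mY i) mY0 (measurable_funX _ mh) h2B (lawY i)).
  rewrite (indep_Rintegral (mY i) (mY j) mh mh hM hM) ?Eh ?mul0r// => A C mA mC.
  exact: indepY.
have ihh i j : P.-integrable [set: Omega] (EFin \o (fun w => h (Y i w) * h (Y j w))).
  apply: (ib _ (B * B)) => [|w]; last by rewrite normrM ler_pM.
  by apply: measurable_funM; exact: measurableT_comp.
pose S w := \sum_(j < n) h (Y j w).
have iS : P.-integrable [set: Omega] (EFin \o S).
  rewrite (_ : EFin \o S = (fun w => \sum_(j < n) (h (Y j w))%:E)%E); last first.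
    by apply/funext => w /=; rewrite sumEFin.
  by apply: integrable_sum => // j _; exact: ih.
have S2E w : S w ^+ 2 = \sum_(i < n) \sum_(j < n) h (Y i w) * h (Y j w).
  by rewrite expr2 mulr_suml; apply: eq_bigr => i _; rewrite mulr_sumr.
have ihhs i : P.-integrable [set: Omega] (EFin \o (fun w => \sum_(j < n) h (Y i w) * h (Y j w))).
  rewrite (_ : EFin \o _ = (fun w => \sum_(j < n) (h (Y i w) * h (Y j w))%:E)%E); last first.
    by apply/funext => w /=; rewrite sumEFin.
  by apply: integrable_sum => // j _; exact: ihh.
have iS2 : P.-integrable [set: Omega] (EFin \o (fun w => S w ^+ 2)).
  rewrite (_ : EFin \o _ = (fun w => \sum_(i < n) (\sum_(j < n) h (Y i w) * h (Y j w))%:E)%E); last first.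
    by apply/funext => w /=; rewrite sumEFin S2E.
  by apply: integrable_sum => // i _; exact: ihhs.
have ES : \int[P]_w S w = 0.
  by rewrite Rintegral_sum// big1// => j _; exact: Eh.
have ES2 : \int[P]_w (S w ^+ 2) = n%:R * v.
  transitivity (\int[P]_w (\sum_(i < n) \sum_(j < n) h (Y i w) * h (Y j w))).
    by apply: eq_Rintegral => w _; exact: S2E.
  rewrite Rintegral_sum//.
  rewrite (eq_bigr (fun=> v)) => [|i _]; first by rewrite sumr_const card_ord mulr_natl.
  rewrite Rintegral_sum; last by move=> j; exact: ihh.
  by rewrite (bigD1 i)//= Ehh eqxx big1 ?addr0// => j; rewrite Ehh eq_sym => /negbTE ->.
have vE : v = \int[P]_w (g (Y0 w) ^+ 2) - mean ^+ 2.
  rewrite /v; transitivity (\int[P]_w ((g (Y0 w) ^+ 2 - 2 * mean * g (Y0 w)) + mean ^+ 2)).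
    by apply: eq_Rintegral => w _; rewrite /h; ring.
  have iZ := integrableZl measurableT (2 * mean) ig.
  rewrite RintegralD//; last 2 first.
  - exact: (integrableB measurableT ig2 iZ).
  - exact: finite_measure_integrable_cst.
  rewrite RintegralB// RintegralZl// Rintegral_cst_prob -/mean; ring.
have nn0 : n%:R != 0 :> R by rewrite pnatr_eq0 -lt0n.
(* expansion around the mean, in terms of the centred sum S *)
have -> : \int[P]_w ((n%:R^-1 * \sum_(j < n) g (Y j w) - c) ^+ 2) =
    \int[P]_w ((n%:R^-2 * S w ^+ 2 + 2 * n%:R^-1 * (mean - c) * S w) + (mean - c) ^+ 2).
  apply: eq_Rintegral => w _.
  have -> : \sum_(j < n) g (Y j w) = S w + n%:R * mean.
    by rewrite /S sumrB sumr_const card_ord mulr_natl subrK.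
  by field.
have iZ1 := integrableZl measurableT (n%:R^-2) iS2.
have iZ2 := integrableZl measurableT (2 * n%:R^-1 * (mean - c)) iS.
rewrite RintegralD//; last 2 first.
- exact: (integrableD measurableT iZ1 iZ2).
- exact: finite_measure_integrable_cst.
rewrite RintegralD// RintegralZl// RintegralZl// ES ES2 Rintegral_cst_prob.
rewrite mulr0 addr0 addrC lerD2l.
have -> : n%:R^-2 * (n%:R * v) = n%:R^-1 * v by field.
by rewrite ler_pM2l ?invr_gt0 ?ltr0n// vE lerBlDr lerDl sqr_ge0.
Qed.

End mean_square_error.

(** * Risk of the projection estimator *)

Section window_kernel.
Context {R : realType}.
Notation mu := (@lebesgue_measure R).
Notation mR := (measurableTypeR R).
Variable m : R.
Hypothesis m0 : 0 <= m.

Let I : set R := `[- m, m]%classic.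

Let mI : measurable (I : set mR). Proof. exact: measurable_itv. Qed.

(** The inverse Fourier transform of the indicator of [-m, m], that is, the
function sin(my) / (pi y) extended by continuity at 0. *)
Definition window_kernel (y : R) : R :=
  (2 * pi)^-1 * \int[mu]_(u in `[- m, m]) cos (u * y).

Let mind : measurable_fun [set: R] (\1_I : R -> R).
Proof. exact: measurable_indic. Qed.

Let iind : mu.-integrable [set: R] (EFin \o (\1_I : R -> R)).
Proof. exact: integrable_indic_itv. Qed.

Let indicM_integrable (h : R -> R) : measurable_fun [set: R] h ->
  (forall u, `|h u| <= 1) -> mu.-integrable [set: R] (EFin \o (fun u => \1_I u * h u)).
Proof.
move=> mh h1; apply: le_integrable iind => //.
  by apply/measurable_EFinP; exact: measurable_funM.
by move=> u _ /=; rewrite lee_fin normrM ler_piMr.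
Qed.

Let mcosM (y : R) : measurable_fun [set: R] (fun u : R => cos (u * y)).
Proof.
apply: (measurableT_comp (f := cos)); last exact: measurable_funM.
by apply: continuous_measurable_fun; exact: continuous_cos.
Qed.

Let msinM (y : R) : measurable_fun [set: R] (fun u : R => sin (u * y)).
Proof.
apply: (measurableT_comp (f := sin)); last exact: measurable_funM.
by apply: continuous_measurable_fun; exact: continuous_sin.
Qed.

Lemma window_kernelE y x : window_kernel (y - x) =
  (2 * pi)^-1 * synthesis (fun u => \1_I u * cos (u * y)) (fun u => \1_I u * sin (u * y)) x.
Proof.
rewrite /window_kernel Rintegral_mkcond; congr (_ * _); apply: eq_Rintegral => u _.
by rewrite patch_indic /wave/= mulrBr cosB mulrC -!mulrA mulrDr.
Qed.

Let indic_cos_integrable y : mu.-integrable [set: R] (EFin \o (fun u => \1_I u * cos (u * y))).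
Proof. by apply: indicM_integrable => // u; exact: cos_max. Qed.

Let indic_sin_integrable y : mu.-integrable [set: R] (EFin \o (fun u => \1_I u * sin (u * y))).
Proof. by apply: indicM_integrable => // u; exact: sin_max. Qed.

Let twopi : 0 < 2 * pi :> R. Proof. by rewrite mulr_gt0// pi_gt0. Qed.

Lemma measurable_window_kernel : measurable_fun [set: R] window_kernel.
Proof.
have H := measurable_synthesis (indic_cos_integrable 0) (indic_sin_integrable 0) ltr01.
have -> : window_kernel = (fun y => (2 * pi)^-1 *
   synthesis (fun u => \1_I u * cos (u * 0)) (fun u => \1_I u * sin (u * 0)) (- y)).
  apply/funext => y; rewrite -window_kernelE sub0r opprK//.
by apply: measurable_funM => //; apply: (measurableT_comp H).
Qed.

Lemma window_kernel_bounded : exists M, forall y, `|window_kernel y| <= M.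
Proof.
eexists => y; rewrite -[y]opprK -[- - y]add0r window_kernelE normrM.
apply: ler_wpM2l => //; apply: synthesis_le; first exact: indic_cos_integrable.
exact: indic_sin_integrable.
Qed.

(** Plancherel, the energy of the indicator being 2m. *)
Lemma window_kernel_energy y :
  (\int[mu]_x (window_kernel (y - x) ^+ 2)%:E <= (m / pi)%:E)%E.
Proof.
have pl := plancherel_le (indic_cos_integrable y) (indic_sin_integrable y).
under eq_integral do rewrite window_kernelE exprMn EFinM.
rewrite ge0_integralZl_EFin//; last 3 first.
- by move=> x _; rewrite lee_fin sqr_ge0.
- apply/measurable_EFinP/measurable_funX.
  exact: (measurable_synthesis (indic_cos_integrable y) (indic_sin_integrable y) ltr01).
- exact: sqr_ge0.
have q0 : (0 <= ((2 * pi)^-1 ^+ 2 : R)%:E)%E by rewrite lee_fin sqr_ge0.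
apply: (le_trans (lee_wpmul2l q0 pl)).
have -> : (\int[mu]_u ((\1_I u * cos (u * y)) ^+ 2 + (\1_I u * sin (u * y)) ^+ 2)%:E =
   (2 * m)%:E)%E.
  transitivity (\int[mu]_u (\1_I u)%:E)%E.
    apply: eq_integral => u _; rewrite !exprMn -mulrDr cos2Dsin2 mulr1.
    by rewrite indicE; case: (_ \in _); rewrite ?expr1n ?expr0n.
  rewrite integral_indic// setIT -[LHS]/(mu `[- m, m]%classic) lebesgue_measure_itv/= lte_fin.
  case: ltrP => [_|mm]; first by rewrite -EFinD; congr EFin; lra.
  have mle0 : m <= 0 by rewrite (le_trans mm)// oppr_le0.
  have -> : m = 0 by apply/eqP; rewrite eq_le mle0 m0.
  by rewrite mulr0.
have simpl_pi (p : R) : 0 < p -> (2 * p)^-1 ^+ 2 * (2 * p * (2 * m)) = m / p.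
  by move=> p0; field; rewrite gt_eqF.
by rewrite -!EFinM lee_fin simpl_pi// pi_gt0.
Qed.

(** Averaging the shifted kernel truncates the inversion integral to [-m, m]. *)
Lemma window_kernel_mean d (Omega : measurableType d) (P : probability Omega R)
    (Y : Omega -> R) x : measurable_fun [set: Omega] Y ->
  \int[P]_w window_kernel (Y w - x) =
  (2 * pi)^-1 * synthesis (fun u => \1_I u * cos_mean P Y u)
                          (fun u => \1_I u * sin_mean P Y u) x.
Proof.
move=> mY.
have mYx : measurable_fun [set: Omega] (fun w => Y w - x) by exact: measurable_funB.
have i1 : P.-integrable [set: Omega] (EFin \o cst 1) by exact: finite_measure_integrable_cst.
have mf : measurable_fun [set: (Omega * mR)%type]
    (fun z : Omega * mR => \1_I z.2 * cos (z.2 * (Y z.1 - x))).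
  apply: measurable_funM; first exact: measurableT_comp mind measurable_snd.
  apply: (measurableT_comp (f := cos)).
    by apply: continuous_measurable_fun; exact: continuous_cos.
  apply: measurable_funM => //.
  exact: (measurableT_comp mYx measurable_fst).
have mfle (w : Omega) (u : mR) : `|\1_I u * cos (u * (Y w - x))| <= 1 * \1_I u.
  by rewrite normrM mul1r ger0_norm// ler_piMr// cos_max.
rewrite /window_kernel RintegralZl//; last first.
  have iH := integrable_Rintegral_sectionl mf i1 iind mfle.
  apply: eq_integrable iH => // w _ /=; congr EFin.
  by rewrite [RHS]Rintegral_mkcond; apply: eq_Rintegral => u _; rewrite patch_indic/= mulrC.
congr (_ * _).
transitivity (\int[P]_w \int[mu]_u (\1_I u * cos (u * (Y w - x)))).
  apply: eq_Rintegral => w _.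
  by rewrite Rintegral_mkcond; apply: eq_Rintegral => u _; rewrite patch_indic/= mulrC.
rewrite (Rintegral_swap mf i1 iind mfle); apply: eq_Rintegral => u _ /=.
rewrite RintegralZl//; last first.
  apply: (@integrable_bounded _ _ _ _ _ 1) => [|w]; last exact: cos_max.
  apply: (measurableT_comp (f := cos)); last exact: measurable_funM.
  by apply: continuous_measurable_fun; exact: continuous_cos.
by rewrite -wave_mean// /wave -!mulrA mulrDr.
Qed.

End window_kernel.

Section projection_risk.
Context {R : realType} {d : measure_display} {Omega : measurableType d}.
Variable P : probability Omega R.
Notation mu := (@lebesgue_measure R).
Notation mR := (measurableTypeR R).
Variables (n : nat) (Y : 'I_n -> Omega -> R) (Y0 : Omega -> R).
Hypothesis n0 : (0 < n)%N.
Hypothesis mY : forall i, measurable_fun [set: Omega] (Y i).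
Hypothesis mY0 : measurable_fun [set: Omega] Y0.
Hypothesis lawY : forall i (A : set (measurableTypeR R)), measurable A ->
  P (Y i @^-1` A) = P (Y0 @^-1` A).
Hypothesis indepY : forall i j (A B : set (measurableTypeR R)), i != j ->
  measurable A -> measurable B ->
  (P (Y i @^-1` A `&` Y j @^-1` B) = P (Y i @^-1` A) * P (Y j @^-1` B))%E.

Let a := cos_mean P Y0.
Let b := sin_mean P Y0.
Hypothesis ia : mu.-integrable [set: R] (EFin \o a).
Hypothesis ib : mu.-integrable [set: R] (EFin \o b).

Variable f : R -> R.
Hypothesis mf : measurable_fun [set: R] f.
Hypothesis f0 : forall x, 0 <= f x.
Hypothesis fE : forall A : set mR, measurable A ->
  (P (Y0 @^-1` A) = \int[mu]_(x in A) (f x)%:E)%E.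

Variable m : R.
Hypothesis m0 : 0 <= m.
Let I : set R := `[- m, m]%classic.
Let mI : measurable (I : set mR). Proof. exact: measurable_itv. Qed.
Let twopi : 0 < 2 * pi :> R. Proof. by rewrite mulr_gt0// pi_gt0. Qed.

Let integrable_indicM (A : set mR) (h : R -> R) : measurable A ->
  mu.-integrable [set: R] (EFin \o h) ->
  mu.-integrable [set: R] (EFin \o (fun u => \1_A u * h u)).
Proof.
move=> mA ih; have mh := measurable_int mu ih.
apply: le_integrable ih => //.
  apply/measurable_EFinP; apply: measurable_funM; first exact: measurable_indic.
  exact/measurable_EFinP.
move=> u _ /=; rewrite lee_fin normrM indicE.
by case: (_ \in _); rewrite ?normr1 ?normr0 ?mul1r// mul0r.
Qed.

Let bias x := \int[P]_w window_kernel m (Y0 w - x) - f x.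

Let tail_a u := \1_(~` I) u * a u.
Let tail_b u := \1_(~` I) u * b u.

Let ita : mu.-integrable [set: R] (EFin \o tail_a).
Proof. by apply: integrable_indicM => //; exact: measurableC. Qed.

Let itb : mu.-integrable [set: R] (EFin \o tail_b).
Proof. by apply: integrable_indicM => //; exact: measurableC. Qed.

(** Subtracting the truncated inversion integral from the full one, which is the
density, leaves the frequencies outside [-m, m]. *)
Let biasE : {ae mu, forall x, bias x = - ((2 * pi)^-1 * synthesis tail_a tail_b x)}.
Proof.
have := fourier_inversion mY0 ia ib mf f0 fE.
apply: filterS; first exact: (ae_filter_ringOfSetsType mu).
move=> x /= fx; rewrite /bias window_kernel_mean// fx -mulrBr -mulrN; congr (_ * _).
rewrite /synthesis -RintegralB//; last 2 first.
- by apply: integrable_wave; exact: integrable_indicM.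
- exact: integrable_wave.
rewrite -mulN1r -RintegralZl//; last exact: integrable_wave.
apply: eq_Rintegral => u _; rewrite /wave /tail_a /tail_b.
have -> : \1_(~` I) u = 1 - \1_I u :> R.
  by rewrite !indicE in_setC; case: (_ \in _); rewrite /= ?subrr ?subr0.
move: (\1_I u : R) (cos _) (sin _) => i c s; rewrite -/a -/b; ring.
Qed.

Let measurable_mean : measurable_fun [set: R] (fun x => \int[P]_w window_kernel m (Y0 w - x)).
Proof.
rewrite (_ : (fun x => _) = (fun x => (2 * pi)^-1 *
   synthesis (fun u => \1_I u * a u) (fun u => \1_I u * b u) x)); last first.
  by apply/funext => x; rewrite window_kernel_mean.
apply: measurable_funM => //.
by apply: (measurable_synthesis _ _ ltr01); exact: integrable_indicM.
Qed.

Let mbias : measurable_fun [set: R] bias.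
Proof. exact: measurable_funB. Qed.

Let bias_energy : (\int[mu]_x (bias x ^+ 2)%:E <=
  ((2 * pi)^-1)%:E * \int[mu]_(u in ~` I) (a u ^+ 2 + b u ^+ 2)%:E)%E.
Proof.
have ms := measurable_synthesis ita itb (ltr01 : 0 < 1 :> R).
have -> : (\int[mu]_x (bias x ^+ 2)%:E =
    \int[mu]_x (((2 * pi)^-1 ^+ 2)%:E * (synthesis tail_a tail_b x ^+ 2)%:E))%E.
  apply: ge0_ae_eq_integral => //.
  - by apply/measurable_EFinP; exact: measurable_funX.
  - apply: emeasurable_funM => //; apply/measurable_EFinP; exact: measurable_funX.
  - by move=> x _; rewrite lee_fin sqr_ge0.
  - by move=> x _; rewrite -EFinM lee_fin mulr_ge0// sqr_ge0.
  - apply: filterS biasE; first exact: (ae_filter_ringOfSetsType mu).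
    by move=> x /= -> _; rewrite sqrrN exprMn.
rewrite ge0_integralZl_EFin//; last 3 first.
- by move=> x _; rewrite lee_fin sqr_ge0.
- by apply/measurable_EFinP/measurable_funX.
- exact: sqr_ge0.
have q0 : (0 <= ((2 * pi)^-1 ^+ 2 : R)%:E)%E by rewrite lee_fin sqr_ge0.
apply: (le_trans (lee_wpmul2l q0 (plancherel_le ita itb))).
rewrite muleA -EFinM.
have -> : (2 * pi)^-1 ^+ 2 * (2 * pi) = (2 * pi)^-1 :> R.
  by rewrite expr2 -mulrA mulVf ?mulr1// gt_eqF.
rewrite [in leRHS]integral_mkcond le_eqVlt; apply/orP; left; apply/eqP; congr (_ * _)%E.
apply: eq_integral => u _; rewrite patchE /tail_a /tail_b indicE.
by case: (u \in ~` I) => /=; rewrite ?mul1r// !mul0r expr0n addr0.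
Qed.

Let K_measurable : measurable_fun [set: (Omega * mR)%type]
  (fun z : Omega * mR => window_kernel m (Y0 z.1 - z.2)).
Proof.
apply: (measurableT_comp (measurable_window_kernel m)).
by apply: measurable_funB; [exact: (measurableT_comp mY0 measurable_fst)|exact: measurable_snd].
Qed.

(** Tonelli, the bound on the energy of the kernel being the same for all
shifts. *)
Let variance_energy :
  (\int[mu]_x \int[P]_w (window_kernel m (Y0 w - x) ^+ 2)%:E <= (m / pi)%:E)%E.
Proof.
have mK2 : measurable_fun [set: (Omega * mR)%type]
    (fun z : Omega * mR => (window_kernel m (Y0 z.1 - z.2) ^+ 2)%:E).
  by apply/measurable_EFinP; exact: measurable_funX.
have K2 (z : Omega * mR) : (0 <= (window_kernel m (Y0 z.1 - z.2) ^+ 2)%:E)%E.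
  by rewrite lee_fin sqr_ge0.
have <- : (\int[P]_w \int[mu]_x (window_kernel m (Y0 w - x) ^+ 2)%:E =
   \int[mu]_x \int[P]_w (window_kernel m (Y0 w - x) ^+ 2)%:E)%E.
  exact: (fubini_tonelli _ mK2 K2).
apply: (@le_trans _ _ (\int[P]_w (cst (m / pi)%:E w))%E).
  apply: ge0_le_integral => //.
  - by move=> w _; apply: integral_ge0 => x _; rewrite lee_fin sqr_ge0.
  - exact: (measurable_fun_fubini_tonelli_F _ mK2 K2).
  - by move=> w _; exact: window_kernel_energy.
rewrite integral_cst// -[leRHS]mule1 le_eqVlt; apply/orP; left; apply/eqP.
by congr (_ * _)%E; exact: probability_setT.
Qed.

(** Tonelli exchanges expectation and integral, the mean square error is bounded
at every point, and the two resulting terms are energies. *)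
Theorem projection_risk_le :
  (\int[P]_w \int[mu]_x
      ((n%:R^-1 * \sum_(j < n) window_kernel m (Y j w - x) - f x) ^+ 2)%:E <=
   ((2 * pi)^-1)%:E * \int[mu]_(u in ~` I) (a u ^+ 2 + b u ^+ 2)%:E +
   (m / (pi * n%:R))%:E)%E.
Proof.
have [M KM] := window_kernel_bounded m.
have mS : measurable_fun [set: (Omega * mR)%type]
    (fun z : Omega * mR => ((n%:R^-1 * \sum_(j < n) window_kernel m (Y j z.1 - z.2) - f z.2) ^+ 2)%:E).
  apply/measurable_EFinP/measurable_funX; apply: measurable_funB.
    apply: measurable_funM => //; apply: measurable_sum => j.
    apply: (measurableT_comp (measurable_window_kernel m)).
    by apply: measurable_funB; [exact: (measurableT_comp (mY j) measurable_fst)|exact: measurable_snd].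
  exact: (measurableT_comp mf measurable_snd).
have S0 (z : Omega * mR) :
   (0 <= ((n%:R^-1 * \sum_(j < n) window_kernel m (Y j z.1 - z.2) - f z.2) ^+ 2)%:E)%E.
  by rewrite lee_fin sqr_ge0.
have -> : (\int[P]_w \int[mu]_x
      ((n%:R^-1 * \sum_(j < n) window_kernel m (Y j w - x) - f x) ^+ 2)%:E =
   \int[mu]_x \int[P]_w
      ((n%:R^-1 * \sum_(j < n) window_kernel m (Y j w - x) - f x) ^+ 2)%:E)%E.
  exact: (fubini_tonelli _ mS S0).
have mK2 : measurable_fun [set: (Omega * mR)%type]
    (fun z : Omega * mR => (window_kernel m (Y0 z.1 - z.2) ^+ 2)%:E).
  by apply/measurable_EFinP; exact: measurable_funX.
have K2 (z : Omega * mR) : (0 <= (window_kernel m (Y0 z.1 - z.2) ^+ 2)%:E)%E.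
  by rewrite lee_fin sqr_ge0.
have mV : measurable_fun [set: R]
    (fun x : mR => \int[P]_w (window_kernel m (Y0 w - x) ^+ 2)%:E)%E.
  exact: (measurable_fun_fubini_tonelli_G _ mK2 K2).
have nV : (0 <= (n%:R^-1 : R)%:E)%E by rewrite lee_fin.
apply: (@le_trans _ _ (\int[mu]_x ((bias x ^+ 2)%:E +
   (n%:R^-1)%:E * \int[P]_w (window_kernel m (Y0 w - x) ^+ 2)%:E))%E).
  apply: ge0_le_integral => //.
  - by move=> x _; apply: integral_ge0 => w _; rewrite lee_fin sqr_ge0.
  - exact: (measurable_fun_fubini_tonelli_G _ mS S0).
  - apply: emeasurable_funD; first by apply/measurable_EFinP; exact: measurable_funX.
    exact: emeasurable_funM.
  move=> x _.
  pose g y := window_kernel m (y - x).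
  have mg : measurable_fun [set: R] g.
    apply: (measurableT_comp (measurable_window_kernel m)); exact: measurable_funB.
  have gM y : `|g y| <= M by exact: KM.
  have M0 : 0 <= M by exact: le_trans (gM 0).
  have mse := mean_square_error_le n0 mY mY0 lawY indepY (f x) mg gM.
  have fin1 : (\int[P]_w ((n%:R^-1 * \sum_(j < n) g (Y j w) - f x) ^+ 2)%:E)%E \is a fin_num.
    apply: integrable_fin_num => //.
    apply: (@integrable_bounded _ _ _ _ _ ((n%:R^-1 * \sum_(j < n) M + `|f x|) ^+ 2)).
      apply: measurable_funX; apply: measurable_funB => //.
      apply: measurable_funM => //; apply: measurable_sum => j.
      exact: measurableT_comp mg (mY j).
    move=> w; rewrite normrX ler_pXn2r ?nnegrE//; last first.
      by rewrite addr_ge0// mulr_ge0// sumr_ge0.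
    rewrite (le_trans (ler_normB _ _))// lerD2r normrM ger0_norm// ler_wpM2l//.
    by rewrite (le_trans (ler_norm_sum _ _ _))// ler_sum.
  have fin2 : (\int[P]_w (g (Y0 w) ^+ 2)%:E)%E \is a fin_num.
    apply: integrable_fin_num => //.
    apply: (@integrable_bounded _ _ _ _ _ (M ^+ 2)).
      by apply: measurable_funX; exact: measurableT_comp mg mY0.
    by move=> w; rewrite normrX ler_pXn2r ?nnegrE.
  by rewrite -(fineK fin1) -(fineK fin2) -EFinM -EFinD lee_fin.
rewrite ge0_integralD//; last 4 first.
- by move=> x _; rewrite lee_fin sqr_ge0.
- by apply/measurable_EFinP; exact: measurable_funX.
- by move=> x _; rewrite mule_ge0// integral_ge0// => w _; rewrite lee_fin sqr_ge0.
- exact: emeasurable_funM.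
apply: leeD; first exact: bias_energy.
rewrite ge0_integralZl//; last first.
  by move=> x _; apply: integral_ge0 => w _; rewrite lee_fin sqr_ge0.
apply: (le_trans (lee_wpmul2l nV variance_energy)).
by rewrite -EFinM lee_fin (invfM pi n%:R) (mulrC pi^-1) mulrCA.
Qed.

End projection_risk.

(** * Tail masses of stretched exponentials *)

Section stretched_exponential.
Context {R : realType}.
Notation mu := (@lebesgue_measure R).
Notation mR := (measurableTypeR R).

Definition stretched_exp (kap a u : R) : R := expR (- (kap * u `^ a)).

Definition tail_mass (kap a m : R) : R :=
  pi^-1 * \int[mu]_(u in `[m, +oo[) stretched_exp kap a u.

Section decay.
Variables kap a : R.
Hypothesis kap0 : 0 < kap.
Hypothesis a0 : 0 < a.

Notation e := (stretched_exp kap a).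

Lemma stretched_exp_gt0 u : 0 < e u. Proof. exact: expR_gt0. Qed.

Lemma measurable_stretched_exp : measurable_fun [set: R] e.
Proof.
apply: (measurableT_comp (f := expR)) => //; apply: measurable_funN.
by apply: measurable_funM => //; exact: measurable_powR.
Qed.

Lemma stretched_exp_decr s t : 0 <= s -> s < t -> e t < e s.
Proof.
move=> s0 st; rewrite ltr_expR ltrN2 ltr_pM2l//.
by rewrite gt0_ltr_powR ?nnegrE// ltW// (le_lt_trans s0).
Qed.

Lemma stretched_exp_nincr s t : 0 <= s -> s <= t -> e t <= e s.
Proof.
by move=> s0; rewrite le_eqVlt => /predU1P[->//|st]; exact/ltW/stretched_exp_decr.
Qed.

(** A crude integrable majorant, available for every exponent: exp(z) dominates
(z/k)^k, and k is chosen with k a >= 2. The Poisson kernel with parameter 1 is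
2 / (1 + u^2). *)
Lemma stretched_exp_decay : exists2 C, 0 < C & forall u, 0 <= u -> e u <= C * poisson 1 u.
Proof.
pose k := (Num.truncn (2 / a)).+1.
have ka : 2 <= k%:R * a by rewrite -ler_pdivrMr// ltW// truncnS_gt.
pose B := (k%:R / kap) ^+ k.
have B0 : 0 < B by rewrite exprn_gt0// divr_gt0.
exists (1 + B); first by rewrite addr_gt0.
move=> u u0; rewrite /poisson expr1n mulr1 mulrA ler_pdivlMr; last first.
  by rewrite ltr_pwDl// sqr_ge0.
have e1 : e u <= 1 by rewrite -expR0 ler_expR oppr_le0 mulr_ge0// ?powR_ge0// ltW.
have [u1|u1] := lerP u 1.
  have u2 : u ^+ 2 <= 1 by rewrite expr_le1.
  have : e u * (1 + u ^+ 2) <= 1 * 2.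
    by apply: ler_pM => //; [exact/ltW/stretched_exp_gt0|rewrite addr_ge0 ?sqr_ge0|lra].
  by move: B0; lra.
have u00 : 0 < u by rewrite (lt_trans _ u1).
have eB : e u <= B / u ^+ 2.
  set z := kap * u `^ a.
  have z0 : 0 < z by rewrite mulr_gt0// powR_gt0.
  (* from 1 + z/k <= exp(z/k) *)
  have zk : (z / k%:R) ^+ k <= expR z.
    have zE : z = k%:R * (z / k%:R) by rewrite mulrC divfK// pnatr_eq0.
    rewrite [in leRHS]zE expRM_natl; apply: lerXn2r.
    - by rewrite nnegrE divr_ge0// ltW.
    - by rewrite nnegrE ltW// expR_gt0.
    - by rewrite (le_trans _ (expR_ge1Dx _))// lerDr.
  have zk0 : 0 < (z / k%:R) ^+ k by rewrite exprn_gt0// divr_gt0.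
  rewrite /stretched_exp -/z expRN.
  apply: (@le_trans _ _ ((z / k%:R) ^+ k)^-1); first by rewrite lef_pV2 ?posrE ?expR_gt0.
  rewrite -exprVn invf_div /z invfM mulrA exprMn -/B ler_pM2l// exprVn.
  rewrite lef_pV2 ?posrE ?exprn_gt0 ?powR_gt0//.
  rewrite -(powR_mulrn k (powR_ge0 u a)) -powRrM -(powR_mulrn 2 u0).
  by apply: ler_powR; [exact: ltW|rewrite mulrC].
have u2 : 1 <= u ^+ 2 by rewrite expr_ge1 // ltW.
have : e u * (1 + u ^+ 2) <= B / u ^+ 2 * (2 * u ^+ 2).
  apply: ler_pM => //; [exact/ltW/stretched_exp_gt0|rewrite addr_ge0 ?sqr_ge0//|lra].
have -> : B / u ^+ 2 * (2 * u ^+ 2) = 2 * B by field; rewrite gt_eqF.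
lra.
Qed.

Lemma integrable_poisson (C : R) : mu.-integrable [set: R] (fun u => (C * poisson 1 u)%:E).
Proof.
have i1 : mu.-integrable [set: R] (EFin \o poisson (1 : R)).
  apply/integrableP; split.
    apply/measurable_EFinP; apply: continuous_measurable_fun.
    exact: continuous_poisson ltr01.
  rewrite (eq_integral (fun u : mR => (poisson 1 (u - 0))%:E)); last first.
    by move=> u _; rewrite subr0 /= ger0_norm// poisson_ge0.
  exact: le_lt_trans (integral_poisson_le 0 ltr01) (ltry _).
exact: (integrableZl measurableT C i1).
Qed.

Lemma integrable_stretched_exp m : 0 <= m ->
  mu.-integrable `[m, +oo[ (EFin \o e).
Proof.
move=> m0; have [C C0 eC] := stretched_exp_decay.
apply: (@le_integrable _ _ _ mu _ (measurable_itv _) _ (fun u => (C * poisson 1 u)%:E)).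
- by apply/measurable_EFinP/measurable_funTS; exact: measurable_stretched_exp.
- move=> u /=; rewrite in_itv/= andbT => mu'; rewrite lee_fin ger0_norm ?expR_ge0//.
  by rewrite (le_trans _ (ler_norm _))// eC// (le_trans m0).
- exact: integrableS (integrable_poisson C).
Qed.

Lemma tail_massB s t : 0 <= s -> s <= t ->
  tail_mass kap a s - tail_mass kap a t = pi^-1 * \int[mu]_(u in `[s, t]) e u.
Proof.
move=> s0 st; rewrite /tail_mass -mulrBr; congr (_ * _).
have := Rintegral_itvB (a := BLeft s) (b := +oo%O) (x := t) (integrable_stretched_exp s0).
rewrite bnd_simp => /(_ st isT).
rewrite Rintegral_itv_obnd_cbnd; last first.
  apply: integrableS (integrable_stretched_exp s0) => //.
  by apply: subset_itvr; rewrite bnd_simp.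
by move=> <-; rewrite opprB addrC subrK.
Qed.

Let integrable_itv s t : 0 <= s -> mu.-integrable `[s, t] (EFin \o e).
Proof.
move=> s0; apply: integrableS (integrable_stretched_exp s0) => //.
by apply: subset_itvl; rewrite bnd_simp.
Qed.

Let integral_cst_itv (c s t : R) : s <= t -> \int[mu]_(u in `[s, t]) c = c * (t - s).
Proof.
move=> st; rewrite Rintegral_cst//; congr (_ * _).
rewrite -[LHS]/(fine (mu `[s, t]%classic)) lebesgue_measure_itv/= lte_fin.
by move: st; rewrite le_eqVlt => /predU1P[->|->//]; rewrite ltxx subrr.
Qed.

Let integrable_cst_itv (c s t : R) : mu.-integrable `[s, t] (EFin \o cst c).
Proof.
have muI : (mu `[s, t] < +oo)%E by rewrite lebesgue_measure_itv/=; case: ifP => _; rewrite ?ltry.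
by apply: measurable_bounded_integrable => //; exists `|c|; split => // z cz x _; exact: ltW.
Qed.

(** As the integrand decreases, the drop of the tail mass over an interval lies
between the products of its length with the least and the greatest value; these two bounds
replace the derivative in the minimisation. *)
Lemma tail_mass_drop_le s t : 0 <= s -> s <= t ->
  tail_mass kap a s - tail_mass kap a t <= pi^-1 * (e s * (t - s)).
Proof.
move=> s0 st; rewrite tail_massB//.
apply: ler_wpM2l; first by rewrite invr_ge0 pi_ge0.
apply: (@le_trans _ _ (\int[mu]_(u in `[s, t]) e s)); last by rewrite (integral_cst_itv _ st).
apply: le_Rintegral.
- exact: measurable_itv.
- exact: integrable_itv.
- exact: integrable_cst_itv.
- by move=> u /=; rewrite in_itv/= => /andP[su _]; exact: stretched_exp_nincr.
Qed.

Lemma tail_mass_drop_ge s t : 0 <= s -> s <= t ->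
  pi^-1 * (e t * (t - s)) <= tail_mass kap a s - tail_mass kap a t.
Proof.
move=> s0 st; rewrite tail_massB//.
apply: ler_wpM2l; first by rewrite invr_ge0 pi_ge0.
apply: (@le_trans _ _ (\int[mu]_(u in `[s, t]) e t)); first by rewrite (integral_cst_itv _ st).
apply: le_Rintegral.
- exact: measurable_itv.
- exact: integrable_cst_itv.
- exact: integrable_itv.
- move=> u /=; rewrite in_itv/= => /andP[su ut].
  by apply: stretched_exp_nincr => //; exact: le_trans su.
Qed.

Lemma tail_mass_ge0 m : 0 <= tail_mass kap a m.
Proof.
by rewrite mulr_ge0 ?invr_ge0 ?pi_ge0//; apply: Rintegral_ge0 => u _; exact: expR_ge0.
Qed.

Let chain_lt (p x y z A B A' B' C : R) :
  x - y <= p * (A * (C - B)) -> y - z <= p * (A' * (B' - C)) ->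
  p * (A' * (B' - C)) < p * (A * (B' - C)) ->
  x + p * (A * B) < z + p * (A * B').
Proof. by rewrite !mulrBr; lra. Qed.

Let chain_gt (p x y z A B A' B' C : R) :
  p * (A' * (C - B)) <= x - y -> p * (A * (B' - C)) <= y - z ->
  p * (A * (C - B)) < p * (A' * (C - B)) ->
  z + p * (A * B') < x + p * (A * B).
Proof. by rewrite !mulrBr; lra. Qed.

Section minimizer.
Variable n : nat.
Hypothesis n2 : (2 <= n)%N.

Definition critical_cutoff : R := (ln n%:R / kap) `^ a^-1.

Let n1 : 1 < n%:R :> R. Proof. by rewrite ltr1n. Qed.
Let n0 : 0 < n%:R :> R. Proof. by rewrite (lt_trans _ n1). Qed.

Let ln0 : 0 < ln n%:R :> R. Proof. exact: ln_gt0. Qed.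

Lemma critical_cutoff_gt0 : 0 < critical_cutoff.
Proof. by rewrite powR_gt0// divr_gt0. Qed.

Lemma critical_cutoff_powR : kap * critical_cutoff `^ a = ln n%:R.
Proof.
rewrite -powRrM mulVf ?gt_eqF// powRr1 ?divr_ge0 ?ltW//.
by rewrite mulrC divfK// gt_eqF.
Qed.

Lemma stretched_exp_critical : e critical_cutoff = n%:R^-1.
Proof. by rewrite /stretched_exp critical_cutoff_powR expRN lnK. Qed.

(** The variance has the constant slope exp(- kap c^a) / pi, where c is the
critical cutoff, and the tail mass falls at a smaller rate after c and at a
larger rate before c. Comparing at the midpoint between c and m makes the
inequality strict. *)
Lemma tail_mass_minimizer :
  unique_minimizer_ge0 (fun m => tail_mass kap a m + variance_bound n m) critical_cutoff.
Proof.
have c0 := critical_cutoff_gt0; set c := critical_cutoff.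
have pi0 : 0 < pi^-1 :> R by rewrite invr_gt0 pi_gt0.
have vE m : variance_bound n m = pi^-1 * (e c * m).
  by rewrite /variance_bound stretched_exp_critical invfM mulrC -mulrA.
split; first exact: ltW.
move=> m m0 mc; rewrite !vE.
have [cm|mc'|/eqP] := ltgtP c m; last by rewrite eq_sym (negbTE mc).
- pose q := (c + m) / 2.
  have cq : c < q by rewrite /q; lra.
  have qm : q < m by rewrite /q; lra.
  have q0 : 0 <= q by rewrite ltW// (lt_trans c0).
  have H1 := tail_mass_drop_le (ltW c0) (ltW cq).
  have H2 := tail_mass_drop_le q0 (ltW qm).
  have H3 : pi^-1 * (e q * (m - q)) < pi^-1 * (e c * (m - q)).
    by rewrite ltr_pM2l// ltr_pM2r ?subr_gt0// stretched_exp_decr// ltW.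
  exact: chain_lt H1 H2 H3.
- pose q := (c + m) / 2.
  have mq : m < q by rewrite /q; lra.
  have qc : q < c by rewrite /q; lra.
  have q0 : 0 <= q by rewrite ltW// (le_lt_trans m0).
  have H1 := tail_mass_drop_ge m0 (ltW mq).
  have H2 := tail_mass_drop_ge q0 (ltW qc).
  have H3 : pi^-1 * (e c * (q - m)) < pi^-1 * (e q * (q - m)).
    by rewrite ltr_pM2l// ltr_pM2r ?subr_gt0// stretched_exp_decr.
  exact: chain_gt H1 H2 H3.
Qed.

End minimizer.

Lemma continuous_powR_gt0 (q u : R) : 0 < u -> {for u, continuous (fun x : R => x `^ q)}.
Proof.
move=> u0; apply/differentiable_continuous/derivable1_diffP.
by apply: derivable_powR; rewrite in_itv/= andbT.
Qed.

Lemma continuous_stretched_exp u : 0 < u -> {for u, continuous e}.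
Proof.
move=> u0; apply: (@continuous_comp _ _ _ (fun x => - (kap * x `^ a)) expR).
  by apply: cvgN; apply: cvgM; [exact: cvg_cst|exact: continuous_powR_gt0].
exact: continuous_expR.
Qed.

End decay.

(** The substitution u = c v, which brings the critical cutoff to 1. *)
Lemma tail_mass_scale kap a c : 0 < kap -> 0 < a -> 0 < c ->
  tail_mass kap a c = c * tail_mass (kap * c `^ a) a 1.
Proof.
move=> kap0 a0 c0; rewrite /tail_mass mulrCA; congr (_ * _).
have kc0 : 0 < kap * c `^ a by rewrite mulr_gt0// powR_gt0.
rewrite -RintegralZl//; last exact: integrable_stretched_exp.
pose F : R -> R := c \*: (@id R : R -> R).
have dF x : is_derive x (1 : R) F c.
  by rewrite /F; apply: is_derive_eq; rewrite /GRing.scale/= mulr1.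
have F'E : derive1 F = cst c by apply/funext => x; rewrite derive1E; case: (dF x).
rewrite -[in LHS](mulr1 c) -[c * 1]/(F 1) /Rintegral; congr fine.
rewrite (@increasing_ge0_integration_by_substitutiony _ F (stretched_exp kap a) 1).
- apply: eq_integral => x; rewrite inE/= in_itv/= andbT => x1; congr EFin.
  rewrite fctE F'E mulrC; congr (_ * _).
  rewrite /stretched_exp /F /= /GRing.scale/= powRM ?mulrA// ?ltW//.
  exact: lt_le_trans x1.
- by move=> x y _ _ xy; rewrite /F /GRing.scale/= ltr_pM2l.
- by rewrite F'E => x _; exact: cvg_cst.
- by rewrite F'E; exact: is_cvg_cst.
- by rewrite F'E; exact: is_cvg_cst.
- split => [x _|]; first by case: (dF x).
  apply: cvg_at_right_filter; apply/differentiable_continuous/derivable1_diffP.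
  by case: (dF 1).
- by apply: gt0_cvgMry => //; exact: cvg_id.
- apply: continuous_in_subspaceT => x; rewrite inE/= in_itv/= andbT => Fx.
  apply: continuous_stretched_exp; apply: lt_le_trans Fx.
  by rewrite /F/= /GRing.scale/= mulr1.
- by move=> x _; exact: expR_ge0.
Qed.

(** After rescaling, the integrand at v >= 1 is n^(- v^a) = (1/n) n^(1 - v^a),
and the exponent is nonpositive, so that n may be replaced by 2 in the second
factor: n^(- v^a) <= (2/n) 2^(- v^a). The remaining integral depends on [a]
only. *)
Lemma tail_mass_critical_le kap a n : 0 < kap -> 0 < a -> (2 <= n)%N ->
  tail_mass kap a (critical_cutoff kap a n) <=
  2 * tail_mass (ln 2) a 1 * (critical_cutoff kap a n / n%:R).
Proof.
move=> kap0 a0 n2; have c0 := critical_cutoff_gt0 a kap0 n2.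
have ln20 : 0 < ln 2 :> R by rewrite ln_gt0// ltr1n.
have nn0 : 0 < n%:R :> R by rewrite ltr0n (leq_trans _ n2).
have ln2n : ln 2 <= ln n%:R :> R by rewrite ler_ln ?posrE// ler_nat.
have lnn0 := lt_le_trans ln20 ln2n.
rewrite tail_mass_scale// critical_cutoff_powR//.
rewrite [leRHS](_ : _ = critical_cutoff kap a n * (2 / n%:R * tail_mass (ln 2) a 1)); last by ring.
apply: ler_wpM2l; first exact: ltW.
rewrite /tail_mass [leRHS]mulrCA.
apply: ler_wpM2l; first by rewrite invr_ge0 pi_ge0.
rewrite -RintegralZl//; last exact: integrable_stretched_exp.
apply: le_Rintegral => //.
- exact: integrable_stretched_exp.
- have mI : measurable (`[1%R, +oo[%classic : set mR) by exact: measurable_itv.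
  exact: (integrableZl mI (2 / n%:R) (integrable_stretched_exp ln20 a0 ler01)).
move=> v /=; rewrite in_itv/= andbT => v1.
have va1 : 1 <= v `^ a by rewrite -(powRr0 v); apply: ler_powR => //; exact: ltW.
rewrite /stretched_exp.
have -> : 2 / n%:R = expR (ln 2 - ln n%:R) :> R.
  by rewrite expRD expRN !lnK// posrE.
rewrite -expRD ler_expR.
have : (ln n%:R - ln 2) * 1 <= (ln n%:R - ln 2) * v `^ a.
  by apply: ler_wpM2l => //; rewrite subr_ge0.
move: (ln n%:R) (ln 2) (v `^ a) => A B D; lra.
Qed.

End stretched_exponential.

(** * The two squared bias bounds are tail masses *)

Section bias_bounds_as_tail_masses.
Context {R : realType}.
Notation mu := (@lebesgue_measure R).
Notation mR := (measurableTypeR R).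

Lemma gamma_substitution (kap a s t : R) : 0 < kap -> 0 < a -> 0 < s -> s <= t ->
  (\int[mu]_(z in `[(kap * s `^ a)%R, (kap * t `^ a)%R]) (z `^ (a^-1 - 1) * expR (- z))%:E =
   \int[mu]_(u in `[s, t]) (a * kap `^ a^-1 * stretched_exp kap a u)%:E)%E.
Proof.
move=> kap0 a0 s0 st.
pose F : R -> R := kap \*: (fun x : R => x `^ a).
pose F1 x : R := kap * (a * x `^ (a - 1)).
have dF (x : R) : 0 < x -> is_derive x (1 : R) F (F1 x).
  move=> x0; have dp : is_derive x (1 : R) ((@powR R) ^~ a) (a * x `^ (a - 1)).
    exact: is_derive1_powR.
  exact: is_deriveZ.
have F1E (x : R) : 0 < x -> derive1 F x = F1 x.
  by move=> x0; rewrite derive1E; case: (dF x x0).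
have cF1 (x : R) : 0 < x -> {for x, continuous F1}.
  move=> x0; apply: cvgM; first exact: cvg_cst.
  by apply: cvgM; [exact: cvg_cst|exact: continuous_powR_gt0].
have cdF (x : R) : 0 < x -> {for x, continuous (derive1 F)}.
  move=> x0; rewrite /prop_for /continuous_at F1E//.
  apply: cvg_trans (cF1 x x0); apply: near_eq_cvg; near=> y.
  by rewrite F1E//; near: y; exact: lt_nbhsr.
have cF (x : R) : 0 < x -> {for x, continuous F}.
  by move=> x0; apply/differentiable_continuous/derivable1_diffP; case: (dF x x0).
have t0 : 0 < t by exact: lt_le_trans st.
rewrite -[(kap * s `^ a)%R]/(F s) -[(kap * t `^ a)%R]/(F t).
rewrite integration_by_substitution_increasing//.
- apply: eq_integral => x; rewrite inE/= in_itv/= => /andP[sx _].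
  have x0 : 0 < x by exact: lt_le_trans sx.
  congr EFin; rewrite fctE/= F1E//.
  (* the power of z in the Gamma integrand cancels the Jacobian *)
  have xx : (x `^ a) `^ (a^-1 - 1) * x `^ (a - 1) = 1.
    rewrite -powRrM mulrBr mulfV ?gt_eqF// mulr1 -powRD; last by apply/implyP => _; rewrite gt_eqF.
    by rewrite addrA subrK subrr powRr0.
  have kk : kap `^ a^-1 = kap * kap `^ (a^-1 - 1) by rewrite mulr_powRB1 ?invr_gt0// ltW.
  rewrite /F1 /stretched_exp /F/= /GRing.scale/= powRM ?powR_ge0 ?ltW// kk.
  by rewrite -[RHS]mulr1 -[X in _ = _ * X]xx; ring.
- move=> x y; rewrite !in_itv/= => /andP[sx _] /andP[sy _] xy.
  rewrite /F/= /GRing.scale/= ltr_pM2l// gt0_ltr_powR ?nnegrE//.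
    by rewrite ltW// (lt_le_trans s0).
  by rewrite ltW// (lt_le_trans s0).
- by move=> x; rewrite in_itv/= => /andP[sx _]; apply: cdF; exact: lt_trans sx.
- by apply/cvg_ex; exists (derive1 F s); apply: cvg_at_right_filter; exact: cdF.
- by apply/cvg_ex; exists (derive1 F t); apply: cvg_at_left_filter; exact: cdF.
- split.
  + by move=> x; rewrite in_itv/= => /andP[sx _]; case: (dF x (lt_trans s0 sx)).
  + by apply: cvg_at_right_filter; exact: cF.
  + by apply: cvg_at_left_filter; exact: cF.
- apply: continuous_in_subspaceT => x; rewrite inE/= in_itv/= => /andP[Fx _].
  have x0 : 0 < x by apply: lt_le_trans Fx; rewrite /F/= /GRing.scale/= mulr_gt0// powR_gt0.
  apply: cvgM; first exact: continuous_powR_gt0.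
  apply: (@continuous_comp _ _ _ (fun y : R => - y) expR); last exact: continuous_expR.
  exact: opp_continuous.
Unshelve. all: end_near.
Qed.

(** The substitution on compact intervals inside the open half line, where the
power is differentiable, followed by monotone convergence; this covers [m = 0],
where the integrand on the Gamma side may blow up. *)
Lemma gamma_substitution_infty (kap a m : R) : 0 < kap -> 0 < a -> 0 <= m ->
  (\int[mu]_(z in `](kap * m `^ a)%R, +oo[) (z `^ (a^-1 - 1) * expR (- z))%:E =
   \int[mu]_(u in `]m, +oo[) (a * kap `^ a^-1 * stretched_exp kap a u)%:E)%E.
Proof.
move=> kap0 a0 m0.
(* [S k, T k] increases to ]m, +oo[ *)
pose S (k : nat) : R := m + k.+1%:R^-1.
pose T (k : nat) : R := m + k.+1%:R.
pose F (x : R) : R := kap * x `^ a.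
have S0 k : 0 < S k by rewrite ltr_wpDl// invr_gt0.
have mS k : m < S k by rewrite ltrDl invr_gt0.
have ST k : S k <= T k.
  by rewrite lerD2l (@le_trans _ _ 1)// ?invf_le1// ler1n.
have Sdecr k l : (k <= l)%N -> S l <= S k by move=> kl; rewrite lerD2l lef_pV2 ?posrE// ler_nat.
have Tincr k l : (k <= l)%N -> T k <= T l by move=> kl; rewrite lerD2l ler_nat.
have Fle x y : 0 <= x -> x <= y -> F x <= F y.
  move=> x0 xy; rewrite ler_pM2l// ge0_ler_powR ?nnegrE//; first exact: ltW.
  exact: le_trans xy.
have Flt x y : 0 <= x -> x < y -> F x < F y.
  move=> x0 xy; rewrite ltr_pM2l// gt0_ltr_powR ?nnegrE//.
  by rewrite ltW// (le_lt_trans x0).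
have exk x : m < x -> exists k, S k <= x <= T k.
  move=> mx.
  pose k := (Num.truncn (x - m)^-1 + Num.truncn (x - m))%N.
  have xm0 : 0 < x - m by rewrite subr_gt0.
  exists k; apply/andP; split.
    rewrite /S addrC -lerBrDr invf_ple ?posrE// ltW//.
    by rewrite (lt_le_trans (truncnS_gt _))// ler_nat ltnS leq_addr.
  rewrite /T addrC -lerBlDr ltW//.
  by rewrite (lt_le_trans (truncnS_gt _))// ler_nat ltnS leq_addl.
pose D k : set R := `[S k, T k]%classic.
pose E k : set R := `[F (S k), F (T k)]%classic.
have UD : \bigcup_k D k = `]m, +oo[%classic.
  apply/seteqP; split => [x [k _]|x] /=; rewrite !in_itv/= ?andbT.
    by move=> /andP[Sx _]; exact: lt_le_trans (mS k) Sx.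
  by move=> /exk[k Hk]; exists k => //; rewrite /D/= in_itv.
have UE : \bigcup_k E k = `]F m, +oo[%classic.
  apply/seteqP; split => [x [k _]|x] /=; rewrite !in_itv/= ?andbT.
    by move=> /andP[Sx _]; exact: lt_le_trans (Flt _ _ m0 (mS k)) Sx.
  move=> Fx; pose u := (x / kap) `^ a^-1.
  have x0 : 0 < x by apply: le_lt_trans Fx; rewrite mulr_ge0 ?powR_ge0// ltW.
  have u0 : 0 <= u by exact: powR_ge0.
  have Fu : F u = x.
    rewrite /F /u -powRrM mulVf ?gt_eqF// powRr1 ?divr_ge0 ?ltW//.
    by rewrite mulrC divfK// gt_eqF.
  have mu' : m < u.
    by rewrite ltNge; apply/negP => /(Fle _ _ u0); rewrite Fu leNgt Fx.
  have [k /andP[Su uT]] := exk u mu'.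
  exists k => //; rewrite /E/= in_itv/= -Fu Fle ?Fle//; exact: ltW.
have mg : measurable_fun [set: R] (fun z : R => z `^ (a^-1 - 1) * expR (- z)).
  apply: measurable_funM; first exact: measurable_powR.
  by apply: (measurableT_comp (f := expR)) => //; exact: measurable_funN.
have me : measurable_fun [set: R] (fun u : R => a * kap `^ a^-1 * stretched_exp kap a u).
  by apply: measurable_funM => //; exact: measurable_stretched_exp.
have cvE : (\int[mu]_(z in E k) (z `^ (a^-1 - 1) * expR (- z))%:E @[k --> \oo] -->
   \int[mu]_(z in \bigcup_k E k) (z `^ (a^-1 - 1) * expR (- z))%:E)%E.
  apply: ge0_nondecreasing_set_cvg_integral => //.
  - move=> k l kl; rewrite subsetEset; apply: subset_itv; rewrite bnd_simp Fle ?Sdecr ?Tincr//.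
      exact: ltW.
    by rewrite (le_trans (ltW (S0 k))).
  - by move=> k; exact: measurable_itv.
  - by move=> k; apply/measurable_EFinP; exact: measurable_funTS.
  - by move=> k x _; rewrite lee_fin mulr_ge0 ?powR_ge0 ?expR_ge0.
have cvD : (\int[mu]_(u in D k) (a * kap `^ a^-1 * stretched_exp kap a u)%:E @[k --> \oo] -->
   \int[mu]_(u in \bigcup_k D k) (a * kap `^ a^-1 * stretched_exp kap a u)%:E)%E.
  apply: ge0_nondecreasing_set_cvg_integral => //.
  - move=> k l kl; rewrite subsetEset; apply: subset_itv; rewrite bnd_simp ?Sdecr ?Tincr//.
  - by move=> k; exact: measurable_itv.
  - by move=> k; apply/measurable_EFinP; exact: measurable_funTS.
  - by move=> k x _; rewrite lee_fin !mulr_ge0 ?powR_ge0 ?expR_ge0// ltW.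
rewrite UD in cvD; rewrite UE in cvE.
have fE : (fun k => \int[mu]_(z in E k) (z `^ (a^-1 - 1) * expR (- z))%:E)%E =
  (fun k => \int[mu]_(u in D k) (a * kap `^ a^-1 * stretched_exp kap a u)%:E)%E.
  by apply/funext => k; exact: gamma_substitution.
rewrite fE in cvE.
exact: (cvg_unique _ cvE cvD).
Qed.

Lemma upper_GammaE (kap a m : R) : 0 < kap -> 0 < a -> 0 <= m ->
  upper_Gamma a^-1 (kap * m `^ a) = a * kap `^ a^-1 * pi * tail_mass kap a m.
Proof.
move=> kap0 a0 m0; rewrite /upper_Gamma /tail_mass.
have mg : measurable_fun [set: R] (fun z : R => z `^ (a^-1 - 1) * expR (- z)).
  apply: measurable_funM; first exact: measurable_powR.
  by apply: (measurableT_comp (f := expR)) => //; exact: measurable_funN.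
have me : measurable_fun [set: R] (fun u : R => a * kap `^ a^-1 * stretched_exp kap a u).
  by apply: measurable_funM => //; exact: measurable_stretched_exp.
have intE : \int[mu]_(z in `[kap * m `^ a, +oo[) (z `^ (a^-1 - 1) * expR (- z)) =
    \int[mu]_(u in `[m, +oo[) (a * kap `^ a^-1 * stretched_exp kap a u).
  congr fine.
  rewrite -integral_itv_obnd_cbnd; last by apply/measurable_EFinP; exact: measurable_funTS.
  rewrite -[RHS]integral_itv_obnd_cbnd; last by apply/measurable_EFinP; exact: measurable_funTS.
  exact: gamma_substitution_infty.
rewrite intE RintegralZl; [|exact: measurable_itv|exact: integrable_stretched_exp].
by rewrite -!mulrA mulVKf// gt_eqF// pi_gt0.
Qed.

Lemma bias1_sqE (Delta sg m : R) : 0 <= m ->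
  bias1_sq Delta sg m = tail_mass (Delta * sg ^+ 2) 2 m.
Proof.
move=> m0; rewrite /bias1_sq /tail_mass; congr (_ * _).
apply: eq_Rintegral => u; rewrite inE/= in_itv/= andbT => mu'.
by rewrite /stretched_exp powR_mulrn// (le_trans m0).
Qed.

Lemma cutoff1E (Delta sg : R) n : 0 <= Delta * sg ^+ 2 -> (2 <= n)%N ->
  cutoff1 Delta sg n = critical_cutoff (Delta * sg ^+ 2) 2 n.
Proof.
move=> D0 n2; rewrite /cutoff1 /critical_cutoff powR12_sqrt// divr_ge0// ln_ge0//.
by rewrite ler1n (leq_trans _ n2).
Qed.

(** The value of [kap] for which kap m^alpha = (2m / pi)^alpha M Delta. *)
Definition stable_rate (Delta M alpha : R) : R := M * Delta * (2 / pi) `^ alpha.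

Section stable.
Variables Delta M alpha : R.
Hypothesis MD0 : 0 < M * Delta.
Hypothesis a0 : 0 < alpha.

Let q0 : 0 < 2 / pi :> R. Proof. by rewrite divr_gt0// pi_gt0. Qed.

Lemma stable_rate_gt0 : 0 < stable_rate Delta M alpha.
Proof. by rewrite mulr_gt0// powR_gt0. Qed.

Lemma stable_rate_powR :
  stable_rate Delta M alpha `^ alpha^-1 = (M * Delta) `^ alpha^-1 * (2 / pi).
Proof.
rewrite /stable_rate powRM ?powR_ge0// ?ltW// -powRrM mulfV ?gt_eqF// powRr1//.
exact: ltW.
Qed.

Lemma bias2_sqE m : 0 <= m ->
  bias2_sq Delta M alpha m = tail_mass (stable_rate Delta M alpha) alpha m.
Proof.
move=> m0; rewrite /bias2_sq.
have -> : (2 * m / pi) `^ alpha * M * Delta = stable_rate Delta M alpha * m `^ alpha.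
  rewrite (_ : 2 * m / pi = 2 / pi * m); last by rewrite -!mulrA (mulrC m).
  by rewrite powRM// ?ltW// /stable_rate; ring.
rewrite upper_GammaE//; last exact: stable_rate_gt0.
rewrite stable_rate_powR.
have MDa : 0 < (M * Delta) `^ alpha^-1 by exact: powR_gt0.
move: (tail_mass _ _ _) ((M * Delta) `^ _) MDa => t D D0.
have cancel (p : R) : 0 < p -> alpha * (D * (2 / p)) * p * t / (2 * alpha * D) = t.
  by move=> p0; field; rewrite !gt_eqF.
exact: cancel (pi_gt0 R).
Qed.

Lemma cutoff2E n : (2 <= n)%N ->
  cutoff2 Delta M alpha n = critical_cutoff (stable_rate Delta M alpha) alpha n.
Proof.
move=> n2; rewrite /cutoff2 /critical_cutoff.
have L0 : 0 <= ln n%:R :> R by rewrite ln_ge0// ler1n (leq_trans _ n2).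
have r0 := stable_rate_gt0.
rewrite !powRM ?invr_ge0// ?ltW//.
rewrite mulrCA; congr (_ * _).
have invE (x : R) : 0 <= x -> x^-1 `^ alpha^-1 = (x `^ alpha^-1)^-1.
  by move=> x0; rewrite -powR_inv1// powRAC powR_inv1 ?powR_ge0.
rewrite (invE _ (ltW MD0)) (invE _ (ltW r0)) stable_rate_powR.
by rewrite (invfM _ (2 / pi)) invf_div mulrC.
Qed.

End stable.

End bias_bounds_as_tail_masses.

(** * Consequences of a bound on the characteristic function *)

Section characteristic_envelope.
Context {R : realType} {d : measure_display} {Omega : measurableType d}.
Variable P : probability Omega R.
Notation mu := (@lebesgue_measure R).
Notation mR := (measurableTypeR R).
Variable Y : Omega -> R.
Hypothesis mY : measurable_fun [set: Omega] Y.
Variables kap al u0 : R.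
Hypothesis kap0 : 0 < kap.
Hypothesis al0 : 0 < al.
Hypothesis u0_ge0 : 0 <= u0.

Let a := cos_mean P Y.
Let b := sin_mean P Y.

Hypothesis energy_le1 : forall u, a u ^+ 2 + b u ^+ 2 <= 1.
Hypothesis energy_le : forall u, u0 <= `|u| ->
  a u ^+ 2 + b u ^+ 2 <= stretched_exp kap al `|u|.

(** One is added to [h] so that the measurability of parameter integrals of
nonnegative functions applies. *)
Let measurable_mean (h : R -> R) : measurable_fun [set: R] h -> (forall y, `|h y| <= 1) ->
  measurable_fun [set: R] (fun u => \int[P]_w h (u * Y w)).
Proof.
move=> mh h1.
have mhY u : measurable_fun [set: Omega] (fun w => h (u * Y w)).
  by apply: (measurableT_comp mh); exact: measurable_funM.
have ih u : P.-integrable [set: Omega] (EFin \o (fun w => h (u * Y w))).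
  by apply: (@integrable_bounded _ _ _ _ _ 1) => // w; exact: h1.
rewrite (_ : (fun u => _) = (fun u => fine (\int[P]_w (1 + h (u * Y w))%:E)%E - 1)); last first.
  apply/funext => u; rewrite -[fine _]/(\int[P]_w (1 + h (u * Y w))).
  rewrite RintegralD//; last exact: finite_measure_integrable_cst.
  by rewrite Rintegral_cst_prob addrC addKr.
apply: measurable_funB => //; apply: (measurableT_comp (f := fine)) => //.
apply: (@measurable_fun_fubini_tonelli_F _ _ mR Omega R P
  (fun z : mR * Omega => (1 + h (z.1 * Y z.2))%:E)).
  apply/measurable_EFinP; apply: measurable_funD => //; apply: (measurableT_comp mh).
  apply: measurable_funM => //; exact: (measurableT_comp mY measurable_snd).
move=> z; rewrite lee_fin -lerBlDl sub0r lerNl.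
by rewrite (le_trans _ (h1 (z.1 * Y z.2)))// -normrN ler_norm.
Qed.

Let ma : measurable_fun [set: R] a.
Proof.
apply: measurable_mean; last exact: cos_max.
by apply: continuous_measurable_fun; exact: continuous_cos.
Qed.

Let mb : measurable_fun [set: R] b.
Proof.
apply: measurable_mean; last exact: sin_max.
by apply: continuous_measurable_fun; exact: continuous_sin.
Qed.

Let poisson_decr (x y : R) : `|x| <= `|y| -> poisson 1 y <= poisson 1 x.
Proof.
move=> xy; rewrite /poisson ler_pM2l// lef_pV2 ?posrE ?ltr_pwDl ?sqr_ge0 ?expr1n//.
by rewrite lerD2l -(ger0_norm (sqr_ge0 x)) -(ger0_norm (sqr_ge0 y)) !normrX ler_pXn2r ?nnegrE.
Qed.

(** Bounded by 1 on |u| < u0, where [poisson 1 u] is at least [poisson 1 u0],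
and by the square root of the stretched exponential beyond. *)
Let component_integrable (h : R -> R) : measurable_fun [set: R] h ->
  (forall u, h u ^+ 2 <= a u ^+ 2 + b u ^+ 2) -> mu.-integrable [set: R] (EFin \o h).
Proof.
move=> mh hle.
have k20 : 0 < kap / 2 by rewrite divr_gt0.
have [C C0 eC] := stretched_exp_decay k20 al0.
have p0 u : 0 < poisson (1 : R) u.
  by rewrite /poisson divr_gt0// ltr_pwDl ?sqr_ge0// expr1n.
apply: (@le_integrable _ _ _ mu _ measurableT _
  (fun u => ((C + (poisson 1 u0)^-1) * poisson 1 u)%:E)).
- exact/measurable_EFinP.
- move=> u _ /=; rewrite lee_fin [leRHS]ger0_norm; last first.
    by rewrite mulr_ge0// ?ltW// addr_gt0// invr_gt0.
  rewrite mulrDl.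
  have [uu0|u0u] := ltrP `|u| u0.
    have h1 : `|h u| <= 1.
      rewrite -(@ler_pXn2r _ 2) ?nnegrE// expr1n -normrX ger0_norm ?sqr_ge0//.
      exact: le_trans (hle u) (energy_le1 u).
    rewrite (le_trans h1)// ler_wpDl//; first by rewrite mulr_ge0 ?ltW.
    rewrite mulrC ler_pdivlMr// mul1r; apply: poisson_decr.
    by rewrite (ger0_norm u0_ge0) ltW.
  have he : `|h u| <= stretched_exp (kap / 2) al `|u|.
    rewrite -(@ler_pXn2r _ 2) ?nnegrE ?expR_ge0// -normrX ger0_norm ?sqr_ge0//.
    rewrite (le_trans (hle u))// (le_trans (energy_le u0u))//.
    rewrite /stretched_exp expr2 -expRD ler_expR -opprD lerN2.
    by rewrite -mulrDl -splitr.
  rewrite (le_trans he)// (le_trans (eC _ (normr_ge0 u)))//.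
  have -> : poisson 1 `|u| = poisson 1 u.
    by rewrite /poisson -normrX ger0_norm ?sqr_ge0.
  by rewrite lerDl mulr_ge0 ?ltW// invr_gt0.
- exact: integrable_poisson.
Qed.

Lemma cos_mean_integrable : mu.-integrable [set: R] (EFin \o a).
Proof. by apply: component_integrable => // u; rewrite lerDl sqr_ge0. Qed.

Lemma sin_mean_integrable : mu.-integrable [set: R] (EFin \o b).
Proof. by apply: component_integrable => // u; rewrite lerDr sqr_ge0. Qed.

(** On the frequencies between [m] and [u0], if any, only the bound by 1 is
available; it costs at most u0 / pi. Evenness of the bounds cancels the factor 2
of the normalisation. *)
Lemma tail_energy_le (m : R) : 0 <= m ->
  ((2 * pi)^-1%:E * \int[mu]_(u in ~` `[(- m)%R, m]) (a u ^+ 2 + b u ^+ 2)%:E <=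
   (tail_mass kap al m + (if m < u0 then u0 / pi else 0))%:E)%E.
Proof.
move=> m0.
pose e := stretched_exp kap al.
pose J : set R := `]m, +oo[%classic.
pose U : set R := `]-oo, u0[%classic.
(* an even majorant of the energy outside the window, the second indicator
covering the frequencies below [u0] *)
pose g (u : R) : R := \1_J `|u| * (e `|u| + \1_U `|u|).
have mJ : measurable (J : set mR) by exact: measurable_itv.
have mU : measurable (U : set mR) by exact: measurable_itv.
have me : measurable_fun [set: R] e by exact: measurable_stretched_exp.
have mg0 : measurable_fun [set: R] (fun u : R => \1_J u * (e u + \1_U u)).
  apply: measurable_funM; first exact: measurable_indic.
  by apply: measurable_funD => //; exact: measurable_indic.
have mg : measurable_fun [set: R] g.
  exact: (measurableT_comp mg0 (@normr_measurable _ _)).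
have g0 u : 0 <= g u by rewrite mulr_ge0// addr_ge0// expR_ge0.
have step1 : (\int[mu]_(u in ~` `[(- m)%R, m]) (a u ^+ 2 + b u ^+ 2)%:E <= \int[mu]_u (g u)%:E)%E.
  rewrite integral_mkcond; apply: ge0_le_integral => //.
  - by move=> u _; rewrite patchE; case: ifP => // _; rewrite lee_fin addr_ge0 ?sqr_ge0.
  - apply/(measurable_restrictT _ _).1; first by apply: measurableC; exact: measurable_itv.
    by apply/measurable_EFinP/measurable_funTS; apply: measurable_funD; exact: measurable_funX.
  - exact/measurable_EFinP.
  move=> u _; rewrite patchE; case: ifPn => [|_]; last by rewrite lee_fin.
  rewrite in_setC mem_setE in_itv/= -ler_norml -ltNge => mu'.
  rewrite lee_fin /g indicE mem_setE in_itv/= mu' mul1r indicE mem_setE in_itv/=.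
  have [uu0|u0u] := ltrP `|u| u0; last by rewrite addr0; exact: energy_le.
  by rewrite ler_wpDl ?expR_ge0.
have step2 : (\int[mu]_u (g u)%:E = 2%:E * \int[mu]_(u in `[0%R, +oo[) (g u)%:E)%E.
  by apply: ge0_integral_even => // u; rewrite /g normrN.
have step3 : (\int[mu]_(u in `[0%R, +oo[) (g u)%:E <=
    \int[mu]_(u in `[m, +oo[) (e u)%:E + (if m < u0 then u0 else 0)%:E)%E.
  pose h (u : R) : R := \1_J u * (e u + \1_U u).
  have h0 u : 0 <= h u by rewrite mulr_ge0// addr_ge0// expR_ge0.
  have gh : (\int[mu]_(u in `[0%R, +oo[) (g u)%:E = \int[mu]_(u in `[0%R, +oo[) (h u)%:E)%E.
    apply: eq_integral => u; rewrite inE/= in_itv/= andbT => uge0.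
    by rewrite /g ger0_norm.
  rewrite gh; apply: (@le_trans _ _ (\int[mu]_u (h u)%:E)%E).
    apply: ge0_subset_integral => //; first exact/measurable_EFinP.
    by move=> u _; rewrite lee_fin.
  have hE : (\int[mu]_u (h u)%:E = \int[mu]_u ((\1_J u * e u)%:E + (\1_(J `&` U) u)%:E))%E.
    by apply: eq_integral => u _; rewrite /h mulrDr EFinD indicI.
  rewrite hE ge0_integralD; last 5 first.
  - exact: measurableT.
  - by move=> u _; rewrite lee_fin mulr_ge0// expR_ge0.
  - by apply/measurable_EFinP; apply: measurable_funM => //; exact: measurable_indic.
  - by move=> u _; rewrite lee_fin.
  - apply/measurable_EFinP; apply: measurable_indic; exact: measurableI.
  apply: leeD.
    rewrite -integral_itv_obnd_cbnd; last by apply/measurable_EFinP; exact: measurable_funTS.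
    rewrite [leRHS]integral_mkcond le_eqVlt; apply/orP; left; apply/eqP.
    apply: eq_integral => u _; rewrite patchE indicE.
    by case: (u \in J); rewrite ?mul1r ?mul0r.
  rewrite integral_indic//; last exact: measurableI.
  rewrite setIT (_ : J `&` U = `]m, u0[%classic); last first.
    rewrite /J /U; apply/seteqP; split => u /=; rewrite !in_itv/= ?andbT.
      by move=> [-> ->].
    by move=> /andP[].
  rewrite -[leLHS]/(mu `]m, u0[%classic) lebesgue_measure_itv/= lte_fin.
  by case: ifP => // _; rewrite -EFinD lee_fin gerBl.
apply: (@le_trans _ _ ((2 * pi)^-1%:E * (2%:E *
   (\int[mu]_(u in `[m, +oo[) (e u)%:E + (if m < u0 then u0 else 0)%:E)))%E).
  apply: lee_wpmul2l; first by rewrite lee_fin invr_ge0 mulr_ge0// pi_ge0.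
  by rewrite (le_trans step1)// step2 lee_wpmul2l.
rewrite -[X in (_ * (_ * (X + _)))%E]fineK; last first.
  by apply: integrable_fin_num => //; exact: integrable_stretched_exp.
rewrite -EFinD -!EFinM lee_fin /tail_mass.
rewrite -[fine _]/(\int[mu]_(u in `[m, +oo[) e u).
rewrite le_eqVlt; apply/orP; left; apply/eqP.
rewrite (invfM 2 pi) mulrACA mulVf// mul1r mulrDr; congr (_ + _).
by case: ifP => _; rewrite ?mulr0// mulrC.
Qed.

End characteristic_envelope.

(** * The characteristic function of a Levy process *)

Section change_to_density.
Context {R : realType}.
Notation mu := (@lebesgue_measure R).
Notation mR := (measurableTypeR R).
Variable nu : {measure set mR -> \bar R}.
Variable p : R -> R.
Hypothesis nup : has_density nu p.

Let mp : measurable_fun [set: mR] p. Proof. by case: nup. Qed.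
Let p0 x : 0 <= p x. Proof. by case: nup. Qed.
Let nuE (A : set mR) : measurable A -> (nu A = \int[mu]_(x in A) (p x)%:E)%E.
Proof. by case: nup => _ _; exact. Qed.

Import HBNNSimple.

(** The change of measure for simple functions, to be extended to nonnegative
functions by monotone convergence. *)
Let integral_density_nnsfun (f : {nnsfun mR >-> R}) :
  (\int[nu]_x (f x)%:E = \int[mu]_x (f x * p x)%:E)%E.
Proof.
under [LHS]eq_integral do rewrite fimfunE -fsumEFin//.
rewrite [LHS]ge0_integral_fsum//; last 2 first.
- by move=> r; exact/measurable_EFinP/measurableT_comp.
- by move=> n x _; rewrite EFinM nnfun_muleindic_ge0.
under [RHS]eq_integral.
  move=> x xD; rewrite EFinM fimfunE -fsumEFin// ge0_mule_fsuml; last first.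
    by move=> r; rewrite EFinM nnfun_muleindic_ge0.
  over.
rewrite [RHS]ge0_integral_fsum//; last 2 first.
- move=> r; apply: emeasurable_funM; last exact/measurable_EFinP.
  by apply/measurable_EFinP; exact: measurableT_comp.
- move=> n x _; apply: mule_ge0; last by rewrite lee_fin.
  by rewrite EFinM nnfun_muleindic_ge0.
apply: eq_fsbigr => r _.
rewrite integralZl_indic_nnsfun//= integral_indic//= setIT nuE//.
have [r0|r0] := leP 0 r; last first.
  have fr : f @^-1` [set r] = set0.
    by apply/seteqP; split => x //= fxr; move: r0; rewrite -fxr ltNge fun_ge0.
  rewrite fr integral_set0 mule0; apply/esym; apply: integral0_eq => x _.
  by rewrite indicE in_set0 mulr0 mul0e.
rewrite integral_mkcond -ge0_integralZl//; last 2 first.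
- apply/(measurable_restrictT _ _).1 => //.
  by apply/measurable_EFinP; exact: measurable_funTS.
- by move=> x _; rewrite patchE; case: ifP => _ //; rewrite lee_fin.
apply: eq_integral => x _; rewrite patchE indicE.
by case: (x \in _); rewrite ?mulr1 ?mulr0 ?mul0e ?mule0.
Qed.

Lemma ge0_integral_density (g : R -> R) : measurable_fun [set: R] g ->
  (forall x, 0 <= g x) ->
  (\int[nu]_x (g x)%:E = \int[mu]_x (g x * p x)%:E)%E.
Proof.
move=> mg g0.
have mEg : measurable_fun [set: mR] (EFin \o g) by exact/measurable_EFinP.
pose f_ := nnsfun_approx measurableT mEg.
have f_cvg x : (f_ n x)%:E @[n --> \oo] --> (g x)%:E.
  by apply: (cvg_nnsfun_approx measurableT mEg) => // y _; rewrite lee_fin.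
have f_nd x m n : (m <= n)%N -> (f_ m x <= f_ n x)%R.
  by move=> mn; exact/lefP/(nd_nnsfun_approx measurableT mEg).
transitivity (limn (fun n => \int[nu]_x (f_ n x)%:E))%E.
  rewrite -monotone_convergence//.
  - by apply: eq_integral => x _; apply/esym/cvg_lim => //; exact: f_cvg.
  - by move=> n; exact/measurable_EFinP.
  - by move=> n x _; rewrite lee_fin.
  - by move=> x _ m n mn; rewrite lee_fin f_nd.
transitivity (limn (fun n => \int[mu]_x (f_ n x * p x)%:E))%E.
  by congr (limn _); apply/funext => n; exact: integral_density_nnsfun.
rewrite -monotone_convergence//.
- apply: eq_integral => x _; apply/cvg_lim => //.
  apply: cvg_EFin; first exact: nearW.
  by apply: cvgMl; have /fine_cvgP[_] := f_cvg x.
- by move=> n; apply/measurable_EFinP; exact: measurable_funM.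
- by move=> n x _; rewrite lee_fin mulr_ge0.
- by move=> x _ m n mn; rewrite lee_fin ler_wpM2r// f_nd.
Qed.

End change_to_density.

Section cosine_lower_bound.
Context {R : realType}.

(** A function with decreasing slopes lies above its chord: [k1] and [k2] are
its mean slopes on the two sides of [z], the function being 0 at 0, [s] at [z]
and 1 at [h]. *)
Let chord (h z s k1 k2 : R) : 0 < h -> 0 < z -> z < h ->
  s = k1 * z -> 1 - s = k2 * (h - z) -> k2 <= k1 -> h^-1 * z <= s.
Proof.
move=> h0 z0 zh -> E k21; rewrite ler_pdivrMl// mulrA; apply: ler_peMl; first exact: ltW.
have : k2 * (h - z) <= k1 * (h - z) by rewrite ler_wpM2r// subr_ge0 ltW.
rewrite -E mulrBr (mulrC h); lra.
Qed.

(** Concavity of the sine on [0, pi/2], with slopes provided by the mean value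
theorem. *)
Lemma jordan_sine (z : R) : 0 <= z <= pi / 2 -> (pi / 2)^-1 * z <= sin z.
Proof.
have h0 : 0 < pi / 2 :> R by rewrite divr_gt0// pi_gt0.
move=> /andP[]; rewrite le_eqVlt => /predU1P[<- _|z0]; first by rewrite mulr0 sin0.
rewrite le_eqVlt => /predU1P[->|zp]; first by rewrite sin_pihalf mulVf// gt_eqF.
have dsin (x : R) : is_derive x (1 : R) (@sin R) (cos x) by exact: is_derive_sin.
have csin (x y : R) : {within `[x, y], continuous (@sin R)}.
  by apply: continuous_subspaceT; exact: continuous_sin.
have [c1] := MVT z0 (fun x _ => dsin x) (csin 0 z).
rewrite in_itv/= => /andP[c10 c1z] E1.
have [c2] := MVT zp (fun x _ => dsin x) (csin z (pi / 2)).
rewrite in_itv/= => /andP[zc2 c2p] E2.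
rewrite sin0 !subr0 in E1; rewrite sin_pihalf in E2.
have hpi : pi / 2 <= pi :> R by rewrite ler_pdivrMr// ler_peMr ?pi_ge0// ler1n.
have c2le : c2 <= pi by rewrite (le_trans (ltW c2p)).
have c12' : c1 < c2 by exact: lt_trans zc2.
have c12 : cos c2 <= cos c1.
  rewrite ltW// ltr_cos// in_itv/=.
    by rewrite (ltW c10) (le_trans (ltW c12')).
  by rewrite c2le andbT ltW// (lt_trans c10).
exact: chord h0 z0 zp E1 E2 c12.
Qed.

Lemma one_sub_cos_ge (y : R) : `|y| <= pi -> 2 / pi ^+ 2 * y ^+ 2 <= 1 - cos y.
Proof.
move=> ypi.
have cE : 1 - cos y = 2 * sin (`|y| / 2) ^+ 2.
  have -> : cos y = cos (`|y| / 2 *+ 2).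
    rewrite -mulr_natr divfK//.
    by have [y0|y0] := lerP 0 y; [rewrite ger0_norm|rewrite ltr0_norm// cosN].
  by rewrite cos_mulr2n; have := cos2Dsin2 (`|y| / 2); lra.
have js : (pi / 2)^-1 * (`|y| / 2) <= sin (`|y| / 2).
  by apply: jordan_sine; rewrite divr_ge0//= ler_pM2r ?invr_gt0.
have nn : 0 <= (pi / 2)^-1 * (`|y| / 2) :> R.
  by rewrite mulr_ge0 ?invr_ge0 ?divr_ge0// pi_ge0.
rewrite cE -mulrA ler_pM2l//.
have -> : (pi ^+ 2)^-1 * y ^+ 2 = ((pi / 2)^-1 * (`|y| / 2)) ^+ 2.
  have aux (p z : R) : 0 < p -> (p ^+ 2)^-1 * z ^+ 2 = ((p / 2)^-1 * (z / 2)) ^+ 2.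
    by move=> p0; field; rewrite gt_eqF.
  by rewrite -aux ?pi_gt0// -normrX ger0_norm ?sqr_ge0.
by rewrite ler_pXn2r ?nnegrE// (le_trans nn).
Qed.

Lemma one_sub_cos_le (y : R) : 1 - cos y <= y ^+ 2 / 2.
Proof.
have cE : 1 - cos y = 2 * sin (y / 2) ^+ 2.
  have -> : cos y = cos (y / 2 *+ 2) by rewrite -mulr_natr divfK.
  by rewrite cos_mulr2n; have := cos2Dsin2 (y / 2); lra.
have ss : sin (y / 2) ^+ 2 <= (y / 2) ^+ 2.
  have abs_sin (z : R) : 0 <= z -> `|sin z| <= z.
    move=> z0; rewrite -[leRHS]subr0 -[X in `|X|]subr0 -[X in _ - X]sin0.
    have dsin (x : R) : is_derive x (1 : R) (@sin R) (cos x) by exact: is_derive_sin.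
    have csin : {within `[0, z], continuous (@sin R)}.
      by apply: continuous_subspaceT; exact: continuous_sin.
    have [c _ ->] := MVT_segment z0 (fun x _ => dsin x) csin.
    by rewrite subr0 normrM (ger0_norm z0) ler_piMl// cos_max.
  have sinnorm : sin (y / 2) ^+ 2 = `|sin `|y / 2| | ^+ 2.
    rewrite -normrX ger0_norm ?sqr_ge0//.
    by have [y0|y0] := lerP 0 (y / 2); [rewrite ger0_norm|rewrite ltr0_norm// sinN sqrrN].
  rewrite sinnorm -[leRHS]ger0_norm ?sqr_ge0// normrX.
  by rewrite ler_pXn2r ?nnegrE//; exact: abs_sin.
rewrite cE.
have -> : y ^+ 2 / 2 = 2 * (y / 2) ^+ 2 by field.
by rewrite ler_pM2l.
Qed.

End cosine_lower_bound.

Section levy_characteristic_function.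
Context {R : realType}.
Notation mR := (measurableTypeR R).
Variable tr : levy_triplet R.
Notation nu := (levy_nu tr).

(** The part of - Re psi(u), for psi the characteristic exponent, due to the
jumps. *)
Definition jump_energy (u : R) : R := \int[nu]_x (1 - cos (u * x)).

Let m1cos (u : R) : measurable_fun [set: R] (fun x => 1 - cos (u * x)).
Proof.
apply: measurable_funB => //; apply: continuous_measurable_fun.
exact: continuous_cosM.
Qed.

(** 1 - cos(ux) is at most u^2 x^2 / 2 and at most 2, hence at most a multiple
of min(x^2, 1). *)
Lemma integrable_one_sub_cos u :
  nu.-integrable [set: mR] (fun x => (1 - cos (u * x))%:E).
Proof.
have [_ nufin] := levy_nuP tr.
apply/integrableP; split; first by apply/measurable_EFinP; exact: m1cos.
pose K : R := Num.max (u ^+ 2 / 2) 2.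
have K0 : 0 <= K by rewrite le_max ler0n orbT.
apply: (@le_lt_trans _ _ (K%:E * \int[nu]_x (Num.min (x ^+ 2) 1)%:E)%E); last first.
  rewrite lte_mul_pinfty//.
have mmin : measurable_fun [set: mR] (fun x : R => Num.min (x ^+ 2) 1).
  by apply: measurable_minr => //; exact: measurable_funX.
have min0 (x : R) : 0 <= Num.min (x ^+ 2) 1 by rewrite le_min sqr_ge0 ler01.
rewrite -ge0_integralZl//; last 2 first.
- exact/measurable_EFinP.
- by move=> x _; rewrite lee_fin.
apply: ge0_le_integral => //.
- by apply: measurableT_comp => //; apply/measurable_EFinP; exact: m1cos.
- by apply: emeasurable_funM => //; exact/measurable_EFinP.
move=> x _; rewrite /= ger0_norm// lee_fin.
have [x1|x1] := lerP (x ^+ 2) 1.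
  rewrite (le_trans (one_sub_cos_le _))// exprMn mulrAC ler_wpM2r ?sqr_ge0//.
  by rewrite le_max lexx.
rewrite mulr1 (@le_trans _ _ 2)//; last by rewrite le_max lexx orbT.
have := cos_geN1 (u * x); lra.
Qed.

Lemma jump_energy_ge0 u : 0 <= jump_energy u.
Proof. by apply: Rintegral_ge0 => x _. Qed.

Lemma Re_levy_exponent t u : complex.Re (levy_exponent tr t u) =
  - (t * sigma tr ^+ 2 * u ^+ 2 / 2) - t * jump_energy u.
Proof.
rewrite /levy_exponent /cintegral /jump_energy /= mul0r subr0 sub0r; congr (_ + _).
rewrite -mulrN; congr (_ * _).
have -> : \int[nu]_x (expR 0 * cos (u * x) - 1 - 0) =
    \int[nu]_x (-1 * (1 - cos (u * x))).
  by apply: eq_Rintegral => x _; rewrite expR0; ring.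
by rewrite RintegralZl ?mulN1r//; exact: integrable_one_sub_cos.
Qed.

(** Restricting to |x| <= eta := pi / |u| keeps |ux| <= pi, where the quadratic
lower bound for 1 - cos holds; the condition on the truncated second moment is
available at this eta because |u| >= pi. *)
Lemma jump_energy_ge (M al : R) (u : R) : 0 < M -> T_class M al tr -> pi <= `|u| ->
  2 * M * (`|u| / pi) `^ al <= jump_energy u.
Proof.
move=> M0 [p [dp cA]] piu.
have pi0 := pi_gt0 R.
have u0 : 0 < `|u| by exact: lt_le_trans piu.
pose eta : R := pi / `|u|.
have eta0 : 0 < eta by rewrite divr_gt0.
have eta1 : eta <= 1 by rewrite ler_pdivrMr// mul1r.
pose I : set R := `[- eta, eta]%classic.
have mI : measurable (I : set mR) by exact: measurable_itv.
pose c : R := 2 / pi ^+ 2 * u ^+ 2.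
have c0 : 0 <= c by rewrite mulr_ge0 ?sqr_ge0// divr_ge0// sqr_ge0.
pose g (x : R) : R := \1_I x * (c * x ^+ 2).
have mg : measurable_fun [set: R] g.
  apply: measurable_funM; first exact: measurable_indic.
  by apply: measurable_funM => //; exact: measurable_funX.
have g0 x : 0 <= g x by rewrite mulr_ge0// mulr_ge0// sqr_ge0.
rewrite -lee_fin /jump_energy /Rintegral fineK; last first.
  by apply: integrable_fin_num => //; exact: integrable_one_sub_cos.
apply: (@le_trans _ _ (\int[nu]_x (g x)%:E)%E); last first.
  apply: ge0_le_integral => //.
  - by move=> x _; rewrite lee_fin.
  - exact/measurable_EFinP.
  - by apply/measurable_EFinP; exact: m1cos.
  move=> x _; rewrite lee_fin /g indicE mem_setE in_itv/=.
  case: (boolP (- eta <= x <= eta)) => [xeta|_]; last by rewrite mul0r.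
  rewrite mul1r /c.
  have -> : 2 / pi ^+ 2 * u ^+ 2 * x ^+ 2 = 2 / pi ^+ 2 * (u * x) ^+ 2.
    by rewrite exprMn [RHS]mulrA.
  apply: one_sub_cos_ge.
  rewrite normrM mulrC -ler_pdivlMr//.
  by rewrite ler_norml.
rewrite (ge0_integral_density dp mg g0).
have [mp p0 _] := dp.
have -> : (\int[@lebesgue_measure R]_x (g x * p x)%:E =
    c%:E * \int[@lebesgue_measure R]_(x in I) (x ^+ 2 * p x)%:E)%E.
  rewrite -ge0_integralZl//; last 2 first.
  - apply/measurable_EFinP/measurable_funTS.
    by apply: measurable_funM; [exact: measurable_funX|exact: mp].
  - by move=> x _; rewrite lee_fin mulr_ge0// sqr_ge0.
  rewrite [RHS]integral_mkcond; apply: eq_integral => x _; rewrite patchE /g indicE.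
  by case: (x \in I); rewrite ?mul1r ?mul0r// -EFinM !mulrA.
have eta01 : 0 < eta <= 1 by rewrite eta0 eta1.
have c0E : (0 <= c%:E)%E by rewrite lee_fin.
apply: le_trans (lee_wpmul2l c0E (cA eta eta01)).
rewrite -EFinM lee_fin le_eqVlt; apply/orP; left; apply/eqP.
(* the powers of pi and |u| combine into 2 M q^2 q^(al - 2) *)
pose q := `|u| / pi.
have q0 : 0 < q by rewrite divr_gt0.
have etaE : eta = q^-1 by rewrite /q invf_div.
have cE : c = 2 * q ^+ 2.
  rewrite /c /q -(ger0_norm (sqr_ge0 u)) normrX.
  have aux (P U : R) : 0 < P -> 2 / P ^+ 2 * U ^+ 2 = 2 * (U / P) ^+ 2.
    by move=> P0; field; rewrite gt_eqF.
  exact: aux.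
rewrite -/q etaE cE -(powR_inv1 (ltW q0)) -powRrM mulN1r opprB.
have -> : q `^ (al - 2) = q `^ al / q ^+ 2.
  rewrite powRB; last by apply/implyP => _; rewrite gt_eqF.
  by rewrite (powR_mulrn 2 (ltW q0)).
field.
by rewrite gt_eqF.
Qed.

End levy_characteristic_function.

Section increment_characteristic_function.
Context {R : realType} {d : measure_display} {Omega : measurableType d}.
Variable P : probability Omega R.
Variables (X : R -> {RV P >-> R}) (tr : levy_triplet R).
Hypothesis Xtr : has_triplet X tr.
Variable t : R.
Hypothesis t0 : 0 < t.

Let energy u := cos_mean P (X t) u ^+ 2 + sin_mean P (X t) u ^+ 2.

(** The squared modulus of exp(psi) is exp(2 Re psi). *)
Lemma energyE u : energy u =
  expR (- (t * sigma tr ^+ 2 * u ^+ 2) - 2 * t * jump_energy tr u).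
Proof.
have [Ere Eim] := Xtr u (ltW t0).
have -> : - (t * sigma tr ^+ 2 * u ^+ 2) - 2 * t * jump_energy tr u =
    2 * complex.Re (levy_exponent tr t u) by rewrite Re_levy_exponent; field.
have cmE : cos_mean P (X t) u = complex.Re (cexp (levy_exponent tr t u)).
  rewrite /= -Ere; apply: eq_Rintegral => w _.
  by rewrite expR0 mul1r.
have smE : sin_mean P (X t) u = complex.Im (cexp (levy_exponent tr t u)).
  rewrite /= -Eim; apply: eq_Rintegral => w _.
  by rewrite expR0 mul1r.
rewrite /energy cmE smE /= !exprMn -mulrDr cos2Dsin2 mulr1.
by rewrite -expRM_natl.
Qed.

Let gaussian_part u : 0 <= t * sigma tr ^+ 2 * u ^+ 2.
Proof. exact: mulr_ge0 (mulr_ge0 (ltW t0) (sqr_ge0 _)) (sqr_ge0 _). Qed.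

Let jump_part u : 0 <= 2 * t * jump_energy tr u.
Proof. by apply: mulr_ge0; [rewrite mulr_ge0// ltW|exact: jump_energy_ge0]. Qed.

Lemma energy_le1 u : energy u <= 1.
Proof.
rewrite energyE -[leRHS]expR0 ler_expR -opprD oppr_le0; exact: addr_ge0.
Qed.

Lemma energy_le_gaussian u : energy u <= stretched_exp (t * sigma tr ^+ 2) 2 `|u|.
Proof.
rewrite energyE /stretched_exp powR_mulrn// -normrX ger0_norm ?sqr_ge0//.
by rewrite ler_expR gerBl.
Qed.

(** The exponent obtained from [jump_energy_ge] is 4 t M (|u| / pi)^alpha, and
2^alpha <= 4. *)
Lemma energy_le_stable M al u : 0 < M -> 0 < al < 2 -> T_class M al tr -> pi <= `|u| ->
  energy u <= stretched_exp (stable_rate t M al) al `|u|.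
Proof.
move=> M0 /andP[a0 a2] trT piu; have jl := jump_energy_ge M0 trT piu.
have pi0 := pi_gt0 R.
rewrite energyE /stretched_exp ler_expR /stable_rate.
have pw : (2 / pi) `^ al * `|u| `^ al = 2 `^ al * (`|u| / pi) `^ al.
  have E : 2 / pi * `|u| = 2 * (`|u| / pi) by rewrite -!mulrA (mulrC `|u|).
  have q1 : 0 <= 2 / pi :> R by rewrite divr_ge0// ltW.
  have q2 : 0 <= `|u| / pi by rewrite divr_ge0// ltW.
  by rewrite -(powRM _ q1 (normr_ge0 u)) E (powRM _ _ q2).
have -> : M * t * (2 / pi) `^ al * `|u| `^ al = t * (M * (2 `^ al * (`|u| / pi) `^ al)).
  by rewrite -pw [M * t]mulrC -!mulrA.
have p4 : 2 `^ al <= 4 :> R.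
  have -> : 4 = 2 `^ 2%:R :> R by rewrite powR_mulrn// -natrX.
  by apply: ler_powR; rewrite ?ler1n// ltW.
have q0 : 0 <= (`|u| / pi) `^ al by exact: powR_ge0.
have H1 : 2 `^ al * (`|u| / pi) `^ al <= 4 * (`|u| / pi) `^ al by rewrite ler_wpM2r.
have H2 : M * (2 `^ al * (`|u| / pi) `^ al) <= 2 * jump_energy tr u.
  apply: (@le_trans _ _ (M * (4 * (`|u| / pi) `^ al))); first by rewrite ler_pM2l.
  by move: jl; move: ((`|u| / pi) `^ al) (jump_energy tr u) => A B; lra.
have H3 : t * (M * (2 `^ al * (`|u| / pi) `^ al)) <= t * (2 * jump_energy tr u).
  by rewrite ler_pM2l.
have jE : 2 * t * jump_energy tr u = t * (2 * jump_energy tr u) by ring.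
by rewrite -opprD lerN2 (le_trans H3)// jE lerDr.
Qed.

End increment_characteristic_function.

(** * The estimator as a mean of window kernels *)

Section estimator.
Context {R : realType} {d : measure_display} {Omega : measurableType d}.
Variable P : probability Omega R.
Notation mu := (@lebesgue_measure R).
Notation mR := (measurableTypeR R).
Variables (X : R -> {RV P >-> R}) (Delta : R) (n : nat) (m : R).

Definition increment (j : nat) (w : Omega) : R := X (j.+1%:R * Delta) w - X (j%:R * Delta) w.

Let integrable_trig (h : R -> R) : continuous h -> (forall y, `|h y| <= 1) -> forall y,
  mu.-integrable `[- m, m] (fun u => (h (u * y))%:E).
Proof.
move=> ch h1 y.
have muI : (mu `[(- m)%R, m] < +oo)%E by rewrite lebesgue_measure_itv/=; case: ifP => _; rewrite ?ltry.
apply: measurable_bounded_integrable => //.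
  apply: measurable_funTS; apply: (measurableT_comp (f := h)).
    exact: continuous_measurable_fun.
  exact: measurable_funM.
by exists 1; split => // z z1 u _; apply: le_trans (h1 _) (ltW z1).
Qed.

Let integral_mean (h : R -> R) : continuous h -> (forall y, `|h y| <= 1) ->
  forall y : 'I_n -> R,
  \int[mu]_(u in `[- m, m]) (n%:R^-1 * \sum_(j < n) h (u * y j)) =
  n%:R^-1 * \sum_(j < n) \int[mu]_(u in `[- m, m]) h (u * y j).
Proof.
move=> ch h1 y.
have sum_split (s : seq 'I_n) :
    mu.-integrable `[- m, m] (fun u => (\sum_(j <- s) h (u * y j))%:E) /\
    \int[mu]_(u in `[- m, m]) (\sum_(j <- s) h (u * y j)) =
    \sum_(j <- s) \int[mu]_(u in `[- m, m]) h (u * y j).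
  elim: s => [|j s [IHi IHe]].
    split.
      rewrite (_ : (fun u => _) = cst 0%E); first exact: integrable0.
      by apply/funext => u; rewrite big_nil.
    rewrite big_nil -[RHS](mul0r (fine (mu `[- m, m]%classic))) -Rintegral_cst//.
    by apply: eq_Rintegral => u _; rewrite big_nil.
  have ij := integrable_trig ch h1 (y j).
  split.
    rewrite (_ : (fun u => _) =
      (fun u => (h (u * y j))%:E + (\sum_(j <- s) h (u * y j))%:E)%E).
      exact: integrableD.
    by apply/funext => u; rewrite big_cons.
  rewrite big_cons -IHe -RintegralD//.
  by apply: eq_Rintegral => u _; rewrite big_cons.
by have [i e] := sum_split (index_enum 'I_n); rewrite RintegralZl// e.
Qed.

Lemma integral_sin_sym y : \int[mu]_(u in `[- m, m]) sin (u * y) = 0.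
Proof.
rewrite Rintegral_mkcond; apply: Rintegral_odd.
  rewrite -restrict_EFin; apply/integrable_restrict => //; rewrite ?setTI.
  by apply: integrable_trig; [exact: continuous_sin|exact: sin_max].
move=> u; rewrite !patchE !mem_setE !in_itv/= lerN2 lerNl andbC.
by case: ifP => _; rewrite ?oppr0// mulNr sinN.
Qed.

(** The imaginary part vanishes because the sine is odd and the window
symmetric. *)
Lemma f_hatE w x : f_hat X Delta n m w x =
  ((n%:R^-1 * \sum_(j < n) window_kernel m (increment j w - x)) +i* 0)%C.
Proof.
have ciexpD (s t : R) : ciexp s * ciexp t = ciexp (s + t).
  rewrite /ciexp /cexp /= expR0 !mul1r cosD sinD; congr (_ +i* _)%C; ring.
have invn : (n%:R : R[i])^-1 = (n%:R^-1)%:C%C by rewrite fmorphV rmorph_nat.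
have phiE (u : R) : phi_hat X Delta n w u * ciexp (- (u * x)) =
    ((n%:R^-1 * \sum_(j < n) cos (u * (increment j w - x))) +i*
     (n%:R^-1 * \sum_(j < n) sin (u * (increment j w - x))))%C.
  rewrite /phi_hat -mulrA mulr_suml invn.
  have -> : \sum_(j < n) ciexp (u * (X (j.+1%:R * Delta) w - X (j%:R * Delta) w)) *
      ciexp (- (u * x)) =
    ((\sum_(j < n) cos (u * (increment j w - x))) +i*
     (\sum_(j < n) sin (u * (increment j w - x))))%C.
    elim/big_ind3: _ => // [a b c a' b' c' -> ->//|j _].
    by rewrite ciexpD -mulrBr -/(increment j w) /ciexp /cexp/= expR0 !mul1r.
  by rewrite /GRing.mul/= !mul0r subr0 addr0.
rewrite /f_hat /cintegral.
have -> : \int[mu]_(u in `[- m, m]) complex.Re (phi_hat X Delta n w u * ciexp (- (u * x))) =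
    n%:R^-1 * \sum_(j < n) \int[mu]_(u in `[- m, m]) cos (u * (increment j w - x)).
  rewrite -integral_mean; [|exact: continuous_cos|exact: cos_max].
  by apply: eq_Rintegral => u _; rewrite phiE.
have -> : \int[mu]_(u in `[- m, m]) complex.Im (phi_hat X Delta n w u * ciexp (- (u * x))) = 0.
  transitivity (\int[mu]_(u in `[- m, m])
    (n%:R^-1 * \sum_(j < n) sin (u * (increment j w - x)))).
    by apply: eq_Rintegral => u _; rewrite phiE.
  rewrite integral_mean; [|exact: continuous_sin|exact: sin_max].
  by rewrite big1 ?mulr0// => j _; exact: integral_sin_sym.
rewrite /window_kernel -mulr_sumr mulrCA.
by rewrite /GRing.mul/= !mul0r !mulr0 subr0 addr0.
Qed.

Lemma L2norm_sqE (g : R -> R[i]) :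
  (L2norm_sq g = \int[mu]_x (Normc.normc (g x) ^+ 2)%:E)%E.
Proof.
have sq (x : \bar R) : (0 <= x -> x ^+ 2 = x `^ 2)%E.
  case: x => [r||]//.
  - by rewrite lee_fin => r0; rewrite poweR_EFin powR_mulrn.
  - by move=> _; rewrite poweRyr// expe2 mulyy.
rewrite /L2norm_sq sq ?Lnorm_ge0// poweR_Lnorm//.
apply: eq_integral => x _ /=; rewrite powR_mulrn//.
by rewrite -normrX ger0_norm// sqr_ge0.
Qed.

Lemma L2riskE (f : R -> R) :
  (L2risk X Delta n m f = \int[P]_w \int[mu]_x
    ((n%:R^-1 * \sum_(j < n) window_kernel m (increment j w - x) - f x) ^+ 2)%:E)%E.
Proof.
apply: eq_integral => w _; rewrite L2norm_sqE; apply: eq_integral => x _; congr EFin.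
rewrite f_hatE /= subr0 expr0n addr0 sqr_sqrtr// sqr_ge0//.
Qed.

End estimator.

(** * Risk of the estimator and rates at the optimal cutoff *)

Section levy_increments.
Context {R : realType} {d : measure_display} {Omega : measurableType d}.
Variable P : probability Omega R.
Notation mR := (measurableTypeR R).

(** The product rule over the whole family, with full events outside the two
chosen indices. *)
Lemma pairwise_independent (n : nat) (Y : 'I_n -> Omega -> R) (i j : 'I_n) (A B : set mR) :
  (forall k, measurable_fun [set: Omega] (Y k)) -> independent_family P Y -> i != j ->
  measurable A -> measurable B ->
  (P (Y i @^-1` A `&` Y j @^-1` B) = P (Y i @^-1` A) * P (Y j @^-1` B))%E.
Proof.
move=> mY indY ij mA mB.
pose C (k : 'I_n) : set mR := if k == i then A else if k == j then B else setT.
have mC k : measurable (C k) by rewrite /C; case: eqP => // _; case: eqP.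
have ji : (j == i) = false by rewrite eq_sym; exact/negbTE.
have -> : Y i @^-1` A `&` Y j @^-1` B = \bigcap_(k in [set: 'I_n]) (Y k @^-1` C k).
  apply/seteqP; split => w /=.
    by move=> [Ai Bj] k _; rewrite /C; case: eqP => [->//|_]; case: eqP => [->//|].
  move=> H; split.
    by have := H i I; rewrite /C /= eqxx.
  by have := H j I; rewrite /C /= ji eqxx.
rewrite (indY C mC) (bigD1 i)//= (bigD1 j)/=; last by rewrite eq_sym.
rewrite big1 ?mule1; first by rewrite /C eqxx ji eqxx.
move=> k /andP[/negbTE ki /negbTE kj]; rewrite /C ki kj preimage_setT.
exact: probability_setT.
Qed.

Variables (X : R -> {RV P >-> R}) (Delta : R).
Hypothesis levyX : levy_process X.
Hypothesis Delta0 : 0 < Delta.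

Lemma measurable_increment j : measurable_fun [set: Omega] (increment X Delta j).
Proof. by apply: measurable_funB; exact: measurable_funP. Qed.

Lemma increment_law j (A : set mR) : measurable A ->
  P (increment X Delta j @^-1` A) = P (X Delta @^-1` A).
Proof.
move=> mA; have [_ _ st _ _] := levyX.
rewrite -(st (j%:R * Delta) Delta _ (ltW Delta0) A mA); last first.
  by rewrite mulr_ge0// ltW.
by rewrite /increment -natr1 mulrDl mul1r.
Qed.

Lemma increments_independent n : independent_family P (fun (j : 'I_n) => increment X Delta j).
Proof.
have [_ ind _ _ _] := levyX.
apply: (ind n (fun i => i%:R * Delta)); first by rewrite mul0r.
by move=> i; rewrite ler_wpM2r ?ler_nat// ltW.
Qed.

Variables (n : nat) (f : R -> R) (kap al u0 m : R).
Hypothesis n0 : (0 < n)%N.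
Hypothesis densf : has_density (distribution P (X Delta)) f.
Hypothesis kap0 : 0 < kap.
Hypothesis al0 : 0 < al.
Hypothesis u0_ge0 : 0 <= u0.
Hypothesis m0 : 0 <= m.
Hypothesis energy_le1 : forall u,
  cos_mean P (X Delta) u ^+ 2 + sin_mean P (X Delta) u ^+ 2 <= 1.
Hypothesis energy_le : forall u, u0 <= `|u| ->
  cos_mean P (X Delta) u ^+ 2 + sin_mean P (X Delta) u ^+ 2 <= stretched_exp kap al `|u|.

(** Pairwise independent, identically distributed increments and an integrable
characteristic function put the estimator under [projection_risk_le]; the bound
on the squared modulus of the characteristic function then controls its bias
term. *)
Theorem L2risk_le : (L2risk X Delta n m f <=
  (tail_mass kap al m + (if m < u0 then u0 / pi else 0) + m / (pi * n%:R))%:E)%E.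
Proof.
have mX : measurable_fun [set: Omega] (X Delta) by exact: measurable_funP.
have [mf f0 fE] := densf.
have ia := cos_mean_integrable mX kap0 al0 u0_ge0 energy_le1 energy_le.
have ib := sin_mean_integrable mX kap0 al0 u0_ge0 energy_le1 energy_le.
rewrite L2riskE EFinD.
apply: le_trans (leeD (tail_energy_le mX kap0 al0 energy_le1 energy_le m0) (lexx _)).
apply: (projection_risk_le (Y := fun j : 'I_n => increment X Delta j) n0 _ mX _ _ ia ib mf f0 _ m0).
- by move=> j; exact: measurable_increment.
- by move=> j A mA; exact: increment_law.
- move=> i j A B ij mA mB; exact: (pairwise_independent (fun k : 'I_n => measurable_increment k)
    (@increments_independent n) ij mA mB).
- exact: fE.
Qed.

End levy_increments.

Lemma eq_unique_minimizer (R : realType) (g h : R -> R) (x y : R) :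
  (forall m, 0 <= m -> g m = h m) -> x = y ->
  unique_minimizer_ge0 h y -> unique_minimizer_ge0 g x.
Proof.
move=> gh -> [y0 hy]; split => // m m0 my.
by rewrite !gh//; exact: hy.
Qed.

Section optimal_cutoff_risk.
Context {R : realType} {d : measure_display} {Omega : measurableType d}.
Variable P : probability Omega R.
Variables (X : R -> {RV P >-> R}) (tr : levy_triplet R).
Hypothesis levyX : levy_process X.
Hypothesis Xtr : has_triplet X tr.

Let risk_constant (al : R) : R := 2 * tail_mass (ln 2) al 1 + pi^-1.

Let risk_constant_gt0 al : 0 < risk_constant al.
Proof.
by rewrite ltr_wpDl ?invr_gt0 ?pi_gt0// mulr_ge0// tail_mass_ge0.
Qed.

Let critical_risk (kap al : R) n : 0 < kap -> 0 < al -> (2 <= n)%N ->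
  tail_mass kap al (critical_cutoff kap al n) + critical_cutoff kap al n / (pi * n%:R) <=
  risk_constant al * (critical_cutoff kap al n / n%:R).
Proof.
move=> k0 a0 n2; rewrite /risk_constant (mulrDl (2 * tail_mass (ln 2) al 1)); apply: lerD.
  exact: tail_mass_critical_le.
by rewrite (invfM pi) mulrCA mulrA.
Qed.

Lemma cutoff1_rate (Delta sg : R) n : 0 < Delta -> 0 < sg -> (2 <= n)%N ->
  cutoff1 Delta sg n / n%:R = sg * rate1 Delta sg n :> R.
Proof.
move=> D0 s0 n2; rewrite /cutoff1 /rate1.
have L0 : 0 <= ln n%:R :> R by rewrite ln_ge0// ler1n (leq_trans _ n2).
have nn0 : n%:R != 0 :> R by rewrite pnatr_eq0 -lt0n (leq_trans _ n2).
rewrite sqrtrM// sqrtrV ?mulr_ge0 ?sqr_ge0 ?ltW// sqrtrM ?ltW// sqrtr_sqr gtr0_norm//.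
have Ds : Num.sqrt Delta != 0 by rewrite gt_eqF// sqrtr_gt0.
field.
by rewrite nn0 Ds gt_eqF.
Qed.

Lemma cutoff2_rate (Delta M al : R) n : 0 < M * Delta -> (2 <= n)%N ->
  cutoff2 Delta M al n / n%:R = pi / 2 * rate2 Delta M al n :> R.
Proof.
move=> MD0 n2; rewrite /cutoff2 /rate2.
have L0 : 0 <= ln n%:R :> R by rewrite ln_ge0// ler1n (leq_trans _ n2).
have split_ratio (p L D N e : R) : 0 <= L -> 0 < D ->
    p * (L / D) `^ e / N = p * (L `^ e / (N * D `^ e)).
  move=> L0' D0; rewrite powRM//; last by rewrite invr_ge0 ltW.
  have -> : D^-1 `^ e = (D `^ e)^-1 by rewrite -powR_inv1 ?ltW// powRAC powR_inv1 ?powR_ge0.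
  by rewrite (invfM N) (mulrC N^-1) !mulrA.
exact: split_ratio.
Qed.

Lemma risk_T_plus : T_plus tr -> exists C : R, 0 < C /\
  forall (Delta : R) n, 0 < Delta -> (2 <= n)%N ->
  forall f : R -> R, has_density (distribution P (X Delta)) f ->
    (L2risk X Delta n (cutoff1 Delta (sigma tr) n) f
     <= (C * rate1 Delta (sigma tr) n)%:E)%E.
Proof.
move=> sg2.
have s0 : 0 < sigma tr.
  rewrite lt_neqAle sigma_ge0 andbT eq_sym; apply: contraTneq sg2 => ->.
  by rewrite /T_plus /= expr0n ltxx.
exists (risk_constant 2 * sigma tr); split; first by rewrite mulr_gt0.
move=> Delta n D0 n2 f densf.
have kap0 : 0 < Delta * sigma tr ^+ 2 by rewrite mulr_gt0// exprn_gt0.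
have c0 : 0 <= cutoff1 Delta (sigma tr) n by rewrite /cutoff1 sqrtr_ge0.
have n0 : (0 < n)%N by rewrite (leq_trans _ n2).
apply: (le_trans (L2risk_le levyX D0 n0 densf kap0 (ltr0n R 2) (lexx 0) c0
  (energy_le1 Xtr D0) (fun u _ => energy_le_gaussian Xtr D0 u))).
rewrite lee_fin ltNge c0/= addr0 -mulrA -(cutoff1_rate D0 s0 n2) (cutoff1E (ltW kap0) n2).
exact: critical_risk.
Qed.

(** The cutoff is below pi only if log n < 2^alpha M Delta, which bounds n; and
log n >= log 2 bounds the numerator of the rate from below. *)
Lemma small_cutoff_rate (Delta D M al : R) n : 0 < Delta -> Delta <= D -> 0 < M -> 0 < al ->
  (2 <= n)%N -> cutoff2 Delta M al n < pi ->
  (ln 2 / (M * D)) `^ al^-1 / expR (2 `^ al * (M * D)) <= rate2 Delta M al n :> R.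
Proof.
move=> D0 DD M0 al0 n2 small.
have n0 : 0 < n%:R :> R by rewrite ltr0n (leq_trans _ n2).
have MD0 : 0 < M * Delta by rewrite mulr_gt0.
have MD : M * Delta <= M * D by rewrite ler_wpM2l// ltW.
have MDb : 0 < M * D by exact: lt_le_trans MD0 MD.
have l2 : 0 <= ln 2 :> R by rewrite ln_ge0// ler1n.
have L0 : 0 <= ln n%:R :> R by rewrite ln_ge0// ler1n (leq_trans _ n2).
have rateE : rate2 Delta M al n = (ln n%:R / (M * Delta)) `^ al^-1 / n%:R :> R.
  have p2 : pi / 2 != 0 :> R by rewrite gt_eqF// divr_gt0// pi_gt0.
  apply: (mulfI p2); rewrite -cutoff2_rate// /cutoff2.
  by rewrite mulrA.
have Lle : ln n%:R <= 2 `^ al * (M * D).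
  have q0 : 0 <= ln n%:R / (M * Delta) by rewrite divr_ge0// ltW.
  have : (ln n%:R / (M * Delta)) `^ al^-1 < 2.
    have := small; rewrite /cutoff2 mulrAC ltr_pdivrMr// => H.
    by rewrite -(ltr_pM2l (pi_gt0 R)).
  move=> /ltW /(@ge0_ler_powR R al (ltW al0) _ _ (powR_ge0 _ _) (ler0n _ 2)).
  rewrite -powRrM mulVf ?gt_eqF// powRr1// ler_pdivrMr// => H.
  by apply: (le_trans H); rewrite ler_wpM2l ?powR_ge0.
rewrite rateE; apply: ler_pM.
- exact: powR_ge0.
- by rewrite invr_ge0 expR_ge0.
- apply: ge0_ler_powR.
  + by rewrite invr_ge0 ltW.
  + by rewrite nnegrE divr_ge0// ltW.
  + by rewrite nnegrE divr_ge0// ltW.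
  + apply: ler_pM => //.
    * by rewrite invr_ge0 ltW.
    * by rewrite ler_ln ?posrE ?ler_nat.
    * by rewrite lef_pV2 ?posrE.
- by rewrite lef_pV2 ?posrE ?expR_gt0// -(lnK n0) ler_expR.
Qed.

(** The second summand of the constant pays for the frequencies below pi when
the cutoff is smaller than pi. The constant depends on the step only through its
upper bound [D], which is what the case of vanishing steps requires. *)
Lemma risk_T_class (M al D : R) : 0 < M -> 0 < al < 2 -> T_class M al tr -> 0 < D ->
  exists C : R, 0 < C /\
  forall (Delta : R) n, 0 < Delta -> Delta <= D -> (2 <= n)%N ->
  forall f : R -> R, has_density (distribution P (X Delta)) f ->
    (L2risk X Delta n (cutoff2 Delta M al n) f <= (C * rate2 Delta M al n)%:E)%E.
Proof.
move=> M0 al02 trM Dpos; have /andP[al0 _] := al02.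
pose r : R := (ln 2 / (M * D)) `^ al^-1 / expR (2 `^ al * (M * D)).
have r0 : 0 < r.
  by rewrite divr_gt0 ?expR_gt0// powR_gt0// divr_gt0 ?mulr_gt0// ln_gt0// ltr1n.
have pi2 : 0 < pi / 2 :> R by rewrite divr_gt0// pi_gt0.
exists (risk_constant al * (pi / 2) + r^-1); split.
  by apply: addr_gt0; [exact: mulr_gt0 | rewrite invr_gt0].
move=> Delta n D0 DD n2 f densf.
have MD0 : 0 < M * Delta by rewrite mulr_gt0.
have kap0 := stable_rate_gt0 al MD0.
have c0 : 0 <= cutoff2 Delta M al n by rewrite mulr_ge0 ?powR_ge0// ltW.
have n0 : (0 < n)%N by rewrite (leq_trans _ n2).
apply: (le_trans (L2risk_le levyX D0 n0 densf kap0 al0 (pi_ge0 R) c0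
  (energy_le1 Xtr D0) (fun u => @energy_le_stable _ _ _ _ _ _ Xtr _ D0 M al u M0 al02 trM))).
rewrite lee_fin addrAC (mulrDl (risk_constant al * (pi / 2))); apply: lerD.
  by rewrite -mulrA -(cutoff2_rate al MD0 n2) (cutoff2E MD0 al0 n2); exact: critical_risk.
case: ifPn => [small|_].
  rewrite divff ?gt_eqF ?pi_gt0// mulrC ler_pdivlMr// mul1r.
  exact: small_cutoff_rate.
by rewrite mulr_ge0 ?invr_ge0 ?(ltW r0)// /rate2 divr_ge0 ?powR_ge0// mulr_ge0 ?powR_ge0.
Qed.

End optimal_cutoff_risk.

Lemma bounded_steps (R : realType) (Delta : nat -> R) : (forall n, 0 < Delta n) ->
  (exists Delta0 : R, forall n, Delta n = Delta0) \/ Delta @ \oo --> (0 : R) ->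
  exists2 D : R, 0 < D & forall n, Delta n <= D.
Proof.
move=> D0 [[D DE]|Dcv].
  by exists D => [|n]; [rewrite -(DE 0%N) | rewrite DE].
have /cvg_seq_bounded/bounded_fun_has_ubound[B BP] : cvgn Delta by apply/cvg_ex; exists 0.
have DB n : Delta n <= B by apply: BP; exists n.
by exists B => //; exact: lt_le_trans (D0 0%N) (DB 0%N).
Qed.

Theorem theorem2 (R : realType) (d : measure_display)
    (Omega : measurableType d) (P : probability Omega R)
    (X : R -> {RV P >-> R}) (tr : levy_triplet R) :
  levy_process X -> has_triplet X tr ->
  forall Delta : nat -> R, (forall n, 0 < Delta n) ->
  (exists Delta0 : R, forall n, Delta n = Delta0) \/ Delta @ \oo --> (0 : R) ->
  (T_plus tr ->
     (forall n, (2 <= n)%N ->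
        unique_minimizer_ge0
          (fun m => bias1_sq (Delta n) (sigma tr) m + variance_bound n m)
          (cutoff1 (Delta n) (sigma tr) n)) /\
     (exists C : R, 0 < C /\
        forall n, (2 <= n)%N ->
        forall f : R -> R, has_density (distribution P (X (Delta n))) f ->
          (L2risk X (Delta n) n (cutoff1 (Delta n) (sigma tr) n) f
           <= (C * rate1 (Delta n) (sigma tr) n)%:E)%E)) /\
  (forall M alpha : R, 0 < M -> 0 < alpha < 2 -> T_zero M alpha tr ->
     (forall n, (2 <= n)%N ->
        unique_minimizer_ge0
          (fun m => bias2_sq (Delta n) M alpha m + variance_bound n m)
          (cutoff2 (Delta n) M alpha n)) /\
     (exists C : R, 0 < C /\
        forall n, (2 <= n)%N ->
        forall f : R -> R, has_density (distribution P (X (Delta n))) f ->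
          (L2risk X (Delta n) n (cutoff2 (Delta n) M alpha n) f
           <= (C * rate2 (Delta n) M alpha n)%:E)%E)).
Proof.
move=> levyX Xtr Delta D0 Dbnd.
have [D Dpos DD] := bounded_steps D0 Dbnd.
split=> [sg2|M alpha M0 al02 [trM _]]; split.
- move=> n n2; have kap0 : 0 < Delta n * sigma tr ^+ 2 by rewrite mulr_gt0.
  apply: eq_unique_minimizer (tail_mass_minimizer kap0 (ltr0n R 2) n2).
    by move=> m m0; rewrite bias1_sqE.
  exact: (cutoff1E (ltW kap0) n2).
- have [C [C0 CP]] := risk_T_plus levyX Xtr sg2.
  by exists C; split=> // n n2 f; exact: CP.
- move=> n n2; have /andP[al0 _] := al02.
  have MD0 : 0 < M * Delta n by rewrite mulr_gt0.
  apply: eq_unique_minimizer (tail_mass_minimizer (stable_rate_gt0 alpha MD0) al0 n2).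
    by move=> m m0; rewrite bias2_sqE.
  exact: (cutoff2E MD0 al0 n2).
- have [C [C0 CP]] := risk_T_class levyX Xtr M0 al02 trM Dpos.
  by exists C; split=> // n n2 f; exact: CP.
Qed.
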